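(* Let $V$ be a function on $[0,\infty)$ such that (a) $V$ is $C^1$ on $[0,\infty)$; (b) $V$ is positive and strictly monotone decreasing, indeed $V'(x)<0$; (c) $\lim_{x\to\infty}V(x)=0$. Let $d\mu$ be the spectral measure of $H=-\frac{d^2}{dx^2}+V(x)$ on $L^2([0,\infty))$ with boundary condition $u(0)=0$, so that $d\mu$ is purely absolutely continuous on $(0,\infty)$ and $d\mu(E)=e^{-2Q(E)}\,dE$ there. For $0<E<V(0)$ define $N(E)=V^{-1}(E)$, so that $V(x)>E$ if $x<N(E)$ and $V(x)<E$ if $x>N(E)$. For $x<N(E)$ define $\gamma(x,E)=(V(x)-E)^{1/2}$. Then for $0<E<V(0)$, $$|Q(E)-g(E)|\le h(E),\qquad g(E)=\int_0^{N(E)}\gamma(x,E)\,dx,$$ where $h(E)$ is given by $$e^{h(E)}=C\,N(E)\,\bigl(V(N(E))-V(N(E)+1)\bigr)^{-1}E^{1/2}$$ for a constant $C$ not depending on $E$.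
   Context: $d\mu$ is the conventional spectral measure: $H$ is unitarily equivalent to multiplication by $E$ on $L^2(\mathbb{R},d\mu(E))$, with normalization fixed by the solution $u(x,E)$ of $-u''+Vu=Eu$, $u(0,E)=0$, $u'(0,E)=1$. With this normalization, as $x\to\infty$ the measures $\pi^{-1}\bigl(|u(x,E)|^2+|u'(x,E)|^2\bigr)^{-1}dE$ converge weakly to $d\mu(E)$ (Carmona's formula).
   Formalization: The bound is proved for 0<E≤E0 with C depending on E0, for each E0<V(0); one C for all 0<E<V(0) is impossible, since N(E)→0 as E→V(0) makes h(E)→-∞. Absolute continuity is proved, with Q the continuous version. *)

(* Defs.v *)
From HB Require Import structures.
From mathcomp Require Export all_boot all_order all_algebra.
From mathcomp Require Export all_classical all_reals all_analysis.
Export Order.TTheory GRing.Theory Num.Theory.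
Export numFieldNormedType.Exports.

Set Implicit Arguments.
Unset Strict Implicit.
Unset Printing Implicit Defensive.

Local Open Scope classical_set_scope.
Local Open Scope ring_scope.

(* Functions on [0, +oo[ are represented by functions R -> R whose values on
   ]-oo, 0[ are irrelevant. *)

Definition has_derivative_halfline (R : realType) (f df : R -> R) : Prop :=
  (forall x : R, 0 < x -> is_derive x 1 f (df x)) /\
  h^-1 * (f h - f 0) @[h --> (0 : R)^'+] --> df 0.

Definition C1_halfline (R : realType) (f df : R -> R) : Prop :=
  has_derivative_halfline f df /\ {within `[0, +oo[, continuous df}.

Definition dirichlet_solution (R : realType) (V : R -> R) (E : R)
    (u : R -> R) : Prop :=
  exists du ddu : R -> R,
    [/\ has_derivative_halfline u du, has_derivative_halfline du ddu,
        forall x : R, 0 <= x -> - ddu x + V x * u x = E * u x,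
        u 0 = 0 & du 0 = 1].

Definition lebesgue_halfline (R : realType) :
    {measure set (measurableTypeR R) -> \bar R} :=
  mrestr lebesgue_measure (measurable_itv `[(0 : R), +oo[).

(* The graph of H = -d^2/dx^2 + V with u(0) = 0, for V continuous and bounded
   on [0, +oo[: f and g are in L^2 and, up to a null set, f is a C^1 function
   F with F(0) = 0 whose derivative is absolutely continuous and satisfies
   -F'' + V F = g almost everywhere. *)
Definition schrodinger_graph (R : realType) (V f g : R -> R) : Prop :=
  [/\ f \in Lfun (lebesgue_halfline R) 2%:E,
      g \in Lfun (lebesgue_halfline R) 2%:E &
      exists F dF : R -> R,
        [/\ f = F %[ae lebesgue_halfline R], C1_halfline F dF, F 0 = 0 &
            forall x : R, 0 <= x ->
              dF x = dF 0 + \int[lebesgue_measure]_(t in `[0, x])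
                              (V t * F t - g t)]].

(* U is a unitary map from L^2([0, +oo[, dx) onto L^2(R, mu), given on
   representatives.  H being a real operator, real scalars suffice: the complex
   unitary is the complexification of U.
   In the fourth clause, E * U f E is in L^2(mu) as soon as it is mu-a.e. equal
   to some U g, and by surjectivity only then; so this clause says both that U
   maps the domain of H onto the domain of multiplication by E and that it
   intertwines the two operators.
   The last clause fixes the normalization of mu. *)
Definition spectral_measure (R : realType) (V : R -> R)
    (mu : {measure set (measurableTypeR R) -> \bar R}) : Prop :=
  exists2 u : R -> R -> R, (forall E : R, dirichlet_solution V E (u E)) &
  exists U : (R -> R) -> R -> R,
  [/\ (forall (a : R) (f g : R -> R),
         f \in Lfun (lebesgue_halfline R) 2%:E ->
         g \in Lfun (lebesgue_halfline R) 2%:E ->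
         U (fun x => a * f x + g x) = (fun E => a * U f E + U g E) %[ae mu]),
      (forall f : R -> R, f \in Lfun (lebesgue_halfline R) 2%:E ->
         U f \in Lfun mu 2%:E /\
         ('N[mu]_2%:E [EFin \o U f] =
          'N[lebesgue_halfline R]_2%:E [EFin \o f])%E),
      (forall k : R -> R, k \in Lfun mu 2%:E ->
         exists2 f : R -> R,
           f \in Lfun (lebesgue_halfline R) 2%:E & U f = k %[ae mu]),
      (forall f g : R -> R,
         f \in Lfun (lebesgue_halfline R) 2%:E ->
         g \in Lfun (lebesgue_halfline R) 2%:E ->
         schrodinger_graph V f g <-> U g = (fun E => E * U f E) %[ae mu]) &
      (forall (f : R -> R) (b : R),
         f \in Lfun (lebesgue_halfline R) 2%:E ->
         (forall x : R, b < x -> f x = 0) ->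
         U f = (fun E => \int[lebesgue_measure]_(x in `[0, b]) (f x * u E x))
           %[ae mu])].

(* Main.v *)
(* For a solution y of -y'' + V y = E y with E > 0, the energy
   y'^2 + (E - V) y^2 increases with x while its quotient by E - V decreases
   beyond the turning point; for y = u(., E) let K(E) be its limit, which is
   continuous in E.

   The density of mu is sqrt E / (pi K(E)).  Damping the outgoing solution at
   energy E by a compactly supported approximation of exp (- eps x / (2 sqrt E))
   gives a function whose transform at F is (1 + r(F)) / (F - E - i eps), where
   r is a transform of norm o(sqrt eps).  Parseval's identity then shows that
   the Poisson integral of mu at E + i eps tends to sqrt E / K(E), locally
   boundedly in E, and Stieltjes inversion applies.

   For E < V(0) and gamma = sqrt (V - E), the functions u' + gamma u and
   u' - gamma u satisfy first order differential inequalities on [0, N(E)],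
   so u and u' at N(E) compare with exp g(E).  One unit further E - V is
   positive, and there K(E) compares with u^2 + u'^2 up to powers of
   V(N(E)) - V(N(E) + 1). *)

From HB Require Import structures.
Require Import Defs.
From mathcomp Require Import measurable_realfun ring lra.

Local Open Scope classical_set_scope.
Local Open Scope ring_scope.

Set Implicit Arguments.
Unset Strict Implicit.
Unset Printing Implicit Defensive.

(** No constant serves all [E < V 0] at once: as [E] tends to [V 0], [N E] tends to 0 and
    [V (N E) - V (N E + 1)] to [V 0 - V 1 > 0], so the prescribed [expR (h E)] tends to 0, while
    [|Q - g|] is nonnegative. Hence one constant for each [E0 < V 0], built on the positive lower
    bound [N E0] of [N E]. Three constraints shape the construction. The transform is an explicit
    integral only for functions of bounded support, so the damping factor must vanish beyond some
    length [c]; a power of [1 - x / c] does so, and its integrals are elementary. The measure is not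
    assumed finite on bounded sets; the finiteness of a single Poisson integral supplies this before
    Tonelli's theorem is applied. Scalars are real, so the outgoing solution is a pair of real
    solutions and each complex identity is written as its two parts. Functions on the half line are
    extended to the left of 0 by their value at 0. They become continuous on the whole line, while
    derivatives are claimed only at [x > 0]; most statements below have this form. *)

Local Notation intR a b f :=
  (\int[lebesgue_measure]_(x in [set` `[a, b]]) f x)%R (only parsing).

Ltac derive_by := apply: is_derive_eq; rewrite ?/GRing.scale /=.

(** * Continuity rules and calculus on the half line *)

Section continuity_rules.
Variables (R : realType) (T : Type) (F : set_system T) (FF : Filter F).
Implicit Types (f : T -> R) (l : R).

Lemma cvg_expR f l : f t @[t --> F] --> l -> expR (f t) @[t --> F] --> expR l.
Proof. by move=> fl; apply: continuous_cvg => //; exact: continuous_expR. Qed.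

Lemma cvg_sqrtr f l :
  f t @[t --> F] --> l -> Num.sqrt (f t) @[t --> F] --> Num.sqrt l.
Proof. by move=> fl; apply: continuous_cvg => //; exact: sqrt_continuous. Qed.

Lemma cvg_expn f l (n : nat) :
  f t @[t --> F] --> l -> f t ^+ n @[t --> F] --> l ^+ n.
Proof.
by move=> fl; apply: (@continuous_cvg _ _ _ F FF f (fun x : R => x ^+ n));
  [exact: exprn_continuous|].
Qed.

Lemma cvg_max0 f l :
  f t @[t --> F] --> l -> Num.max (f t) 0 @[t --> F] --> Num.max l 0.
Proof.
move=> fl; apply: (@continuous_cvg _ _ _ F FF f (fun x : R => Num.max x 0)) => //.
by apply: (@continuous_max _ _ (fun x => x) (fun=> 0));
  [exact: cvg_id|exact: cvg_cst].
Qed.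

End continuity_rules.

Ltac cont_step :=
  lazymatch goal with
  | |- cvg_to (nbhs (fmap ?f _)) _ =>
    lazymatch f with
    | (fun _ => ?c) => exact: cvg_cst
    | (fun x => x) => exact: cvg_id
    | (fun x => @GRing.add _ _ _) => apply: cvgD
    | (fun x => @GRing.opp _ _) => apply: cvgN
    | (fun x => @GRing.mul _ _ _) => apply: cvgM
    | (fun x => @GRing.exp _ _ _) => apply: cvg_expn
    | (fun x => expR _) => apply: cvg_expR
    | (fun x => Num.sqrt _) => apply: cvg_sqrtr
    | (fun x => Num.max _ _) => apply: cvg_max0
    | (fun x => ?g x) =>
      match goal with H : continuous g |- _ => exact (H _) | _ => assumption end
    | @GRing.opp _ => by apply: cvgN; exact: cvg_id
    | ?g =>
      match goal with H : continuous g |- _ => exact (H _) | _ => assumption end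
    end
  end.

Ltac continuous_by :=
  let x := fresh "x" in move=> x;
  (match goal with |- is_true _ -> _ => move=> _ | _ => idtac end);
  lazymatch goal with
  | |- context [continuous_at _ ?f] => change (f t @[t --> x] --> f x)
  | _ => idtac
  end; cbv beta; repeat cont_step.

Section half_line_calculus.
Variable R : realType.
Implicit Types (f g df F : R -> R) (a b x : R).

Lemma ge0_derive_le f df a b : a <= b ->
  (forall x, a <= x <= b -> {for x, continuous f}) ->
  (forall x, a < x < b -> is_derive x 1 f (df x)) ->
  (forall x, a < x < b -> 0 <= df x) -> f a <= f b.
Proof.
rewrite le_eqVlt => /predU1P[-> //|ab] cf fd df0.
have fd' x : x \in `]a, b[ -> is_derive x 1 f (df x).
  by rewrite in_itv/=; exact: fd.
have cf' : {within `[a, b], continuous f}.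
  apply: continuous_in_subspaceT => x; rewrite inE/= in_itv/=; exact: cf.
have [c cab e] := MVT ab fd' cf'.
rewrite -subr_ge0 e mulr_ge0//; last by rewrite subr_ge0 ltW.
by move: cab; rewrite in_itv/=; exact: df0.
Qed.

Lemma le0_derive_ge f df a b : a <= b ->
  (forall x, a <= x <= b -> {for x, continuous f}) ->
  (forall x, a < x < b -> is_derive x 1 f (df x)) ->
  (forall x, a < x < b -> df x <= 0) -> f b <= f a.
Proof.
move=> ab cf fd df0; rewrite -lerN2.
apply: (@ge0_derive_le (fun x => - f x) (fun x => - df x) a b ab).
- by move=> x /cf ?; exact: cvgN.
- by move=> x /fd ?; exact: is_deriveN.
- by move=> x /df0; rewrite oppr_ge0.
Qed.

(** The derivative of [expR (- c * (x - a)) * f x] is that exponential times [df x - c * f x], hence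
    nonpositive. Neither [f] nor [c] has a prescribed sign, so the reverse inequality follows by
    passing to [- f]. *)
Lemma gronwall_le f df (c a b : R) : a <= b -> continuous f ->
  (forall x, a < x < b -> is_derive x 1 f (df x)) ->
  (forall x, a < x < b -> df x <= c * f x) -> f b <= expR (c * (b - a)) * f a.
Proof.
move=> ab cf fd dfc.
have : expR (- c * (b - a)) * f b <= expR (- c * (a - a)) * f a.
  apply: (@le0_derive_ge (fun x => expR (- c * (x - a)) * f x)
    (fun x => expR (- c * (x - a)) * (df x - c * f x)) a b ab).
  - by continuous_by.
  - by move=> x xab; have := fd _ xab => ?; derive_by; ring.
  - by move=> x /dfc h; rewrite pmulr_rle0 ?expR_gt0// subr_le0.
by rewrite subrr mulr0 expR0 mul1r mulNr expRN ler_pdivrMl ?expR_gt0.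
Qed.

Lemma gronwall_ge f df (c a b : R) : a <= b -> continuous f ->
  (forall x, a < x < b -> is_derive x 1 f (df x)) ->
  (forall x, a < x < b -> c * f x <= df x) -> expR (c * (b - a)) * f a <= f b.
Proof.
move=> ab cf fd dfc.
rewrite -lerN2 -mulrN.
apply: (@gronwall_le (fun x => - f x) (fun x => - df x) c a b ab).
- by continuous_by.
- by move=> x /fd ?; exact: is_deriveN.
- by move=> x /dfc; rewrite mulrN lerN2.
Qed.

Lemma integrable_continuous f a b : continuous f ->
  lebesgue_measure.-integrable `[a, b] (EFin \o f).
Proof.
move=> cf; apply: continuous_compact_integrable; first exact: segment_compact.
exact: continuous_subspaceT.
Qed.

Lemma integral_derive f F a b : a <= b -> continuous f -> continuous F ->
  (forall x, a < x < b -> is_derive x 1 F (f x)) -> intR a b f = F b - F a.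
Proof.
rewrite le_eqVlt => /predU1P[->|ab] cf cF fd.
  by rewrite set_itv1 Rintegral_set1 subrr.
rewrite /Rintegral (@continuous_FTC2 _ f F)//.
- exact: continuous_subspaceT.
- split; [|apply: cvg_at_right_filter; exact: cF|apply: cvg_at_left_filter; exact: cF].
  by move=> x; rewrite in_itv/= => /fd [].
- move=> x; rewrite in_itv/= => /fd ?; rewrite derive1E.
  exact: derive_val.
Qed.

Lemma le_integral f g a b : continuous f -> continuous g ->
  (forall x, a <= x <= b -> f x <= g x) -> intR a b f <= intR a b g.
Proof.
move=> cf cg fg; apply: le_Rintegral => //; exact: integrable_continuous.
Qed.

Lemma derive_max0 f (d x : R) : 0 < x -> is_derive x 1 f d ->
  is_derive x 1 (fun t => f (Num.max t 0)) d.
Proof.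
move=> x0; apply: near_eq_is_derive; near=> t.
rewrite max_l// ltW//; near: t.
exact: (cvgr_gt x (@cvg_id _ (nbhs x)) _ x0).
Unshelve. all: by end_near. Qed.

(* The primitive is only differentiated on ]0, +oo[, hence the truncation. *)
Lemma continuous_primitive f : continuous f ->
  exists F, [/\ continuous F, F 0 = 0 &
    forall x, 0 < x -> is_derive x 1 F (f x)].
Proof.
(* Starting at -1 puts 0 in the interior of the interval on which the fundamental theorem
   applies. *)
move=> cf; pose G x := intR (-1) x f.
have Gd x : -1 < x -> is_derive x 1 G (f x).
  move=> x1; have [] := @continuous_FTC1_closed _ f (-1) x (x + 1).
  - by rewrite ltrDl.
  - exact: integrable_continuous.
  - exact: x1.
  - exact: cf.
  by move=> dG <-; rewrite derive1E; exact: DeriveDef.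
exists (fun x => G (Num.max x 0) - G 0); split.
- move=> x; apply: cvgB; last exact: cvg_cst.
  apply: (@continuous_cvg _ _ _ _ _ (fun x => Num.max x 0) G).
    apply: differentiable_continuous; apply/derivable1_diffP.
    have : -1 < Num.max x 0 by rewrite lt_max ltrN10 orbT.
    by move=> /Gd [].
  by apply: cvg_max0; exact: cvg_id.
- by rewrite maxxx subrr.
- move=> x x0; have /(derive_max0 x0) ? := Gd x (lt_trans (ltrN10 _) x0).
  by derive_by; rewrite subr0.
Qed.

End half_line_calculus.

(** * Solutions and their energy *)

(** The equation as a first order system, with [z] for y'. Continuity on the line and derivatives at
    positive points only: this is what the extension by a constant to the left of 0 satisfies. *)
Definition solution (R : realType) (V : R -> R) (E : R) (y z : R -> R) : Prop :=
  [/\ continuous y, continuous z,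
      forall x : R, 0 < x -> is_derive x 1 y (z x) &
      forall x : R, 0 < x -> is_derive x 1 z ((V x - E) * y x)].

(** The potential after its extension by [V 0] to negative arguments; monotonicity is therefore weak
    here, and strictness on the half line is carried separately. *)
Definition decaying_potential (R : realType) (V dV : R -> R) : Prop :=
  [/\ continuous V, forall x, 0 < V x, {homo V : x y /~ x <= y},
      forall x : R, 0 < x -> is_derive x 1 V (dV x) /\ dV x <= 0 &
      V x @[x --> +oo] --> (0 : R)].

Definition energy (R : realType) (V : R -> R) (E : R) (y z : R -> R) (x : R) : R :=
  z x ^+ 2 + (E - V x) * y x ^+ 2.

(** The energy being nondecreasing, the supremum is its limit as soon as it is bounded, which
    [energy_le] ensures for [E > 0]. *)
Definition energy_limit (R : realType) (V : R -> R) (E : R) (y z : R -> R) : R :=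
  sup (range (fun x => energy V E y z (Num.max x 0))).

Section solutions.
Variables (R : realType) (V dV : R -> R).
Hypothesis V_dec : decaying_potential V dV.
Implicit Types (E a b c x : R) (y z : R -> R).

Let V_cont : continuous V. Proof. by case: V_dec. Qed.
Let V_gt0 x : 0 < V x. Proof. by case: V_dec. Qed.
Let V_mono x1 x2 : x1 <= x2 -> V x2 <= V x1.
Proof. by case: V_dec => _ _ Vm _ _; exact: Vm. Qed.
Let V_der x : 0 < x -> is_derive x 1 V (dV x).
Proof. by case: V_dec => _ _ _ + _ => /[apply] -[]. Qed.
Let V_cvg0 : V x @[x --> +oo] --> (0 : R). Proof. by case: V_dec. Qed.

Let dV_le0 x : 0 < x -> dV x <= 0.
Proof. by case: V_dec => _ _ _ + _ => /[apply] -[]. Qed.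

Lemma solution_lincomb E y1 z1 y2 z2 (r1 r2 : R) :
  solution V E y1 z1 -> solution V E y2 z2 ->
  solution V E (fun x => r1 * y1 x + r2 * y2 x) (fun x => r1 * z1 x + r2 * z2 x).
Proof.
move=> [cy1 cz1 dy1 dz1] [cy2 cz2 dy2 dz2]; split.
- by continuous_by.
- by continuous_by.
- by move=> x x0; have := dy1 x x0; have := dy2 x x0 => ? ?; derive_by; ring.
- by move=> x x0; have := dz1 x x0; have := dz2 x x0 => ? ?; derive_by; ring.
Qed.

(** The derivative of [y ^+ 2 + z ^+ 2] is [2 * (1 + V - E) * (y * z)], at most [c] times the
    function in absolute value; Gronwall applies in both directions. *)
Lemma solution_growth E y z c a b : solution V E y z -> 1 + V 0 + `|E| <= c ->
  0 <= a <= b ->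
  y b ^+ 2 + z b ^+ 2 <= expR (c * (b - a)) * (y a ^+ 2 + z a ^+ 2) /\
  y a ^+ 2 + z a ^+ 2 <= expR (c * (b - a)) * (y b ^+ 2 + z b ^+ 2).
Proof.
move=> [cy cz dy dz] cE /andP[a0 ab].
pose S x := y x ^+ 2 + z x ^+ 2.
pose dS x := 2 * (1 + V x - E) * (y x * z x).
have Sd x : a < x < b -> is_derive x 1 S (dS x).
  move=> /andP[ax _]; have x0 := le_lt_trans a0 ax.
  by have := dy x x0; have := dz x x0 => ? ?; rewrite /dS; derive_by; ring.
have cS : continuous S by rewrite /S; continuous_by.
have dSle x : a < x < b -> `|dS x| <= c * S x.
  move=> /andP[ax _]; have x0 := ltW (le_lt_trans a0 ax).
  have Vx : `|1 + V x - E| <= c.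
    rewrite (le_trans (ler_normB _ _))// (le_trans _ cE)// lerD2r.
    by rewrite gtr0_norm ?addr_gt0// lerD2l V_mono.
  have -> : `|dS x| = `|1 + V x - E| * `|2 * (y x * z x)|.
    by rewrite -normrM /dS; congr (`|_|); ring.
  apply: ler_pM => //; rewrite /S ler_norml; apply/andP; split.
    by rewrite -subr_ge0 opprK; have := sqr_ge0 (y x + z x); nra.
  by rewrite -subr_ge0; have := sqr_ge0 (y x - z x); nra.
split; first by apply: (@gronwall_le _ S dS) => // x /dSle; exact: ler_normlW.
rewrite mulrC -ler_pdivrMr ?expR_gt0// -expRN -mulNr mulrC.
apply: (@gronwall_ge _ S dS) => // x /dSle; rewrite ler_norml => /andP[+ _].
by rewrite mulNr.
Qed.

Let energy_derive E y z x : solution V E y z -> 0 < x ->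
  is_derive x 1 (energy V E y z) (- dV x * y x ^+ 2).
Proof.
move=> [_ _ dy dz] x0; have := dy x x0; have := dz x x0; have := V_der x0.
by move=> ? ? ?; rewrite /energy; derive_by; ring.
Qed.

Let energy_continuous E y z : solution V E y z -> continuous (energy V E y z).
Proof. by move=> [cy cz _ _]; rewrite /energy; continuous_by. Qed.

Lemma energy_nondecreasing E y z a b : solution V E y z -> 0 <= a <= b ->
  energy V E y z a <= energy V E y z b.
Proof.
move=> sol /andP[a0 ab].
apply: (@ge0_derive_le _ _ (fun x => - dV x * y x ^+ 2)) => // x.
- by move=> _; exact: energy_continuous.
- by move=> /andP[ax _]; exact: energy_derive (le_lt_trans a0 ax).
- move=> /andP[ax _]; rewrite mulr_ge0 ?sqr_ge0// oppr_ge0.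
  exact: dV_le0 (le_lt_trans a0 ax).
Qed.

(** The quotient of the energy by [E - V] has derivative [dV * z ^+ 2 / (E - V) ^+ 2 <= 0]; at [b]
    its denominator is at most [E]. *)
Lemma energy_le E y z a b : solution V E y z -> 0 <= a <= b -> V a < E ->
  energy V E y z b <= E * (y a ^+ 2 + z a ^+ 2 / (E - V a)).
Proof.
move=> sol /andP[a0 ab] VaE.
have EV x : a <= x -> 0 < E - V x.
  by move=> ax; rewrite subr_gt0 (le_lt_trans (V_mono ax)).
have E0 : 0 < E by exact: lt_trans VaE.
pose m x := energy V E y z x * (E - V x)^-1.
have : m b <= m a.
  apply: (@le0_derive_ge _ _
    (fun x => dV x * z x ^+ 2 * (E - V x) ^- 2)) => // x.
  - move=> /andP[/EV ax _]; apply: cvgM; first exact: energy_continuous.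
    apply: cvgV; first by rewrite gt_eqF.
    by apply: cvgB; [exact: cvg_cst|exact: V_cont].
  - move=> /andP[ax _]; have x0 := le_lt_trans a0 ax.
    have EV0 := EV _ (ltW ax).
    have := energy_derive sol x0; have := V_der x0 => ? ?.
    have EVn : E - V x != 0 by rewrite gt_eqF.
    by rewrite /m; derive_by; rewrite /energy; field.
  - move=> /andP[ax _]; have x0 := le_lt_trans a0 ax.
    rewrite -mulrA mulr_le0_ge0 ?dV_le0// mulr_ge0 ?sqr_ge0//.
    by rewrite invr_ge0 sqr_ge0.
rewrite /m ler_pdivrMr; last exact: EV.
move=> /le_trans; apply.
have -> : y a ^+ 2 + z a ^+ 2 / (E - V a) = energy V E y z a / (E - V a).
  by rewrite /energy; field; rewrite gt_eqF ?EV.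
rewrite [leRHS]mulrC ler_wpM2l//; last by rewrite lerBlDr lerDl ltW.
have EVa := ltW (EV _ (lexx a)).
rewrite /energy divr_ge0// addr_ge0 ?sqr_ge0//.
by apply: mulr_ge0 => //; exact: sqr_ge0.
Qed.

Lemma potential_eventually_lt (e : R) : 0 < e -> exists2 a, 0 <= a & V a < e.
Proof.
move=> e0; have : \forall x \near +oo, V x < e by exact: cvgr_lt V_cvg0 _ e0.
move=> [M [_ MV]]; exists (Num.max 0 (M + 1)); first by rewrite le_max lexx.
by apply: MV; rewrite lt_max ltrDl ltr01 orbT.
Qed.

Section positive_energy.
Variables (E : R) (y z : R -> R).
Hypotheses (E_gt0 : 0 < E) (sol : solution V E y z).

Let energy_mono : {homo (fun x => energy V E y z (Num.max x 0)) : x1 x2 / x1 <= x2}.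
Proof.
move=> x1 x2 x12; apply: energy_nondecreasing => //.
rewrite le_max lexx orbT/= ge_max le_max x12/=.
by rewrite le_max lexx orbT.
Qed.

Let energy_ubound a : 0 <= a -> V a < E ->
  ubound (range (fun x => energy V E y z (Num.max x 0)))
    (E * (y a ^+ 2 + z a ^+ 2 / (E - V a))).
Proof.
move=> a0 VaE _ [x _ <-].
apply: (@le_trans _ _ (energy V E y z (Num.max x a))).
  have -> : energy V E y z (Num.max x a) = energy V E y z (Num.max (Num.max x a) 0).
    by congr energy; rewrite [RHS]max_l// le_max a0 orbT.
  by apply: energy_mono; rewrite le_max lexx.
by apply: energy_le => //; rewrite a0/= le_max lexx orbT.
Qed.

Let energy_has_ubound : has_ubound (range (fun x => energy V E y z (Num.max x 0))).
Proof.
have [a a0 VaE] := potential_eventually_lt E_gt0.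
by eexists; exact: energy_ubound a0 VaE.
Qed.

Lemma le_energy_limit x : 0 <= x -> energy V E y z x <= energy_limit V E y z.
Proof.
move=> x0; apply: ub_le_sup => //=; exists x => //.
by rewrite max_l.
Qed.

Lemma energy_limit_le a : 0 <= a -> V a < E ->
  energy_limit V E y z <= E * (y a ^+ 2 + z a ^+ 2 / (E - V a)).
Proof.
move=> a0 VaE; apply: ge_sup; last exact: energy_ubound.
by exists (energy V E y z (Num.max 0 0)), 0.
Qed.

Lemma energy_cvg : energy V E y z x @[x --> +oo] --> energy_limit V E y z.
Proof.
have := nondecreasing_cvgr energy_mono energy_has_ubound.
apply: cvg_trans; apply: near_eq_cvg; near=> x.
by rewrite max_l//; near: x; exact: nbhs_pinfty_ge.
Unshelve. all: by end_near. Qed.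

End positive_energy.

(** Beyond a point [x0] with [V x0 < a / 2] one has [E - V >= a / 2], so the energy controls both
    squares; before [x0] the backward growth estimate carries the bound from [x0]. Nothing here
    depends on [E] in [[a, b]], which later makes the Poisson integrals locally bounded. *)
Lemma solution_bounded a b : 0 < a -> a <= b ->
  exists2 C, 0 < C & forall E y z x, a <= E <= b -> solution V E y z -> 0 <= x ->
    y x ^+ 2 + z x ^+ 2 <= C * energy_limit V E y z.
Proof.
move=> a0 ab; have [x0 x00 Vx0] := potential_eventually_lt (divr_gt0 a0 (ltr0Sn _ 1)).
pose c := 1 + V 0 + b.
have c0 : 0 <= c by rewrite !addr_ge0// ltW// (lt_le_trans a0).
pose C1 := 1 + 2 / a.
have C10 : 0 < C1 by rewrite addr_gt0// divr_gt0.
exists (expR (c * x0) * C1) => [|E y z x /andP[aE Eb] sol xge0].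
  by rewrite mulr_gt0 ?expR_gt0.
have E0 : 0 < E by exact: lt_le_trans aE.
have far t : x0 <= t -> y t ^+ 2 + z t ^+ 2 <= C1 * energy_limit V E y z.
  move=> xt; have := le_energy_limit E0 sol (le_trans x00 xt).
  have := V_mono xt => Vt h; have Ea : a / 2 <= E - V t by lra.
  have l0 : a / 2 * y t ^+ 2 + z t ^+ 2 <= energy_limit V E y z.
    rewrite (le_trans _ h)// /energy addrC lerD2l ler_wpM2r ?sqr_ge0//.
  have : y t ^+ 2 <= 2 / a * energy_limit V E y z.
    rewrite mulrAC ler_pdivlMr//; have := sqr_ge0 (z t); lra.
  by rewrite /C1 mulrDl mul1r; have := mulr_ge0 (ltW a0) (sqr_ge0 (y t)); lra.
have K0 : 0 <= energy_limit V E y z.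
  rewrite -(pmulr_rge0 _ C10); apply: le_trans (far x0 (lexx _)).
  by rewrite addr_ge0 ?sqr_ge0.
have [xx0|xx0] := leP x0 x.
  rewrite (le_trans (far _ xx0))// ler_wpM2r//; apply: ler_peMl; first exact: ltW.
  by rewrite -(@expR0 R) ler_expR mulr_ge0.
have cE : 1 + V 0 + `|E| <= c by rewrite gtr0_norm// lerD2l.
have [|_ /le_trans] := @solution_growth E y z c x x0 sol cE.
  by rewrite xge0 ltW.
apply; rewrite -mulrA; apply: ler_pM; rewrite ?expR_ge0 ?addr_ge0 ?sqr_ge0//.
- by rewrite ler_expR ler_wpM2l// lerBlDr lerDl.
- exact: far.
Qed.

End solutions.

(** * The outgoing solution *)

Lemma cvg0_mul_bounded (R : realType) (f g : R -> R) (M : R) :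
  f x @[x --> +oo] --> 0 -> (forall x, 0 <= x -> `|g x| <= M) ->
  f x * g x @[x --> +oo] --> 0.
Proof.
move=> f0 gM; apply/cvgr0Pnorm_le => e e0.
have M1 : 0 < Num.max M 1 by rewrite lt_max ltr01 orbT.
near=> x; have x0 : 0 <= x by near: x; exact: nbhs_pinfty_ge.
have fx : `|f x| <= e / Num.max M 1.
  by near: x; apply: cvgr0_norm_le => //; rewrite divr_gt0.
rewrite normrM -[leRHS](divfK (lt0r_neq0 M1)).
by apply: ler_pM => //; rewrite (le_trans (gM _ x0))// le_max lexx.
Unshelve. all: by end_near. Qed.

Section jost_solutions.
Variables (R : realType) (V dV : R -> R).
Hypothesis V_dec : decaying_potential V dV.
Implicit Types (E a b c x : R) (y z u : R -> R).

Let V_cont : continuous V. Proof. by case: V_dec. Qed.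
Let V_gt0 x : 0 < V x. Proof. by case: V_dec. Qed.
Let V_cvg0 : V x @[x --> +oo] --> (0 : R). Proof. by case: V_dec. Qed.

Lemma solution_norm_bounded E y z : 0 < E -> solution V E y z ->
  exists M, forall x, 0 <= x -> `|y x| <= M /\ `|z x| <= M.
Proof.
move=> E0 sol; have [C C0 Cb] := solution_bounded V_dec E0 (lexx E).
pose M := C * energy_limit V E y z.
have SM x : 0 <= x -> y x ^+ 2 + z x ^+ 2 <= M.
  by apply: Cb => //; rewrite lexx.
exists (1 + M) => x x0; have := SM x x0; have := sqr_ge0 (y x).
have := sqr_ge0 (z x) => z2 y2 le.
have bound (t : R) : t ^+ 2 <= M -> `|t| <= 1 + M.
  by move=> tM; have := sqr_ge0 (`|t| - 1); rewrite sqrrB1 real_normK ?num_real//; lra.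
by split; apply: bound; lra.
Qed.

(** The difference with the energy is [V x * y x ^+ 2], which vanishes at infinity since [y] is
    bounded. *)
Lemma kinetic_cvg E y z : 0 < E -> solution V E y z ->
  z x ^+ 2 + E * y x ^+ 2 @[x --> +oo] --> energy_limit V E y z.
Proof.
move=> E0 sol; have [M Mb] := solution_norm_bounded E0 sol.
have -> : (fun x => z x ^+ 2 + E * y x ^+ 2) =
    (fun x => energy V E y z x + V x * y x ^+ 2).
  by apply/funext => x; rewrite /energy; ring.
rewrite -[energy_limit V E y z]addr0; apply: cvgD.
  exact (energy_cvg V_dec E0 sol).
apply: (@cvg0_mul_bounded _ _ _ (M ^+ 2)) => // x /Mb[yM _].
rewrite normrX; apply: lerXn2r => //; rewrite nnegrE//.
exact: le_trans yM.
Qed.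

(** Polarization of [kinetic_cvg]. *)
Lemma kinetic_cross_cvg E y1 z1 y2 z2 : 0 < E ->
  solution V E y1 z1 -> solution V E y2 z2 ->
  exists G : R, z1 x * z2 x + E * (y1 x * y2 x) @[x --> +oo] --> G.
Proof.
move=> E0 s1 s2.
have cp := kinetic_cvg E0 (solution_lincomb 1 1 s1 s2).
have cm := kinetic_cvg E0 (solution_lincomb 1 (-1) s1 s2).
pose G := 4^-1 * (energy_limit V E (fun x => 1 * y1 x + 1 * y2 x)
    (fun x => 1 * z1 x + 1 * z2 x) -
  energy_limit V E (fun x => 1 * y1 x + -1 * y2 x)
    (fun x => 1 * z1 x + -1 * z2 x)).
exists G.
have -> : (fun x => z1 x * z2 x + E * (y1 x * y2 x)) = (fun x => 4^-1 *
    (((1 * z1 x + 1 * z2 x) ^+ 2 + E * (1 * y1 x + 1 * y2 x) ^+ 2) -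
    ((1 * z1 x + -1 * z2 x) ^+ 2 + E * (1 * y1 x + -1 * y2 x) ^+ 2))).
  by apply/funext => x; field.
by apply: cvgM; [exact: cvg_cst|exact: cvgB].
Qed.

(* Rofe-Beketov's formula [a u + u' / (u^2 + u'^2)] for a second solution; it
   stays regular at the zeros of [u]. *)
Lemma second_solution E u z : solution V E u z -> u 0 = 0 -> z 0 = 1 ->
  exists c s : R -> R, [/\ solution V E c s, c 0 = 1 &
    forall x, 0 < x -> c x * z x - s x * u x = 1].
Proof.
move=> sol u0 z0; have [cu cz du dz] := sol.
pose m x := Num.max x (0 : R).
have m0 x : 0 <= m x by rewrite le_max lexx orbT.
have mE x : 0 < x -> m x = x by move=> x0; rewrite /m max_l// ltW.
pose n x := u (m x) ^+ 2 + z (m x) ^+ 2.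
have n_gt0 x : 0 < n x.
  have m00 : 0 <= (0 : R) <= m x by rewrite m0 andbT.
  have [_ +] := solution_growth V_dec sol (lexx _) m00.
  rewrite u0 z0 -/(n x) => h; rewrite -(pmulr_rgt0 _ (expR_gt0 ((1 + V 0 + `|E|) * (m x - 0)))).
  by apply: lt_le_trans h; lra.
have n_neq0 x : n x != 0 by rewrite gt_eqF.
have cu' : continuous (fun x => u (m x)).
  move=> x; apply: (@continuous_cvg _ _ _ _ _ m u); first exact: cu.
  by rewrite /m; repeat cont_step.
have cz' : continuous (fun x => z (m x)).
  move=> x; apply: (@continuous_cvg _ _ _ _ _ m z); first exact: cz.
  by rewrite /m; repeat cont_step.
have cn : continuous n by rewrite /n; continuous_by.
have cninv : continuous (fun x => (n x)^-1).
  by move=> x; apply: cvgV; [exact: n_neq0|exact: cn].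
(* Forced by requiring that [a z - u / n] be the derivative of [a u + z / n]: a factor [u] cancels
   from both sides. *)
pose da x := (1 + V x - E) * (z (m x) ^+ 2 - u (m x) ^+ 2) * (n x)^-1 ^+ 2.
have [|a [ca a0 ad]] := @continuous_primitive R da; first by rewrite /da; continuous_by.
exists (fun x => a x * u (m x) + z (m x) * (n x)^-1).
exists (fun x => a x * z (m x) - u (m x) * (n x)^-1).
have um x : 0 < x -> is_derive x 1 (fun x => u (m x)) (z x).
  by move=> x0; apply: derive_max0 => //; exact: du.
have zm x : 0 < x -> is_derive x 1 (fun x => z (m x)) ((V x - E) * u x).
  by move=> x0; apply: derive_max0 => //; exact: dz.
have nd x : 0 < x -> is_derive x 1 n (2 * (1 + V x - E) * (u x * z x)).
  move=> x0; have := um x x0; have := zm x x0 => ? ?.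
  by rewrite /n; derive_by; rewrite mE//; ring.
have nid x : 0 < x -> is_derive x 1 (fun x => (n x)^-1)
    (- (2 * (1 + V x - E) * (u x * z x)) / n x ^+ 2).
  move=> x0; have := nd x x0 => ?; have := n_neq0 x => ?.
  by derive_by; rewrite mulrC mulNr mulrN.
split.
- split.
  + by continuous_by.
  + by continuous_by.
  + move=> x x0; have := um x x0; have := zm x x0; have := ad x x0; have := nid x x0.
    move=> ? ? ? ?; derive_by; have := n_neq0 x.
    by rewrite /da /n mE// => ?; field.
  + move=> x x0; have := um x x0; have := zm x x0; have := ad x x0; have := nid x x0.
    move=> ? ? ? ?; derive_by; have := n_neq0 x.
    by rewrite /da /n mE// => ?; field.
- by rewrite /n /m maxxx a0 u0 z0; field.
- move=> x x0; have := n_neq0 x; rewrite /n mE// => ?; field.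
  by [].
Qed.

(** At [x = 0] the bound of [solution_bounded] reads [1 <= C * energy_limit V E u z]. *)
Lemma energy_limit_gt0 E u z : 0 < E -> solution V E u z -> u 0 = 0 -> z 0 = 1 ->
  0 < energy_limit V E u z.
Proof.
move=> E0 sol u0 z0; have [C C0 Cb] := solution_bounded V_dec E0 (lexx E).
rewrite -(pmulr_rgt0 _ C0); have EE : E <= E <= E by rewrite lexx.
by apply: lt_le_trans (Cb E u z 0 EE sol (lexx _)); rewrite u0 z0; lra.
Qed.

(* [y1 + i y2] is the outgoing solution: asymptotically its derivative is
   [i sqrt E] times itself. *)
Lemma outgoing_solution E u z : 0 < E -> solution V E u z -> u 0 = 0 -> z 0 = 1 ->
  let K := energy_limit V E u z in
  exists y1 z1 y2 z2 : R -> R,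
  [/\ solution V E y1 z1 /\ solution V E y2 z2,
      y1 0 = 1 /\ y2 0 = 0,
      energy_limit V E y1 z1 = E / K /\ energy_limit V E y2 z2 = E / K,
      z1 x + Num.sqrt E * y2 x @[x --> +oo] --> (0 : R) /\
      z2 x - Num.sqrt E * y1 x @[x --> +oo] --> (0 : R) &
      y1 x ^+ 2 + y2 x ^+ 2 @[x --> +oo] --> K^-1].
Proof.
move=> E0 sol u0 z0 K; have K0 : 0 < K by exact: energy_limit_gt0.
have Kn : K != 0 by rewrite gt_eqF.
set k := Num.sqrt E; have kk : k * k = E by rewrite -expr2 sqr_sqrtr// ltW.
have [c [s [solc c0 wr]]] := second_solution sol u0 z0.
have [G GE] := kinetic_cross_cvg E0 solc sol.
(* Subtracting [G / K] times [u] makes the cross energy with [u] tend to [G - (G / K) * K = 0], so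
   [y1] is asymptotically in quadrature with [u]. The factor [k / K] in [y2] then gives both parts
   the same limit energy [E / K]. *)
pose y1 x := 1 * c x + (- G / K) * u x; pose z1 x := 1 * s x + (- G / K) * z x.
have sol1 : solution V E y1 z1 by exact: solution_lincomb.
pose y2 x := (k / K) * u x + 0 * u x; pose z2 x := (k / K) * z x + 0 * z x.
have sol2 : solution V E y2 z2 by exact: solution_lincomb.
have [M Mb] := solution_norm_bounded E0 sol.
have [M1 M1b] := solution_norm_bounded E0 sol1.
pose P x := z x ^+ 2 + E * u x ^+ 2.
pose A x := z1 x * z x + E * (y1 x * u x).
have PK : P x @[x --> +oo] --> K by exact: kinetic_cvg.
have PK0 : K - P x @[x --> +oo] --> (0 : R).
  by rewrite -(subrr K); apply: cvgB => //; exact: cvg_cst.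
have A0 : A x @[x --> +oo] --> (0 : R).
  have -> : (0 : R) = G + (- G / K) * K by field.
  have -> : A = fun x => (s x * z x + E * (c x * u x)) + (- G / K) * P x.
    by apply/funext => x; rewrite /A /y1 /z1 /P; ring.
  by apply: cvgD => //; apply: cvgM => //; exact: cvg_cst.
have W x : 0 < x -> y1 x * z x - z1 x * u x = 1.
  by move=> x0; rewrite -(wr x x0) /y1 /z1; ring.
(* Solving the two linear equations [A = o(1)], [y1 z - z1 u = 1] for
   [(y1, z1)], whose determinant is [P]. *)
have r1 : K * y1 x - z x @[x --> +oo] --> (0 : R).
  have : A x * u x + (K - P x) * y1 x @[x --> +oo] --> (0 + 0 : R).
    apply: cvgD; first by apply: (@cvg0_mul_bounded _ _ _ M) => // x /Mb[].
    by apply: (@cvg0_mul_bounded _ _ _ M1) => // x /M1b[].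
  rewrite addr0; apply: cvg_trans; apply: near_eq_cvg; near=> x.
  have x0 : 0 < x by near: x; exact: nbhs_pinfty_gt.
  rewrite -[in RHS](mulr1 (z x)) -(W x x0) /A /P; ring.
have r2 : K * z1 x + E * u x @[x --> +oo] --> (0 : R).
  have : A x * z x + (K - P x) * z1 x @[x --> +oo] --> (0 + 0 : R).
    apply: cvgD; first by apply: (@cvg0_mul_bounded _ _ _ M) => // x /Mb[].
    by apply: (@cvg0_mul_bounded _ _ _ M1) => // x /M1b[].
  rewrite addr0; apply: cvg_trans; apply: near_eq_cvg; near=> x.
  have x0 : 0 < x by near: x; exact: nbhs_pinfty_gt.
  rewrite -[in RHS](mulr1 (E * u x)) -(W x x0) /A /P; ring.
(* Thus [y1 = z / K + e1] and [z1 = - (E / K) * u + e2], and every quadratic limit below reduces to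
   that of [P] through [y1 ^+ 2 = e1 * (y1 + z / K) + (z / K) ^+ 2] and its analogue for [z1]. *)
pose e1 x := K^-1 * (K * y1 x - z x); pose e2 x := K^-1 * (K * z1 x + E * u x).
have e10 : e1 x @[x --> +oo] --> (0 : R).
  by rewrite -(mulr0 K^-1); apply: cvgM => //; exact: cvg_cst.
have e20 : e2 x @[x --> +oo] --> (0 : R).
  by rewrite -(mulr0 K^-1); apply: cvgM => //; exact: cvg_cst.
have rem x0 : 0 <= x0 -> `|y1 x0 + K^-1 * z x0| <= M1 + `|K^-1| * M.
  move=> h; rewrite (le_trans (ler_normD _ _))// lerD ?(M1b _ h).1//.
  by rewrite normrM ler_wpM2l//; exact: (Mb _ h).2.
have rem2 x0 : 0 <= x0 -> `|z1 x0 - E / K * u x0| <= M1 + `|E / K| * M.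
  move=> h; rewrite (le_trans (ler_normB _ _))// lerD ?(M1b _ h).2//.
  by rewrite normrM ler_wpM2l//; exact: (Mb _ h).1.
have h1 := cvg0_mul_bounded e10 rem.
have h2 := cvg0_mul_bounded e20 rem2.
have KK : (K^-1 ^+ 2 : R) * P x @[x --> +oo] --> K^-1.
  have : K^-1 ^+ 2 * P x @[x --> +oo] --> K^-1 ^+ 2 * K.
    by apply: cvgM => //; exact: cvg_cst.
  by have -> : K^-1 ^+ 2 * K = K^-1 by field.
exists y1, z1, y2, z2; split.
- by split.
- by rewrite /y1 /y2 c0 u0; split; ring.
- split.
  + suff : z1 x ^+ 2 + E * y1 x ^+ 2 @[x --> +oo] --> E / K.
      exact: cvg_unique (kinetic_cvg E0 sol1).
    have -> : E / K = 0 + (E * 0 + E * K^-1) by rewrite mulr0 !add0r.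
    have -> : (fun x => z1 x ^+ 2 + E * y1 x ^+ 2) = (fun x =>
      e2 x * (z1 x - E / K * u x) + (E * (e1 x * (y1 x + K^-1 * z x)) +
      E * (K^-1 ^+ 2 * P x))).
      by apply/funext => x; rewrite /e1 /e2 /P; field.
    by apply: cvgD => //; apply: cvgD; apply: cvgM => //; exact: cvg_cst.
  + suff : z2 x ^+ 2 + E * y2 x ^+ 2 @[x --> +oo] --> E / K.
      exact: cvg_unique (kinetic_cvg E0 sol2).
    have -> : (fun x => z2 x ^+ 2 + E * y2 x ^+ 2) =
        (fun x => E * (K^-1 ^+ 2 * P x)).
      by apply/funext => x; rewrite /y2 /z2 /P -kk; field.
    by apply: cvgM => //; exact: cvg_cst.
- split.
  + have -> : (fun x => z1 x + k * y2 x) = e2 => //.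
    by apply/funext => x; rewrite /e2 /y2 -kk; field.
  + have -> : (fun x => z2 x - k * y1 x) = (fun x => - k * e1 x).
      by apply/funext => x; rewrite /e1 /z2; field.
    by rewrite -(mulr0 (- k)); apply: cvgM => //; exact: cvg_cst.
- have -> : (fun x => y1 x ^+ 2 + y2 x ^+ 2) = (fun x =>
    e1 x * (y1 x + K^-1 * z x) + K^-1 ^+ 2 * P x).
    by apply/funext => x; rewrite /e1 /P /y2 -kk; field.
  by rewrite -[K^-1]add0r; apply: cvgD => //; rewrite add0r.
Unshelve. all: by end_near. Qed.

End jost_solutions.

(** * Dependence of solutions and limit energy on [E] *)

Section energy_dependence.
Variables (R : realType) (V dV : R -> R) (u z : R -> R -> R).
Hypothesis V_dec : decaying_potential V dV.
Hypothesis u_sol : forall E : R, solution V E (u E) (z E).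
Hypotheses (u_0 : forall E : R, u E 0 = 0) (z_0 : forall E : R, z E 0 = 1).
Implicit Types (E a b c x : R).

Let V_cont : continuous V. Proof. by case: V_dec. Qed.
Let V_gt0 x : 0 < V x. Proof. by case: V_dec. Qed.
Let V_mono x1 x2 : x1 <= x2 -> V x2 <= V x1.
Proof. by case: V_dec => _ _ Vm _ _; exact: Vm. Qed.

(** The difference [(w, v)] solves the system with source [(E0 - E) * u E0]. Adding the constant
    [eta], a bound for the squared source, to [w ^+ 2 + v ^+ 2] absorbs this source, and the sum
    starts from [eta] because the initial data agree. In [c], [c - 1] dominates [|1 + V - E|] and
    the remaining 1 pays for the source. *)
Lemma solution_lipschitz E0 x : 0 < E0 -> 0 <= x ->
  exists D, forall E, `|E - E0| <= 1 ->
    `|u E x - u E0 x| <= D * `|E - E0| /\ `|z E x - z E0 x| <= D * `|E - E0|.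
Proof.
move=> E00 x0; have [M Mb] := solution_norm_bounded V_dec E00 (u_sol E0).
pose c := 3 + V 0 + E0.
have M0 : 0 <= M by have [h _] := Mb _ (lexx 0); rewrite (le_trans _ h).
have c0 : 0 <= c by rewrite /c; have := V_gt0 0; lra.
exists (expR (c * x) * M) => E EE0.
have [cu cz du dz] := u_sol E; have [cu0 cz0 du0 dz0] := u_sol E0.
pose w t := u E t - u E0 t; pose v t := z E t - z E0 t.
pose eta := (E - E0) ^+ 2 * M ^+ 2.
pose S t := w t ^+ 2 + v t ^+ 2 + eta.
pose dS t := 2 * (1 + V t - E) * (w t * v t) + 2 * v t * ((E0 - E) * u E0 t).
have eta0 : 0 <= eta by rewrite /eta mulr_ge0 ?sqr_ge0.
have Sx : S x <= expR (c * (x - 0)) * S 0.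
  apply: (@gronwall_le _ S dS) => //.
  - by rewrite /S /w /v; continuous_by.
  - move=> t /andP[t0 _]; have := du t t0; have := dz t t0.
    have := du0 t t0; have := dz0 t t0 => ? ? ? ?.
    by rewrite /S /w /v /dS; derive_by; rewrite /w /v; ring.
  - move=> t /andP[t0 _]; have [uM _] := Mb t (ltW t0).
    have Vt : V t <= V 0 by apply: V_mono; exact: ltW.
    have V0 := V_gt0 t; move: EE0; rewrite ler_norml => /andP[E1 E2].
    have t1 : 2 * (1 + V t - E) * (w t * v t) <= (c - 1) * (w t ^+ 2 + v t ^+ 2).
      have wp := sqr_ge0 (w t + v t); have wm := sqr_ge0 (w t - v t).
      have k1 : 0 <= c - 1 - (1 + V t - E) by rewrite /c; lra.
      have k2 : 0 <= c - 1 + (1 + V t - E) by rewrite /c; lra.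
      have := mulr_ge0 k1 wp; have := mulr_ge0 k2 wm; lra.
    have t2 : 2 * v t * ((E0 - E) * u E0 t) <= v t ^+ 2 + eta.
      have : ((E0 - E) * u E0 t) ^+ 2 <= eta.
        rewrite exprMn /eta -(sqrrN (E0 - E)) opprB ler_wpM2l ?sqr_ge0//.
        rewrite -(@real_normK _ (u E0 t)) ?num_real//.
        by rewrite ler_sqr ?nnegrE.
      by have := sqr_ge0 (v t - (E0 - E) * u E0 t); lra.
    have c1 : 0 <= c - 1 by rewrite /c; have := V_gt0 0; lra.
    have := mulr_ge0 c1 eta0.
    by have := sqr_ge0 (w t); rewrite /dS /S; lra.
have S0 : S 0 = eta by rewrite /S /w /v !u_0 !z_0; ring.
have Sle : w x ^+ 2 + v x ^+ 2 <= (expR (c * x) * M * `|E - E0|) ^+ 2.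
  move: Sx; rewrite S0 subr0 => Sx.
  have : expR (c * x) * eta <= (expR (c * x) * M * `|E - E0|) ^+ 2.
    have -> : (expR (c * x) * M * `|E - E0|) ^+ 2 = expR (c * x) ^+ 2 * eta.
      by rewrite !exprMn real_normK ?num_real// /eta; ring.
    apply: ler_wpM2r => //; rewrite expr2 ler_peMl ?expR_ge0//.
    by rewrite -(@expR0 R) ler_expR mulr_ge0.
  by move: Sx; rewrite /S; lra.
have D0 : 0 <= expR (c * x) * M * `|E - E0| by rewrite !mulr_ge0 ?expR_ge0.
have fin (t : R) : t ^+ 2 <= (expR (c * x) * M * `|E - E0|) ^+ 2 ->
    `|t| <= expR (c * x) * M * `|E - E0|.
  by rewrite -[in X in X -> _](@real_normK _ t) ?num_real// ler_sqr ?nnegrE.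
have w2 := sqr_ge0 (w x); have v2 := sqr_ge0 (v x).
by split; apply: fin; rewrite -/(w x) -/(v x); lra.
Qed.

Lemma solution_continuous_energy E0 x : 0 < E0 -> 0 <= x ->
  u E x @[E --> E0] --> u E0 x /\ z E x @[E --> E0] --> z E0 x.
Proof.
move=> E00 x0; have [D Db] := solution_lipschitz E00 x0.
have D1 : 0 < `|D| + 1 by rewrite ltr_pwDr.
have cvg_of (f : R -> R) :
    (forall E, `|E - E0| <= 1 -> `|f E - f E0| <= D * `|E - E0|) ->
    f E @[E --> E0] --> f E0.
  move=> fD; apply/cvgrPdist_le => e e0; near=> E.
  have E1 : `|E - E0| <= 1.
    rewrite distrC; near: E.
    by apply: (@cvgr_dist_le _ _ _ (nbhs E0) _ id E0) => //; exact: cvg_id.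
  have E2 : `|E - E0| <= e / (`|D| + 1).
    rewrite distrC; near: E.
    by apply: (@cvgr_dist_le _ _ _ (nbhs E0) _ id E0); [exact: cvg_id|exact: divr_gt0].
  rewrite distrC (le_trans (fD _ E1))//.
  apply: (@le_trans _ _ ((`|D| + 1) * `|E - E0|)).
    by rewrite ler_wpM2r// (le_trans (ler_norm _))// lerDl.
  by rewrite mulrC -ler_pdivlMr.
by split; apply: cvg_of => E /Db[].
Unshelve. all: by end_near. Qed.

(** At a fixed [x] with [V x < E] the limit lies between [lower E], the energy at [x], and
    [upper E], the bound of [energy_le]; both are continuous in [E]. Their gap at [E0] is
    [V x / (E0 - V x) * lower E0], below [e / 2] once [V x < d]. *)
Lemma energy_limit_continuous :
  {in `]0, +oo[, continuous (fun E => energy_limit V E (u E) (z E))}.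
Proof.
move=> E0; rewrite in_itv/= andbT => E00.
pose f E := energy_limit V E (u E) (z E); rewrite -/f.
have f0 : 0 < f E0 by exact (energy_limit_gt0 V_dec E00 (u_sol E0) (u_0 E0) (z_0 E0)).
apply/cvgrPdist_lt => e e0.
pose d := Num.min (E0 / 2) (E0 * e / (4 * f E0)).
have d0 : 0 < d by rewrite lt_min !divr_gt0 ?mulr_gt0.
have [x x0] := potential_eventually_lt V_dec d0.
rewrite lt_min => /andP[V1 V2].
have [uc zc] := solution_continuous_energy E00 x0.
have VE0 : V x < E0 by lra.
have lo := le_energy_limit V_dec E00 (u_sol E0) x0.
have hi := energy_limit_le V_dec (u_sol E0) x0 VE0.
pose lower E := z E x ^+ 2 + (E - V x) * u E x ^+ 2.
pose upper E := E * (u E x ^+ 2 + z E x ^+ 2 * (E - V x)^-1).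
have lowc : lower E @[E --> E0] --> lower E0 by rewrite /lower; repeat cont_step.
have EV : 0 < E0 - V x by rewrite subr_gt0.
have uppc : upper E @[E --> E0] --> upper E0.
  rewrite /upper; repeat cont_step.
  by apply: cvgV; [rewrite gt_eqF|repeat cont_step].
have gap : upper E0 - lower E0 < e / 2.
  have -> : upper E0 - lower E0 = V x / (E0 - V x) * lower E0.
    by rewrite /upper /lower; field; rewrite gt_eqF.
  have h1 : V x / (E0 - V x) <= 2 * V x / E0.
    have V3 : 0 <= E0 - 2 * V x by lra.
    have h3 := mulr_ge0 (ltW (V_gt0 x)) V3.
    by rewrite ler_pdivrMr// [leRHS]mulrAC ler_pdivlMr//; lra.
  have h2 : 2 * V x / E0 * f E0 < e / 2.
    rewrite mulrAC ltr_pdivrMr//.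
    by move: V2; rewrite ltr_pdivlMr ?mulr_gt0//; lra.
  apply: le_lt_trans h2; apply: (@le_trans _ _ (V x / (E0 - V x) * f E0)).
    by rewrite ler_wpM2l// divr_ge0// ltW.
  by rewrite ler_wpM2r// ltW.
near=> E.
have E_gt : V x < E by near: E; exact: (cvgr_gt E0 (@cvg_id _ (nbhs E0)) _ VE0).
have EE0 : 0 < E by exact: lt_trans E_gt.
have lo' := le_energy_limit V_dec EE0 (u_sol E) x0.
have hi' := energy_limit_le V_dec (u_sol E) x0 E_gt.
have n1 : `|lower E0 - lower E| < e / 2.
  by near: E; apply: cvgr_dist_lt lowc _ _; rewrite divr_gt0.
have n2 : `|upper E0 - upper E| < e / 2.
  by near: E; apply: cvgr_dist_lt uppc _ _; rewrite divr_gt0.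
move: n1 n2 lo hi lo' hi'; rewrite /energy -/(lower E0) -/(upper E0) -/(f E0).
rewrite -/(lower E) -/(upper E) -/(f E) !ltr_norml.
by move=> /andP[? ?] /andP[? ?] ? ? ? ?; apply/andP; split; lra.
Unshelve. all: by end_near. Qed.

End energy_dependence.

(** * Parseval's identity and the Poisson integral *)

Lemma Lnorm2_sqr d (T : measurableType d) (R : realType)
    (mu : {measure set T -> \bar R}) (f : T -> R) :
  ('N[mu]_2%:E [EFin \o f] `^ 2 = \int[mu]_x (f x ^+ 2)%:E)%E.
Proof.
rewrite poweR_Lnorm ?pnatr_eq0//; apply: eq_integral => x _ /=.
by rewrite powR_mulrn// real_normK ?num_real.
Qed.

Lemma integral_halfline_restrict (R : realType) (f : R -> R) (b : R) :
  continuous f ->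
  (\int[lebesgue_halfline R]_x ((f \_ `[0, b]) x ^+ 2)%:E =
    (intR 0 b (fun x => f x ^+ 2))%:E)%E.
Proof.
move=> cf; have cf2 : continuous (fun x => f x ^+ 2) by continuous_by.
rewrite [RHS]fineK; last first.
  by apply: integrable_fin_num => //; exact: integrable_continuous.
transitivity (\int[lebesgue_halfline R]_x
    ((fun x => (f x ^+ 2)%:E) \_ `[0%R, b]) x)%E.
  apply: eq_integral => x _; rewrite !patchE.
  by case: ifP => // _; rewrite expr0n.
rewrite -integral_mkcond; apply: eq_measure_integral => A mA Ab.
change (lebesgue_measure (A `&` `[(0 : R)%R, +oo[%classic) = lebesgue_measure A).
rewrite setIidl// => x /Ab /=.
by rewrite !in_itv/= andbT => /andP[].
Qed.

(** The unitary map is applied to [f] cut off outside [[0, b]]. Taking its image for [phi] makes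
    measurability immediate; the explicit integral agrees with it almost everywhere. *)
Lemma spectral_parseval (R : realType) (V : R -> R)
    (mu : {measure set (measurableTypeR R) -> \bar R}) :
  spectral_measure V mu ->
  exists2 u : R -> R -> R, (forall E, dirichlet_solution V E (u E)) &
  forall (f : R -> R) (b : R), continuous f ->
    exists phi : R -> R, [/\ measurable_fun setT phi,
      {ae mu, forall E, phi E = intR 0 b (fun x => f x * u E x)} &
      (\int[mu]_E (phi E ^+ 2)%:E = (intR 0 b (fun x => f x ^+ 2))%:E)%E].
Proof.
move=> [u u_sol [U [_ U_iso _ _ U_trans]]]; exists u => // f b cf.
pose f0 : R -> R := f \_ `[0, b].
have mf0 : measurable_fun setT f0.
  apply/measurable_restrict => //; apply: measurable_funS measurableT _ _ => //.
  exact: continuous_measurable_fun.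
have f0_Lfun : f0 \in Lfun (lebesgue_halfline R) 2%:E.
  rewrite inE; apply/andP; split; rewrite inE//= /finite_norm.
  apply: (@lty_poweRy _ _ 2); first by rewrite pnatr_eq0.
  by rewrite Lnorm2_sqr integral_halfline_restrict// ltry.
have [Uf_Lfun Uf_norm] := U_iso _ f0_Lfun.
exists (U f0); split.
- by move: Uf_Lfun; rewrite inE => /andP[]; rewrite inE.
- have f0_out x : b < x -> f0 x = 0.
    move=> bx; rewrite /f0 patchE; case: ifPn => //; rewrite inE/= in_itv/=.
    by rewrite [x <= b]leNgt bx andbF.
  apply: filterS (U_trans f0 b f0_Lfun f0_out) => [|E /= ->//].
    exact: (ae_filter_ringOfSetsType mu).
  apply: eq_Rintegral => x xb; rewrite /f0 patchE xb//.
- by rewrite -Lnorm2_sqr Uf_norm Lnorm2_sqr integral_halfline_restrict.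
Qed.

Lemma integralD_continuous (R : realType) (f g : R -> R) (a b : R) :
  continuous f -> continuous g ->
  intR a b (fun x => f x + g x) = intR a b f + intR a b g.
Proof. by move=> cf cg; apply: RintegralD => //; exact: integrable_continuous. Qed.

Lemma integralZ_continuous (R : realType) (f : R -> R) (r a b : R) :
  continuous f -> intR a b (fun x => r * f x) = r * intR a b f.
Proof. by move=> cf; apply: RintegralZl => //; exact: integrable_continuous. Qed.

(** Lagrange's identity: [G] is the Wronskian of [eta y] and [v], whose derivative is the sum of the
    two integrands. It vanishes at [c] by the cutoff and equals [- y 0] at 0. *)
Lemma green_identity (R : realType) (V : R -> R) (E F c : R)
    (y z v w eta deta ddeta : R -> R) :
  0 <= c -> solution V E y z -> solution V F v w -> v 0 = 0 -> w 0 = 1 ->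
  continuous eta -> continuous deta -> continuous ddeta ->
  (forall x : R, is_derive x 1 eta (deta x)) ->
  (forall x : R, is_derive x 1 deta (ddeta x)) ->
  eta 0 = 1 -> eta c = 0 -> deta c = 0 ->
  (F - E) * intR 0 c (fun x => eta x * y x * v x) +
    intR 0 c (fun x => (ddeta x * y x + 2 * deta x * z x) * v x) = y 0.
Proof.
move=> c0 [cy cz dy dz] [cv cw dv dw] v0 w0 ce cde cdde de dde e0 ec dec.
rewrite -integralZ_continuous -?integralD_continuous; try by continuous_by.
pose G x := (deta x * y x + eta x * z x) * v x - eta x * y x * w x.
transitivity (G c - G 0); last by rewrite /G ec dec e0 v0 w0; ring.
apply: integral_derive => //.
- by continuous_by.
- by rewrite /G; continuous_by.
- move=> x /andP[x0 _]; have := dy x x0; have := dz x x0; have := dv x x0.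
  have := dw x x0; have := de x; have := dde x => ? ? ? ? ? ?.
  by rewrite /G; derive_by; ring.
Qed.

(** The hypotheses say that [A + i B] is [(1 + r) / (a - i eps)] with [r = r1 + i r2], so
    [D * S = |1 + r|^2]. Young's inequality with weight [t] compares this with 1, and
    [eps / D <= 1 / eps] bounds the error; hence the need for residuals of squared norm [o(eps)]. *)
Lemma poisson_pointwise (R : realType) (a eps A B r1 r2 t : R) :
  0 < eps -> 0 < t -> a * A + eps * B = 1 + r1 -> a * B - eps * A = r2 ->
  eps / (a ^+ 2 + eps ^+ 2) <=
    (1 + t) * eps * (A ^+ 2 + B ^+ 2) + (1 + t^-1) / eps * (r1 ^+ 2 + r2 ^+ 2) /\
  eps * (A ^+ 2 + B ^+ 2) <= (1 + t) * (eps / (a ^+ 2 + eps ^+ 2)) +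
    (1 + t^-1) / eps * (r1 ^+ 2 + r2 ^+ 2).
Proof.
move=> e0 t0 h1 h2; set D := a ^+ 2 + eps ^+ 2; set S := A ^+ 2 + B ^+ 2.
set r := r1 ^+ 2 + r2 ^+ 2.
have eD : eps ^+ 2 <= D by rewrite lerDr sqr_ge0.
have D0 : 0 < D by apply: lt_le_trans eD; rewrite exprn_gt0.
have DS : D * S = (1 + r1) ^+ 2 + r2 ^+ 2 by rewrite -h1 -h2 /D /S; ring.
have r0 : 0 <= r by rewrite addr_ge0 ?sqr_ge0.
have ti0 : 0 <= t^-1 by rewrite invr_ge0 ltW.
have rD : (1 + t^-1) * (eps / D) * r <= (1 + t^-1) / eps * r.
  apply: ler_wpM2r => //; apply: ler_wpM2l.
    by rewrite addr_ge0.
  by rewrite ler_pdivrMr// ler_pdivlMl// -expr2.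
have q1 : 0 <= t^-1 * ((t * (1 + r1) + r1) ^+ 2 + (t * r2 + r2) ^+ 2).
  by rewrite mulr_ge0// addr_ge0 ?sqr_ge0.
have q2 : 0 <= t^-1 * ((t - r1) ^+ 2 + r2 ^+ 2).
  by rewrite mulr_ge0// addr_ge0 ?sqr_ge0.
have tn : t != 0 by rewrite gt_eqF.
have e1 : 1 <= (1 + t) * (D * S) + (1 + t^-1) * r.
  rewrite -subr_ge0 DS; apply: le_trans q1 _; rewrite le_eqVlt; apply/orP; left.
  by apply/eqP; rewrite /r; field.
have e2 : D * S <= (1 + t) + (1 + t^-1) * r.
  rewrite -subr_ge0 DS; apply: le_trans q2 _; rewrite le_eqVlt; apply/orP; left.
  by apply/eqP; rewrite /r; field.
have Dn : D != 0 by rewrite gt_eqF.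
have eD0 : 0 <= eps / D by exact: ltW (divr_gt0 e0 D0).
split.
- apply: (@le_trans _ _ ((1 + t) * eps * S + (1 + t^-1) * (eps / D) * r)).
    have h := ler_wpM2l eD0 e1.
    have eq : eps / D * (D * S) = eps * S by field.
    have -> : (1 + t) * eps * S + (1 + t^-1) * (eps / D) * r =
        eps / D * ((1 + t) * (D * S) + (1 + t^-1) * r).
      by rewrite -!mulrA -eq; ring.
    by rewrite mulr1 in h.
  by rewrite lerD2l.
- apply: (@le_trans _ _ ((1 + t) * (eps / D) + (1 + t^-1) * (eps / D) * r)).
    have h := ler_wpM2l eD0 e2.
    have <- : eps / D * (D * S) = eps * S by field.
    by move: h; lra.
  by rewrite lerD2l.
Qed.

Section poisson_comparison.
Variables (R : realType) (mu : {measure set (measurableTypeR R) -> \bar R}).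
Implicit Types (f g A B : R -> R) (E eps t : R).

Lemma ge0_integral_lincomb f g (k l : R) : 0 <= k -> 0 <= l ->
  measurable_fun setT f -> measurable_fun setT g ->
  (forall x, 0 <= f x) -> (forall x, 0 <= g x) ->
  (\int[mu]_x (k * f x + l * g x)%:E =
    k%:E * \int[mu]_x (f x)%:E + l%:E * \int[mu]_x (g x)%:E)%E.
Proof.
move=> k0 l0 mf mg f0 g0.
under eq_integral do rewrite EFinD !EFinM.
rewrite ge0_integralD//=.
- by rewrite !ge0_integralZl_EFin//; try (by move=> x _; rewrite lee_fin);
    exact/measurable_EFinP.
- by move=> x _; rewrite mule_ge0// lee_fin.
- by apply/measurable_EFinP; exact: measurable_funM.
- by move=> x _; rewrite mule_ge0// lee_fin.
- by apply/measurable_EFinP; exact: measurable_funM.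
Qed.

(** Imaginary part of the Stieltjes transform at [E + i eps], without the factor 1/pi: its limit is
    pi times the density. *)
Definition poisson E eps : \bar R :=
  \int[mu]_F (eps / ((F - E) ^+ 2 + eps ^+ 2))%:E.

Lemma poisson_kernel_ge0 E eps (F : R) : 0 < eps ->
  0 <= eps / ((F - E) ^+ 2 + eps ^+ 2).
Proof. by move=> e0; rewrite divr_ge0 ?ltW// ltr_wpDl ?sqr_ge0 ?exprn_gt0. Qed.

Lemma measurable_poisson_kernel E eps : 0 < eps ->
  measurable_fun [set: R] (fun F : R => eps / ((F - E) ^+ 2 + eps ^+ 2)).
Proof.
move=> e0; apply: continuous_measurable_fun => x.
apply: cvgM; first exact: cvg_cst.
apply: cvgV; first by rewrite gt_eqF// ltr_wpDl ?sqr_ge0 ?exprn_gt0.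
by repeat cont_step.
Qed.

Lemma poisson_compare (A B R1 R2 : R -> R) (a b r1 r2 E eps t : R) :
  0 < eps -> 0 < t ->
  measurable_fun setT A -> measurable_fun setT B ->
  measurable_fun setT R1 -> measurable_fun setT R2 ->
  {ae mu, forall F, (F - E) * A F + eps * B F = 1 + R1 F /\
                    (F - E) * B F - eps * A F = R2 F} ->
  (\int[mu]_F (A F ^+ 2)%:E = a%:E)%E -> (\int[mu]_F (B F ^+ 2)%:E = b%:E)%E ->
  (\int[mu]_F (R1 F ^+ 2)%:E = r1%:E)%E -> (\int[mu]_F (R2 F ^+ 2)%:E = r2%:E)%E ->
  (poisson E eps <= ((1 + t) * eps * (a + b) + (1 + t^-1) / eps * (r1 + r2))%:E)%E /\
  ((eps * (a + b))%:E <= (1 + t)%:E * poisson E eps +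
     ((1 + t^-1) / eps * (r1 + r2))%:E)%E.
Proof.
move=> e0 t0 mA mB mR1 mR2 rel ia ib ir1 ir2.
have sq f g : measurable_fun setT f -> measurable_fun setT g ->
    measurable_fun setT (fun F => f F ^+ 2 + g F ^+ 2).
  by move=> mf mg; apply: measurable_funD; exact: measurable_funX.
have sq0 f g F : 0 <= f F ^+ 2 + g F ^+ 2 by rewrite addr_ge0 ?sqr_ge0.
have isq f g (p q : R) : measurable_fun setT f -> measurable_fun setT g ->
    (\int[mu]_F (f F ^+ 2)%:E = p%:E)%E -> (\int[mu]_F (g F ^+ 2)%:E = q%:E)%E ->
    (\int[mu]_F (f F ^+ 2 + g F ^+ 2)%:E = (p + q)%:E)%E.
  move=> mf mg ip iq; under eq_integral do rewrite EFinD.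
  rewrite ge0_integralD//= ?ip ?iq//.
  - by move=> x _; rewrite lee_fin sqr_ge0.
  - by apply/measurable_EFinP; exact: measurable_funX.
  - by move=> x _; rewrite lee_fin sqr_ge0.
  - by apply/measurable_EFinP; exact: measurable_funX.
have iab := isq _ _ _ _ mA mB ia ib; have ir := isq _ _ _ _ mR1 mR2 ir1 ir2.
have mAB := sq _ _ mA mB; have mR := sq _ _ mR1 mR2.
have t1 : 0 <= 1 + t by rewrite addr_ge0// ltW.
have t2 : 0 <= (1 + t^-1) / eps by rewrite divr_ge0 ?ltW// ltr_wpDl// invr_gt0.
have t3 : 0 <= (1 + t) * eps by rewrite mulr_ge0// ltW.
have mk := measurable_poisson_kernel E e0.
have k0 F := poisson_kernel_ge0 E F e0.
split.
- have -> : ((1 + t) * eps * (a + b) + (1 + t^-1) / eps * (r1 + r2))%:E =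
    (\int[mu]_F ((1 + t) * eps * (A F ^+ 2 + B F ^+ 2) +
      (1 + t^-1) / eps * (R1 F ^+ 2 + R2 F ^+ 2))%:E)%E.
    by rewrite (ge0_integral_lincomb t3 t2 mAB mR)//= iab ir EFinD !EFinM.
  apply: ae_ge0_le_integral => //.
  + by move=> x _; rewrite lee_fin.
  + exact/measurable_EFinP.
  + by move=> x _; rewrite lee_fin addr_ge0// mulr_ge0.
  + apply/measurable_EFinP; apply: measurable_funD; exact: measurable_funM.
  + apply: filterS rel => [|F [h1 h2] _]; first exact: (ae_filter_ringOfSetsType mu).
    by rewrite lee_fin; have [] := poisson_pointwise e0 t0 h1 h2.
- have -> : ((1 + t)%:E * poisson E eps + ((1 + t^-1) / eps * (r1 + r2))%:E =
    \int[mu]_F ((1 + t) * (eps / ((F - E) ^+ 2 + eps ^+ 2)) +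
      (1 + t^-1) / eps * (R1 F ^+ 2 + R2 F ^+ 2))%:E)%E.
    by rewrite (ge0_integral_lincomb t1 t2 mk mR)//= ir !EFinM.
  have -> : (eps * (a + b))%:E = (\int[mu]_F (eps * (A F ^+ 2 + B F ^+ 2) +
      0 * (R1 F ^+ 2 + R2 F ^+ 2))%:E)%E.
    by rewrite (ge0_integral_lincomb (ltW e0) (lexx 0) mAB mR)//= iab mul0e adde0 EFinM.
  apply: ae_ge0_le_integral => //.
  + by move=> x _; rewrite lee_fin mul0r addr0 mulr_ge0// ltW.
  + apply/measurable_EFinP; apply: measurable_funD; exact: measurable_funM.
  + by move=> x _; rewrite lee_fin addr_ge0// mulr_ge0.
  + apply/measurable_EFinP; apply: measurable_funD; exact: measurable_funM.
  + apply: filterS rel => [|F [h1 h2] _]; first exact: (ae_filter_ringOfSetsType mu).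
    by rewrite lee_fin mul0r addr0; have [] := poisson_pointwise e0 t0 h1 h2.
Qed.

End poisson_comparison.

(** * Quasimodes *)

Section cutoff.
Variables (R : realType) (c : R).
Hypothesis c_gt0 : 0 < c.
Implicit Types (m : nat) (f : R -> R).

(** On [[0, c]] the power [ramp x ^+ n] imitates [expR (- n * x / c)], while vanishing to order [n]
    at [c]. *)
Definition ramp (x : R) : R := 1 - x / c.

Let c_neq0 : c != 0. Proof. by rewrite gt_eqF. Qed.

Lemma ramp_itv x : 0 <= x <= c -> 0 <= ramp x <= 1.
Proof.
move=> /andP[x0 xc]; rewrite /ramp subr_ge0 ler_pdivrMr// mul1r xc/=.
by rewrite lerBlDr lerDl divr_ge0// ltW.
Qed.

Lemma ramp_continuous : continuous ramp.
Proof. by rewrite /ramp; continuous_by. Qed.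

Lemma ramp_derive (n : nat) (x : R) :
  is_derive x 1 (fun t => ramp t ^+ n.+1) (- (n.+1%:R / c) * ramp x ^+ n).
Proof.
have rd : is_derive x 1 ramp (- c^-1) by rewrite /ramp; derive_by; ring.
have -> : (fun t => ramp t ^+ n.+1) = ramp ^+ n.+1.
  by apply/funext => t; rewrite exprfctE.
by derive_by; field.
Qed.

Lemma integral_ramp m : intR 0 c (fun x => ramp x ^+ m) = c / m.+1%:R.
Proof.
have cr := ramp_continuous.
transitivity ((- (c / m.+1%:R) * ramp c ^+ m.+1) - (- (c / m.+1%:R) * ramp 0 ^+ m.+1)).
  apply: (@integral_derive _ _ (fun x => - (c / m.+1%:R) * ramp x ^+ m.+1)).
  - exact: ltW.
  - by continuous_by.
  - by continuous_by.
  - move=> x _; have := ramp_derive m x => ?; derive_by.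
    have : (m.+1%:R : R) != 0 by rewrite pnatr_eq0.
    by move: (m.+1%:R : R) => a a0; field; rewrite c_neq0.
by rewrite /ramp mul0r subr0 expr1n divff// subrr exprS mul0r; ring.
Qed.

(* The exponential term is integrable, so it disappears from averages over
   long intervals: this is how a limit at infinity is used. *)
Lemma ramp_average_le m f (e M X : R) : continuous f -> 0 <= M ->
  (forall x, 0 <= x -> f x <= e + M * expR (X - x)) ->
  intR 0 c (fun x => ramp x ^+ m * f x) <= e * (c / m.+1%:R) + M * expR X.
Proof.
move=> cf M0 fle; have cr := ramp_continuous.
have cX : continuous (fun x : R => M * expR (X - x)) by continuous_by.
apply: (@le_trans _ _ (intR 0 c (fun x => e * ramp x ^+ m + M * expR (X - x)))).
  apply: le_integral; [by continuous_by|by continuous_by|] => x xc.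
  have /andP[r0 r1] := ramp_itv xc; have /andP[x0 _] := xc.
  apply: (@le_trans _ _ (ramp x ^+ m * (e + M * expR (X - x)))).
    by rewrite ler_wpM2l ?exprn_ge0// fle.
  rewrite mulrDr mulrC lerD2l ler_piMl ?exprn_ile1//.
  by rewrite mulr_ge0 ?expR_ge0.
rewrite integralD_continuous; [|by continuous_by|by continuous_by].
rewrite integralZ_continuous; last by continuous_by.
rewrite integral_ramp lerD2l.
have -> : intR 0 c (fun x => M * expR (X - x)) =
    - M * expR (X - c) - (- M * expR (X - 0)).
  apply: (@integral_derive _ _ (fun x => - M * expR (X - x))) => //.
  - exact: ltW.
  - by continuous_by.
  - by move=> x _; derive_by; ring.
rewrite subr0 -subr_ge0 (_ : _ - _ = M * expR (X - c)); last by ring.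
by rewrite mulr_ge0 ?expR_ge0.
Qed.

End cutoff.

(** The cutoff is [p ^+ 2 * q], its derivative [- d * (p * q)], its second derivative
    [d ^+ 2 * r * q], and eps is [2 * k * d]. Each residual splits into three terms: the defect of
    outgoingness [z1 + k * y2] or [z2 - k * y1], the mismatch [p * q * (1 - p)] between the cutoff
    and its rescaled derivative, and the second derivative. The square of the sum is at most three
    times the sum of squares. *)
Lemma residual_pointwise (R : realType) (k d p q r y1 z1 y2 z2 : R) :
  0 <= r <= 1 ->
  ((2 * k * d) * (p ^+ 2 * q) * y2 - (d ^+ 2 * r * q * y1 - 2 * (d * (p * q)) * z1)) ^+ 2 +
  (- ((2 * k * d) * (p ^+ 2 * q) * y1) - (d ^+ 2 * r * q * y2 - 2 * (d * (p * q)) * z2)) ^+ 2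
  <= 12 * d ^+ 2 * ((p * q) ^+ 2 * ((z1 + k * y2) ^+ 2 + (z2 - k * y1) ^+ 2)) +
     (3 * (2 * k * d) ^+ 2 * ((p * q) ^+ 2 * (1 - p) ^+ 2) + 3 * d ^+ 4 * q ^+ 2) *
       (y1 ^+ 2 + y2 ^+ 2).
Proof.
move=> /andP[r0 r1].
have sq3 (s t v : R) : (s + t + v) ^+ 2 <= 3 * (s ^+ 2 + t ^+ 2 + v ^+ 2).
  by have := sqr_ge0 (s - t); have := sqr_ge0 (t - v); have := sqr_ge0 (s - v); lra.
have h1 := sq3 (2 * d * (p * q) * (z1 + k * y2))
  (- (2 * k * d * (p * q) * (1 - p) * y2)) (- (d ^+ 2 * r * q * y1)).
have h2 := sq3 (2 * d * (p * q) * (z2 - k * y1))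
  (2 * k * d * (p * q) * (1 - p) * y1) (- (d ^+ 2 * r * q * y2)).
have r2 : r ^+ 2 <= 1 by rewrite exprn_ile1.
have h3 : r ^+ 2 * (d ^+ 4 * q ^+ 2 * (y1 ^+ 2 + y2 ^+ 2)) <=
    d ^+ 4 * q ^+ 2 * (y1 ^+ 2 + y2 ^+ 2).
  rewrite ler_piMl// mulr_ge0 ?addr_ge0 ?sqr_ge0// mulr_ge0 ?sqr_ge0//.
  by rewrite (_ : d ^+ 4 = (d ^+ 2) ^+ 2) ?sqr_ge0//; ring.
lra.
Qed.

(** The left side is [residual_pointwise] integrated, with [c = 2 * k * N ^+ 2] and
    [d = (2 * k * N)^-1]. The mismatch term is small because the second difference of the
    reciprocals of [2 * N - 1], [2 * N], [2 * N + 1] is of order [N ^- 3]. *)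
Lemma residual_arithmetic (R : realFieldType) (k N e W M : R) :
  0 < k -> 3 <= N -> 0 <= e -> 0 <= W -> 0 <= M ->
  N * (12 * (2 * k * N)^-1 ^+ 2 * (e * (2 * k * N ^+ 2 / (2 * N - 1)) + W) +
    ((3 * (2 * k * (2 * k * N)^-1) ^+ 2 * M) * ((2 * k * N ^+ 2 / (2 * N - 1) +
      (-2) * (2 * k * N ^+ 2 / (2 * N))) + 2 * k * N ^+ 2 / (2 * N + 1)) +
    (3 * (2 * k * N)^-1 ^+ 4 * M) * (2 * k * N ^+ 2 / (2 * N - 3)))) <=
  6 / k * (e + W / (2 * k * N)) + 6 * k * M / N + 3 * M / (2 * k) / (2 * k * N) ^+ 2.
Proof.
move=> k0 N3 e0 W0 M0.
have N0 : 0 < N by lra.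
have N1 : 0 < 2 * N - 1 by lra.
have N2 : 0 < 2 * N + 1 by lra.
have N4 : 0 < 2 * N - 3 by lra.
have -> : N * (12 * (2 * k * N)^-1 ^+ 2 * (e * (2 * k * N ^+ 2 / (2 * N - 1)) + W) +
    ((3 * (2 * k * (2 * k * N)^-1) ^+ 2 * M) * ((2 * k * N ^+ 2 / (2 * N - 1) +
      (-2) * (2 * k * N ^+ 2 / (2 * N))) + 2 * k * N ^+ 2 / (2 * N + 1)) +
    (3 * (2 * k * N)^-1 ^+ 4 * M) * (2 * k * N ^+ 2 / (2 * N - 3)))) =
    6 / k * (e * (N / (2 * N - 1)) + W / (2 * k * N)) +
    6 * k * M * ((2 * N - 1) * (2 * N + 1))^-1 +
    3 * M / (2 * k) / (2 * k * N) ^+ 2 * (N / (2 * N - 3)).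
  by field; rewrite !gt_eqF.
apply: lerD; first apply: lerD.
- apply: ler_wpM2l; first by rewrite divr_ge0// ltW.
  by rewrite lerD2r ler_piMr// ler_pdivrMr// mul1r; lra.
- apply: ler_wpM2l; first by rewrite !mulr_ge0// ltW.
  rewrite lef_pV2 ?posrE ?mulr_gt0//.
  by have := mulr_ge0 (ltW N0) (ltW N1); nra.
- rewrite ler_piMr//; last by rewrite ler_pdivrMr// mul1r; lra.
  by rewrite !divr_ge0 ?sqr_ge0 ?mulr_ge0// ltW.
Qed.

Section quasimodes.
Variables (R : realType) (k : R) (m : nat).
Hypothesis k_gt0 : 0 < k.

(* With [k = sqrt E] and [eps = 1 / n], the cutoff behaves like
   [exp (- eps x / (2 k))], which damps the outgoing solution as if [E] were
   replaced by [E + i eps].  The offset 3 leaves a positive exponent after two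
   derivatives. *)
Let n : R := m.+3%:R.

(** Chosen so that [n / c = (2 * k * n)^-1], the required damping rate for eps equal to [n^-1]. *)
Definition cutoff_length : R := 2 * k * n ^+ 2.
Let c := cutoff_length.

Definition cutoff (x : R) := ramp c x ^+ m.+3.
Definition cutoff' (x : R) := - (n / c) * ramp c x ^+ m.+2.
Definition cutoff'' (x : R) := n / c * (m.+2%:R / c) * ramp c x ^+ m.+1.

Let n_ge3 : 3 <= n. Proof. by rewrite ler_nat. Qed.
Let n_gt0 : 0 < n. Proof. by rewrite ltr0n. Qed.
Let n_neq0 : n != 0. Proof. by rewrite gt_eqF. Qed.
Let k_neq0 : k != 0. Proof. by rewrite gt_eqF. Qed.
Let m2E : m.+2%:R = n - 1. Proof. by rewrite /n -[m.+3%:R]natr1; ring. Qed.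

Lemma cutoff_length_gt0 : 0 < c.
Proof. by rewrite /c /cutoff_length !mulr_gt0// exprn_gt0. Qed.

Let c_gt0 := cutoff_length_gt0.
Let c_neq0 : c != 0. Proof. by rewrite gt_eqF. Qed.
Let ramp_c : continuous (ramp c). Proof. exact: ramp_continuous. Qed.

Lemma cutoff_continuous : [/\ continuous cutoff, continuous cutoff' & continuous cutoff''].
Proof.
by rewrite /cutoff /cutoff' /cutoff''; split; continuous_by.
Qed.

Lemma cutoff_derive (x : R) : is_derive x 1 cutoff (cutoff' x).
Proof. exact: ramp_derive. Qed.

Lemma cutoff'_derive (x : R) : is_derive x 1 cutoff' (cutoff'' x).
Proof.
have := ramp_derive c_gt0 m.+1 x => ?; rewrite /cutoff' /cutoff''.
by derive_by; ring.
Qed.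

Lemma cutoff_boundary : [/\ cutoff 0 = 1, cutoff c = 0 & cutoff' c = 0].
Proof.
have r0 : ramp c 0 = 1 by rewrite /ramp mul0r subr0.
have rc : ramp c c = 0 by rewrite /ramp divff// subrr.
by rewrite /cutoff /cutoff' r0 rc expr1n !exprS !mul0r mulr0.
Qed.

(** With [residual2], the real and imaginary parts of [- d^2/dx^2 + V - E - i eps] applied to
    [cutoff * (y1 + i y2)]. *)
Definition residual1 (y1 z1 y2 : R -> R) (x : R) : R :=
  n^-1 * cutoff x * y2 x - (cutoff'' x * y1 x + 2 * cutoff' x * z1 x).
Definition residual2 (y1 y2 z2 : R -> R) (x : R) : R :=
  - (n^-1 * cutoff x * y1 x) - (cutoff'' x * y2 x + 2 * cutoff' x * z2 x).

Variables (y1 z1 y2 z2 : R -> R).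
Hypotheses (cy1 : continuous y1) (cz1 : continuous z1).
Hypotheses (cy2 : continuous y2) (cz2 : continuous z2).

(** The factor [n] is the division by eps coming from [poisson_pointwise]. The outgoing defect has
    no rate of decay, only a limit 0, so it enters through an arbitrary [e] plus an integrable
    exponential; the other two terms are small by themselves. *)
Lemma residual_energy_le (e M M' X : R) : 0 <= e -> 0 <= M' ->
  (forall x, 0 <= x -> y1 x ^+ 2 + y2 x ^+ 2 <= M) ->
  (forall x, 0 <= x -> (z1 x + k * y2 x) ^+ 2 + (z2 x - k * y1 x) ^+ 2 <=
    e + M' * expR (X - x)) ->
  n * (intR 0 c (fun x => residual1 y1 z1 y2 x ^+ 2) +
       intR 0 c (fun x => residual2 y1 y2 z2 x ^+ 2)) <=
    6 / k * (e + M' * expR X / (2 * k * n)) + 6 * k * M / n +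
    3 * M / (2 * k) / (2 * k * n) ^+ 2.
Proof.
move=> e0 M'0 phiM psiM; have [ce cde cdde] := cutoff_continuous.
have cr1 : continuous (residual1 y1 z1 y2) by rewrite /residual1; continuous_by.
have cr2 : continuous (residual2 y1 y2 z2) by rewrite /residual2; continuous_by.
have M0 : 0 <= M.
  by apply: le_trans (phiM 0 (lexx _)); rewrite addr_ge0 ?sqr_ge0.
pose d := (2 * k * n)^-1; have d0 : 0 < d by rewrite invr_gt0 !mulr_gt0.
have dE : n / c = d.
  have aux (a b : R) : a != 0 -> b != 0 -> a / (2 * b * a ^+ 2) = (2 * b * a)^-1.
    by move=> a0 b0; field; rewrite ?a0 ?b0.
  exact: aux.
have epsE : n^-1 = 2 * k * d.
  have aux (a b : R) : a != 0 -> b != 0 -> a^-1 = 2 * b * (2 * b * a)^-1.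
    by move=> a0 b0; field; rewrite ?b0 ?a0.
  exact: aux.
pose r := (n - 1) / n.
have r01 : 0 <= r <= 1.
  have n3 := n_ge3; rewrite /r; apply/andP; split.
    by apply: divr_ge0; lra.
  by rewrite ler_pdivrMr// mul1r; lra.
pose p := ramp c.
pose psi x := (z1 x + k * y2 x) ^+ 2 + (z2 x - k * y1 x) ^+ 2.
have cpsi : continuous psi by rewrite /psi; continuous_by.
have pw x : 0 <= x <= c ->
    residual1 y1 z1 y2 x ^+ 2 + residual2 y1 y2 z2 x ^+ 2 <=
    12 * d ^+ 2 * (p x ^+ (m.+2 + m.+2) * psi x) +
    ((3 * (2 * k * d) ^+ 2 * M) * ((p x ^+ (m.+2 + m.+2) +
      (-2) * p x ^+ (m.+2 + m.+3)) + p x ^+ (m.+3 + m.+3)) +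
    (3 * d ^+ 4 * M) * p x ^+ (m.+1 + m.+1)).
  move=> /andP[x0 xc].
  have := residual_pointwise k d (p x) (p x ^+ m.+1) (y1 x) (z1 x) (y2 x) (z2 x) r01.
  have -> : 2 * k * d * (p x ^+ 2 * p x ^+ m.+1) * y2 x -
      (d ^+ 2 * r * p x ^+ m.+1 * y1 x - 2 * (d * (p x * p x ^+ m.+1)) * z1 x) =
      residual1 y1 z1 y2 x.
    rewrite /residual1 /cutoff /cutoff' /cutoff'' -/(p x) dE m2E -epsE.
    have -> : (n - 1) / c = d * r.
      have aux (a b : R) : a != 0 -> b != 0 -> (a - 1) / b = a / b * ((a - 1) / a).
        by move=> a0 b0; field; rewrite ?a0 ?b0.
      by rewrite -dE; exact: aux.
    by rewrite -!exprS -exprD !addSn add0n; ring.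
  have -> : - (2 * k * d * (p x ^+ 2 * p x ^+ m.+1) * y1 x) -
      (d ^+ 2 * r * p x ^+ m.+1 * y2 x - 2 * (d * (p x * p x ^+ m.+1)) * z2 x) =
      residual2 y1 y2 z2 x.
    rewrite /residual2 /cutoff /cutoff' /cutoff'' -/(p x) dE m2E -epsE.
    have -> : (n - 1) / c = d * r.
      have aux (a b : R) : a != 0 -> b != 0 -> (a - 1) / b = a / b * ((a - 1) / a).
        by move=> a0 b0; field; rewrite ?a0 ?b0.
      by rewrite -dE; exact: aux.
    by rewrite -!exprS -exprD !addSn add0n; ring.
  move=> /le_trans; apply; rewrite -/(psi x).
  set q := p x ^+ m.+1.
  have Q1 : p x ^+ (m.+2 + m.+2) = (p x * q) ^+ 2 by rewrite -exprS -exprM muln2 -addnn.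
  have Q2 : p x ^+ (m.+2 + m.+3) = p x * (p x * q) ^+ 2.
    by rewrite addnS exprS Q1.
  have Q3 : p x ^+ (m.+3 + m.+3) = (p x) ^+ 2 * (p x * q) ^+ 2.
    by rewrite addSn exprS Q2 expr2 mulrA.
  have Q4 : p x ^+ (m.+1 + m.+1) = q ^+ 2 by rewrite -exprM muln2 -addnn.
  rewrite Q1 Q2 Q3 Q4 lerD2l.
  apply: (@le_trans _ _ ((3 * (2 * k * d) ^+ 2 * ((p x * q) ^+ 2 * (1 - p x) ^+ 2) +
      3 * d ^+ 4 * q ^+ 2) * M)); last by rewrite le_eqVlt; apply/orP; left; apply/eqP; ring.
  rewrite ler_wpM2l ?phiM//.
  have d4 : 0 <= d ^+ 4 by rewrite exprn_ge0// ltW.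
  have s2 (a b : R) : 0 <= b -> 0 <= 3 * a ^+ 2 * b.
    by move=> b0; rewrite mulr_ge0// mulr_ge0// sqr_ge0.
  have s4 (a b : R) : 0 <= a -> 0 <= 3 * a * b ^+ 2.
    by move=> a0; rewrite mulr_ge0 ?sqr_ge0// mulr_ge0.
  by apply: addr_ge0; [apply: s2; apply: mulr_ge0; exact: sqr_ge0|exact: s4].
have cq : continuous p by [].
rewrite -integralD_continuous; [|by continuous_by|by continuous_by].
apply: (@le_trans _ _ (n * (12 * d ^+ 2 * (e * (c / (m.+2 + m.+2).+1%:R) + M' * expR X) +
  ((3 * (2 * k * d) ^+ 2 * M) * ((c / (m.+2 + m.+2).+1%:R +
      (-2) * (c / (m.+2 + m.+3).+1%:R)) + c / (m.+3 + m.+3).+1%:R) +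
    (3 * d ^+ 4 * M) * (c / (m.+1 + m.+1).+1%:R))))).
  apply: ler_wpM2l; first exact: ltW.
  apply: le_trans; first by apply: le_integral; last exact: pw; continuous_by.
  rewrite integralD_continuous; [|by continuous_by|by continuous_by].
  rewrite integralZ_continuous; last by continuous_by.
  apply: lerD.
    apply: ler_wpM2l; first by rewrite mulr_ge0 ?sqr_ge0.
    exact: ramp_average_le.
  rewrite integralD_continuous; [|by continuous_by|by continuous_by].
  rewrite integralZ_continuous; last by continuous_by.
  rewrite integralZ_continuous; last by continuous_by.
  rewrite integralD_continuous; [|by continuous_by|by continuous_by].
  rewrite integralD_continuous; [|by continuous_by|by continuous_by].
  rewrite integralZ_continuous; last by continuous_by.
  by rewrite !integral_ramp.
have N1 : (m.+2 + m.+2).+1%:R = 2 * n - 1 :> R.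
  by rewrite -natr1 natrD m2E; ring.
have N2 : (m.+2 + m.+3).+1%:R = 2 * n :> R.
  by rewrite -natr1 natrD m2E -/n; ring.
have N3 : (m.+3 + m.+3).+1%:R = 2 * n + 1 :> R.
  by rewrite -natr1 natrD -/n; ring.
have N4 : (m.+1 + m.+1).+1%:R = 2 * n - 3 :> R.
  have m1E : m.+1%:R = n - 2 :> R by rewrite -(addrK 1 m.+1%:R) natr1 m2E; ring.
  by rewrite -natr1 natrD m1E; ring.
rewrite N1 N2 N3 N4 /c /cutoff_length /d.
exact: residual_arithmetic (mulr_ge0 M'0 (expR_ge0 X)) _.
Qed.

Lemma profile_energyE :
  intR 0 c (fun x => (cutoff x * y1 x) ^+ 2) +
  intR 0 c (fun x => (cutoff x * y2 x) ^+ 2) =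
  intR 0 c (fun x => ramp c x ^+ (m.+3 + m.+3) * (y1 x ^+ 2 + y2 x ^+ 2)).
Proof.
have [ce _ _] := cutoff_continuous.
rewrite -integralD_continuous; [|by continuous_by|by continuous_by].
by apply: eq_Rintegral => x _; rewrite /cutoff exprD; ring.
Qed.

(** This is eps times the integral of [cutoff ^+ 2], equal to [k * (2 * n / (2 * n + 1))]; the
    exponential it imitates would give exactly [k]. *)
Let average_weight : R := n^-1 * (c / (m.+3 + m.+3).+1%:R).

Let average_weight_bounds : 0 <= average_weight <= k /\ k - average_weight <= k / n.
Proof.
rewrite /average_weight /c /cutoff_length.
have -> : (m.+3 + m.+3).+1%:R = 2 * n + 1 :> R by rewrite -natr1 natrD -/n; ring.
move: n_gt0 k_gt0; move: (n) (k) => N K N0 K0.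
have N1 : 0 < 2 * N + 1 by lra.
have -> : N^-1 * (2 * K * N ^+ 2 / (2 * N + 1)) = K * (2 * N / (2 * N + 1)).
  by field; rewrite !gt_eqF.
split; first apply/andP; first split.
- by rewrite mulr_ge0 ?divr_ge0 ?mulr_ge0// ltW.
- by apply: ler_piMr; [exact: ltW|rewrite ler_pdivrMr// mul1r; lra].
- have -> : K - K * (2 * N / (2 * N + 1)) = K / (2 * N + 1).
    by field; rewrite gt_eqF.
  by rewrite ler_pM2l// lef_pV2 ?posrE//; lra.
Qed.

Lemma profile_energy_le (M : R) : 0 <= M ->
  (forall x, 0 <= x -> y1 x ^+ 2 + y2 x ^+ 2 <= M) ->
  n^-1 * (intR 0 c (fun x => (cutoff x * y1 x) ^+ 2) +
    intR 0 c (fun x => (cutoff x * y2 x) ^+ 2)) <= k * M.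
Proof.
move=> M0 phiM; rewrite profile_energyE.
have cphi : continuous (fun x => y1 x ^+ 2 + y2 x ^+ 2) by continuous_by.
have phiM' x : 0 <= x -> y1 x ^+ 2 + y2 x ^+ 2 <= M + 0 * expR (0 - x).
  by move=> x0; rewrite mul0r addr0; exact: phiM.
have h := ramp_average_le c_gt0 (m.+3 + m.+3) cphi (lexx 0) phiM'.
have [/andP[_ wk] _] := average_weight_bounds.
have n1 : 0 <= n^-1 by rewrite invr_ge0 ltW.
apply: le_trans (ler_wpM2l n1 h) _.
rewrite mul0r addr0 mulrCA -/average_weight mulrC.
by rewrite ler_wpM2r.
Qed.

(** The weight eps times [cutoff ^+ 2] has mass close to [k] spread over ever longer intervals, so
    it averages to [k * l]. The two sides come from [ramp_average_le] for [phi] and for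
    [-1 * phi]. *)
Lemma profile_energy_close (e M' X l : R) : 0 <= e -> 0 <= M' ->
  (forall x, 0 <= x -> `|y1 x ^+ 2 + y2 x ^+ 2 - l| <= e + M' * expR (X - x)) ->
  `|n^-1 * (intR 0 c (fun x => (cutoff x * y1 x) ^+ 2) +
    intR 0 c (fun x => (cutoff x * y2 x) ^+ 2)) - k * l| <=
    k * e + M' * expR X / n + k * `|l| / n.
Proof.
move=> e0 M'0 close; rewrite profile_energyE.
pose phi x := y1 x ^+ 2 + y2 x ^+ 2.
have cphi : continuous phi by rewrite /phi; continuous_by.
have cphiN : continuous (fun x => -1 * phi x) by continuous_by.
have up x : 0 <= x -> phi x <= (l + e) + M' * expR (X - x).
  by move=> /close; rewrite ler_norml /phi => /andP[_]; lra.
have lo x : 0 <= x -> -1 * phi x <= (e - l) + M' * expR (X - x).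
  by move=> /close; rewrite ler_norml /phi => /andP[+ _]; lra.
have hu := ramp_average_le c_gt0 (m.+3 + m.+3) cphi M'0 up.
have hl := ramp_average_le c_gt0 (m.+3 + m.+3) cphiN M'0 lo.
set J := intR 0 c (fun x => ramp c x ^+ (m.+3 + m.+3) * _).
have Jl : intR 0 c (fun x => ramp c x ^+ (m.+3 + m.+3) * (-1 * phi x)) = - J.
  transitivity (-1 * J); last by rewrite mulN1r.
  rewrite /J -integralZ_continuous; last by continuous_by.
  by apply: eq_Rintegral => x _; rewrite /phi; ring.
rewrite {}Jl in hl; rewrite -/J in hu.
have n1 : 0 <= n^-1 by rewrite invr_ge0 ltW.
have {}hu := ler_wpM2l n1 hu; have {}hl := ler_wpM2l n1 hl.
rewrite mulrDr mulrCA -/average_weight in hu.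
rewrite mulrDr mulrCA -/average_weight in hl.
have [/andP[w0 wk] kw] := average_weight_bounds.
have we : e * average_weight <= k * e by rewrite mulrC ler_wpM2r.
have wl : `|(k - average_weight) * l| <= k * `|l| / n.
  rewrite normrM ger0_norm ?subr_ge0// mulrAC ler_wpM2r//.
have ME : n^-1 * (M' * expR X) = M' * expR X / n by rewrite mulrC.
rewrite ME in hu hl; rewrite mulrN in hl.
move: wl; rewrite !ler_norml => /andP[wl1 wl2].
move: hu hl we wl1 wl2; move: (n^-1 * J) (M' * expR X / n) (k * `|l| / n).
move: average_weight => w I1 I2 I3 *.
by apply/andP; split; lra.
Qed.

End quasimodes.

(** * Limit and local boundedness of the Poisson integral *)

Lemma weight_limit_squeeze (R : realType) (a b P : nat -> R) (l : R) :
  a n @[n --> \oo] --> l -> b n @[n --> \oo] --> (0 : R) ->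
  (forall (t : R) n, 0 < t -> P n <= (1 + t) * a n + (1 + t^-1) * b n) ->
  (forall (t : R) n, 0 < t -> a n <= (1 + t) * P n + (1 + t^-1) * b n) ->
  P n @[n --> \oo] --> l.
Proof.
move=> /cvgrPdist_le al /cvgrPdist_le b0 hu hl; apply/cvgrPdist_le => e e0.
(* The weight [t] is fixed before [n] grows, so that [(1 + t^-1) * b n] still vanishes;
   [|l| + e + 2] exceeds both [a n] and [P n] eventually. *)
pose t := Num.min 1 (e / (4 * (`|l| + e + 2))).
have l0 : 0 < `|l| + e + 2 by have := normr_ge0 l; lra.
have t0 : 0 < t by rewrite lt_min ltr01 divr_gt0// mulr_gt0.
have tl : t * (`|l| + e + 2) <= e / 4.
  apply: (@le_trans _ _ (e / (4 * (`|l| + e + 2)) * (`|l| + e + 2))).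
    by rewrite ler_wpM2r ?(ltW l0)// ge_min lexx orbT.
  by rewrite le_eqVlt; apply/orP; left; apply/eqP; field; rewrite gt_eqF.
have t1 : t <= 1 by rewrite ge_min lexx.
have ti : 0 < 1 + t^-1 by rewrite addr_gt0// invr_gt0.
pose d := Num.min (e / 4) (e / 4 / (1 + t^-1)).
have d0 : 0 < d by rewrite lt_min !divr_gt0.
pose d1 := Num.min 1 (e / 4); have d10 : 0 < d1 by rewrite lt_min ltr01 divr_gt0.
near=> n.
have an : `|l - a n| <= d1 by near: n; exact: al.
have bn : `|0 - b n| <= d by near: n; exact: b0.
have bn' : (1 + t^-1) * b n <= e / 4.
  rewrite mulrC -ler_pdivlMr//; move: bn; rewrite sub0r normrN le_min => /andP[_].
  exact/le_trans/ler_norm.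
have an' : `|l - a n| <= 1 /\ `|l - a n| <= e / 4.
  by move: an; rewrite /d1 le_min => /andP[].
have := hu t n t0; have := hl t n t0; move: an' tl; rewrite !ler_norml.
have := ler_norm l; have := ler_norm (- l); rewrite normrN.
set L := `|l| => L1 L2 [/andP[q1 q2] /andP[q3 q4]] tl h1 h2.
have ta : t * a n <= e / 4.
  apply: le_trans tl; rewrite ler_wpM2l ?(ltW t0)//; lra.
have Pn : P n <= l + e by lra.
have tP : t * P n <= e / 4.
  apply: le_trans tl; rewrite ler_wpM2l ?(ltW t0)//; lra.
by apply/andP; split; lra.
Unshelve. all: by end_near. Qed.

Lemma cvg_of_inverse_bound (R : realType) (s : nat -> R) (l : R) :
  (forall e : R, 0 < e -> exists D, forall m, `|s m - l| <= e + D / m.+3%:R) ->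
  s m @[m --> \oo] --> l.
Proof.
move=> sb; apply/cvgrPdist_le => e e0.
have [D Db] := sb _ (divr_gt0 e0 (ltr0Sn R 1)).
have D0 : 0 < `|D| + 1 by rewrite ltr_pwDr.
have eD : 0 < e / 2 / (`|D| + 1) by rewrite !divr_gt0.
near=> m; rewrite distrC; apply: le_trans (Db m) _.
have mi : m.+1%:R^-1 < e / 2 / (`|D| + 1).
  by near: m; exact: (near_infty_natSinv_lt (PosNum eD)).
have m3 : (m.+3%:R : R)^-1 <= m.+1%:R^-1 by rewrite lef_pV2 ?posrE// ler_nat leqW.
have : (`|D| + 1) * m.+3%:R^-1 <= e / 2.
  by rewrite mulrC -ler_pdivlMr// (le_trans m3)// ltW.
have m0 : (0 : R) < m.+3%:R^-1 by rewrite invr_gt0.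
move=> Dm; rewrite [leRHS](splitr e) lerD2l; apply: le_trans Dm.
by rewrite ler_wpM2r ?(ltW m0)//; have := ler_norm D; lra.
Unshelve. all: by end_near. Qed.

(** Puts a limit at infinity in the form that [ramp_average_le] accepts: for [x <= X] the
    exponential is at least 1, and [M + |l|] bounds the difference. *)
Lemma limit_exp_bound (R : realType) (f : R -> R) (l M : R) :
  f x @[x --> +oo] --> l -> (forall x, 0 <= x -> `|f x| <= M) ->
  forall e : R, 0 < e -> exists M' X, 0 <= M' /\
    forall x, 0 <= x -> `|f x - l| <= e + M' * expR (X - x).
Proof.
move=> /cvgrPdist_le fl fM e e0; have [X [_ Xb]] := fl _ e0.
have M0 : 0 <= M by apply: le_trans (fM 0 (lexx _)).
exists (M + `|l|), X; split; first by rewrite addr_ge0.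
move=> x x0; have [xX|Xx] := leP x X; last first.
  by rewrite distrC (le_trans (Xb _ Xx))// lerDl mulr_ge0 ?expR_ge0 ?addr_ge0.
rewrite (le_trans (ler_normB _ _))//.
apply: (@le_trans _ _ (M + `|l|)); first by rewrite lerD2r fM.
apply: (@le_trans _ _ ((M + `|l|) * expR (X - x))).
  rewrite ler_peMr ?addr_ge0// -(@expR0 R) ler_expR subr_ge0//.
by rewrite lerDr ltW.
Qed.

Section poisson_limit.
Variables (R : realType) (V dV : R -> R) (u z : R -> R -> R).
Variable mu : {measure set (measurableTypeR R) -> \bar R}.
Hypothesis V_dec : decaying_potential V dV.
Hypothesis u_sol : forall E : R, solution V E (u E) (z E).
Hypotheses (u_0 : forall E : R, u E 0 = 0) (z_0 : forall E : R, z E 0 = 1).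
Hypothesis parseval : forall (f : R -> R) (b : R), continuous f ->
  exists phi : R -> R, [/\ measurable_fun setT phi,
    {ae mu, forall E, phi E = intR 0 b (fun x => f x * u E x)} &
    (\int[mu]_E (phi E ^+ 2)%:E = (intR 0 b (fun x => f x ^+ 2))%:E)%E].

(** Parseval turns the four integrals over [mu] in [poisson_compare] into integrals over [[0, c]].
    The linear relations between the transforms are Green's identity for [y1] and [y2], whose values
    1 and 0 at the origin produce the leading 1 and 0. *)
Lemma poisson_estimate (E k t : R) (m : nat) (y1 z1 y2 z2 : R -> R) :
  0 < k -> 0 < t ->
  solution V E y1 z1 -> solution V E y2 z2 -> y1 0 = 1 -> y2 0 = 0 ->
  let c := cutoff_length k m in
  let a := m.+3%:R^-1 * (intR 0 c (fun x => (cutoff k m x * y1 x) ^+ 2) +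
      intR 0 c (fun x => (cutoff k m x * y2 x) ^+ 2)) in
  let b := m.+3%:R * (intR 0 c (fun x => residual1 k m y1 z1 y2 x ^+ 2) +
      intR 0 c (fun x => residual2 k m y1 y2 z2 x ^+ 2)) in
  (poisson mu E m.+3%:R^-1 <= ((1 + t) * a + (1 + t^-1) * b)%:E)%E /\
  (a%:E <= (1 + t)%:E * poisson mu E m.+3%:R^-1 + ((1 + t^-1) * b)%:E)%E.
Proof.
move=> k0 t0 sol1 sol2 y10 y20 c a b.
have [ce cde cdde] := cutoff_continuous k m.
have [e0 ec dec] := cutoff_boundary m k0.
have c0 := cutoff_length_gt0 m k0; rewrite -/c in c0.
have [cy1 cz1 _ _] := sol1; have [cy2 cz2 _ _] := sol2.
have cr1 : continuous (residual1 k m y1 z1 y2) by rewrite /residual1; continuous_by.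
have cr2 : continuous (residual2 k m y1 y2 z2) by rewrite /residual2; continuous_by.
have [|A [mA eA iA]] := @parseval (fun x => cutoff k m x * y1 x) c.
  by continuous_by.
have [|B [mB eB iB]] := @parseval (fun x => cutoff k m x * y2 x) c.
  by continuous_by.
have [R1 [mR1 eR1 iR1]] := parseval c cr1.
have [R2 [mR2 eR2 iR2]] := parseval c cr2.
have n0 : (0 : R) < m.+3%:R^-1 by rewrite invr_gt0.
have rel : {ae mu, forall F, (F - E) * A F + m.+3%:R^-1 * B F = 1 + R1 F /\
                    (F - E) * B F - m.+3%:R^-1 * A F = R2 F}.
  have ae := ae_filter_ringOfSetsType mu.
  have ae4 := @filterI _ _ ae _ _ (@filterI _ _ ae _ _ eA eB)
    (@filterI _ _ ae _ _ eR1 eR2).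
  apply: (@filterS _ _ ae _ _ _ ae4) => F [[/= -> ->] [-> ->]].
  have [cu _ _ _] := u_sol F.
  have g1 := green_identity (ltW c0) sol1 (u_sol F) (u_0 F) (z_0 F) ce cde cdde
    (cutoff_derive m k0) (cutoff'_derive m k0) e0 ec dec.
  have g2 := green_identity (ltW c0) sol2 (u_sol F) (u_0 F) (z_0 F) ce cde cdde
    (cutoff_derive m k0) (cutoff'_derive m k0) e0 ec dec.
  have transpose (a' r s w : R) : a' + r = s -> a' + w = s + (w + -1 * r) by lra.
  rewrite y10 in g1; rewrite y20 in g2.
  split.
  - have -> : intR 0 c (fun x => residual1 k m y1 z1 y2 x * u F x) =
      m.+3%:R^-1 * intR 0 c (fun x => cutoff k m x * y2 x * u F x) + -1 *
      intR 0 c (fun x => (cutoff'' k m x * y1 x + 2 * cutoff' k m x * z1 x) * u F x).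
      do 2 (rewrite -integralZ_continuous; last by continuous_by).
      rewrite -integralD_continuous; [|by continuous_by|by continuous_by].
      by apply: eq_Rintegral => x _; rewrite /residual1; ring.
    exact: transpose g1.
  - have -> : intR 0 c (fun x => residual2 k m y1 y2 z2 x * u F x) =
      - m.+3%:R^-1 * intR 0 c (fun x => cutoff k m x * y1 x * u F x) + -1 *
      intR 0 c (fun x => (cutoff'' k m x * y2 x + 2 * cutoff' k m x * z2 x) * u F x).
      do 2 (rewrite -integralZ_continuous; last by continuous_by).
      rewrite -integralD_continuous; [|by continuous_by|by continuous_by].
      by apply: eq_Rintegral => x _; rewrite /residual2; ring.
    by rewrite -[RHS]add0r -mulNr; exact: transpose g2.
have [p1 p2] := poisson_compare n0 t0 mA mB mR1 mR2 rel iA iB iR1 iR2.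
split.
- by apply: le_trans p1 _; rewrite lee_fin invrK /a /b !mulrA.
- by move: p2; rewrite invrK /b !mulrA.
Qed.

Lemma outgoing_energy_le (k M : R) (y1 z1 y2 z2 : R -> R) x : 0 <= k ->
  y1 x ^+ 2 + z1 x ^+ 2 <= M -> y2 x ^+ 2 + z2 x ^+ 2 <= M ->
  y1 x ^+ 2 + y2 x ^+ 2 <= 2 * M /\
  (z1 x + k * y2 x) ^+ 2 + (z2 x - k * y1 x) ^+ 2 <= (4 + 4 * k ^+ 2) * M.
Proof.
move=> k0 h1 h2; have := sqr_ge0 (z1 x); have := sqr_ge0 (z2 x).
have := sqr_ge0 (y1 x); have := sqr_ge0 (y2 x) => a1 a2 a3 a4.
split; first by lra.
have b1 := sqr_ge0 (z1 x - k * y2 x); have b2 := sqr_ge0 (z2 x + k * y1 x).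
have b3 : k ^+ 2 * (y1 x ^+ 2 + y2 x ^+ 2) <= k ^+ 2 * (2 * M).
  by rewrite ler_wpM2l ?sqr_ge0//; lra.
lra.
Qed.

(** Here nothing has to tend to 0: with [t = 1] and no exponential term ([M' = 0]), the bounds of
    [solution_bounded], uniform in [E], suffice. The result is the domination needed in Stieltjes
    inversion. *)
Lemma poisson_bounded a b : 0 < a -> a <= b -> exists C, forall E m, a <= E <= b ->
  (poisson mu E m.+3%:R^-1 <= C%:E)%E.
Proof.
move=> a0 ab; have [C C0 Cb] := solution_bounded V_dec a0 ab.
have b0 : 0 < b by exact: lt_le_trans ab.
(* The initial values of [u] give [1 <= C K], so that the energies [E / K] of the
   outgoing solution are at most [b C]. *)
pose M := C * (b * C).
have M0 : 0 <= M by rewrite !mulr_ge0 ?ltW.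
pose ka := Num.sqrt a.
pose kb := Num.sqrt b.
have ka0 : 0 < ka by rewrite sqrtr_gt0.
exists (2 * (kb * (2 * M)) + 2 * (6 / ka * ((4 + 4 * b) * M) +
  6 * kb * (2 * M) + 3 * (2 * M) / (2 * ka) / (2 * ka) ^+ 2)).
move=> E m /andP[aE Eb]; have E0 : 0 < E by exact: lt_le_trans aE.
have aEb : a <= E <= b by rewrite aE Eb.
set K := energy_limit V E (u E) (z E).
have [y1 [z1 [y2 [z2 [[s1 s2] [y10 y20] [k1 k2] _ _]]]]] :=
  outgoing_solution V_dec E0 (u_sol E) (u_0 E) (z_0 E).
rewrite -/K in k1 k2.
have K0 : 0 < K by exact (energy_limit_gt0 V_dec E0 (u_sol E) (u_0 E) (z_0 E)).
have CK : 1 <= C * K.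
  by have := Cb _ _ _ 0 aEb (u_sol E) (lexx _); rewrite u_0 z_0 expr1n expr0n add0r.
have EK : C * (E / K) <= M.
  apply: ler_wpM2l; first exact: ltW.
  apply: ler_pM => //; [exact: ltW|by rewrite invr_ge0 ltW|].
  by rewrite -[leLHS]mul1r ler_pdivrMr.
have [cy1 cz1 _ _] := s1; have [cy2 cz2 _ _] := s2.
have e1 x : 0 <= x -> y1 x ^+ 2 + z1 x ^+ 2 <= M.
  by move=> x0; apply: le_trans (Cb _ _ _ _ aEb s1 x0) _; rewrite k1.
have e2 x : 0 <= x -> y2 x ^+ 2 + z2 x ^+ 2 <= M.
  by move=> x0; apply: le_trans (Cb _ _ _ _ aEb s2 x0) _; rewrite k2.
set k := Num.sqrt E.
have k0 : 0 < k by rewrite sqrtr_gt0.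
have kE : k ^+ 2 = E by rewrite sqr_sqrtr// ltW.
have kb_ge : k <= kb by exact: ler_wsqrtr.
have ka_le : ka <= k by exact: ler_wsqrtr.
have phiM x : 0 <= x -> y1 x ^+ 2 + y2 x ^+ 2 <= 2 * M.
  by move=> x0; have [] := outgoing_energy_le (ltW k0) (e1 x x0) (e2 x x0).
have psiM x : 0 <= x -> (z1 x + k * y2 x) ^+ 2 + (z2 x - k * y1 x) ^+ 2 <=
    (4 + 4 * b) * M + 0 * expR (0 - x).
  move=> x0; have [_] := outgoing_energy_le (ltW k0) (e1 x x0) (e2 x x0).
  move=> /le_trans; apply; rewrite mul0r addr0 ler_wpM2r// kE; lra.
have pM : 0 <= (4 + 4 * b) * M by rewrite mulr_ge0//; lra.
have [up _] := poisson_estimate m k0 (ltr01 : (0 : R) < 1) s1 s2 y10 y20.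
apply: le_trans up _; rewrite lee_fin invr1.
have res := residual_energy_le m k0 cy1 cz1 cy2 cz2 pM (lexx 0) phiM psiM.
have M20 : 0 <= 2 * M by rewrite mulr_ge0.
have pro := profile_energy_le m k0 cy1 cy2 M20 phiM.
apply: lerD; apply: ler_wpM2l => //.
- by apply: le_trans pro _; rewrite ler_wpM2r.
- apply: le_trans res _; rewrite mul0r mul0r addr0.
  have n1 : (1 : R) <= m.+3%:R by rewrite ler1n.
  apply: lerD; first apply: lerD.
  + by rewrite ler_wpM2r// ler_wpM2l// lef_pV2 ?posrE.
  + rewrite ler_pdivrMr ?ltr0n//; apply: (@le_trans _ _ (6 * kb * (2 * M))).
      by rewrite ler_wpM2r// ler_wpM2l.
    by rewrite ler_peMr// !mulr_ge0// ltW// (lt_le_trans k0).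
  + have kk0 : 0 < 2 * k by rewrite mulr_gt0.
    have ka2 : 0 < 2 * ka by rewrite mulr_gt0.
    have kka : 2 * ka <= 2 * k by rewrite ler_wpM2l.
    have kn : 2 * k <= 2 * k * m.+3%:R by rewrite ler_peMr// ltW.
    have kan : 2 * ka <= 2 * k * m.+3%:R by exact: le_trans kn.
    have kn0 : 0 < 2 * k * m.+3%:R by exact: lt_le_trans kn.
    apply: ler_pM.
    * by rewrite divr_ge0 ?(ltW kk0)// mulr_ge0.
    * by rewrite invr_ge0 sqr_ge0.
    * by apply: ler_wpM2l; [rewrite mulr_ge0|rewrite lef_pV2 ?posrE].
    * rewrite lef_pV2 ?posrE ?exprn_gt0//.
      by rewrite ler_sqr ?nnegrE ?(ltW ka2) ?(ltW kn0).
Qed.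

End poisson_limit.

Section poisson_convergence.
Variables (R : realType) (V dV : R -> R) (u z : R -> R -> R).
Variable mu : {measure set (measurableTypeR R) -> \bar R}.
Hypothesis V_dec : decaying_potential V dV.
Hypothesis u_sol : forall E : R, solution V E (u E) (z E).
Hypotheses (u_0 : forall E : R, u E 0 = 0) (z_0 : forall E : R, z E 0 = 1).
Hypothesis parseval : forall (f : R -> R) (b : R), continuous f ->
  exists phi : R -> R, [/\ measurable_fun setT phi,
    {ae mu, forall E, phi E = intR 0 b (fun x => f x * u E x)} &
    (\int[mu]_E (phi E ^+ 2)%:E = (intR 0 b (fun x => f x ^+ 2))%:E)%E].

Lemma poisson_ge0 E eps : 0 < eps -> (0 <= poisson mu E eps)%E.
Proof.
by move=> e0; apply: integral_ge0 => F _; rewrite lee_fin poisson_kernel_ge0.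
Qed.

Lemma poisson_cvg E : 0 < E ->
  poisson mu E m.+3%:R^-1 @[m --> \oo] -->
    (Num.sqrt E / energy_limit V E (u E) (z E))%:E.
Proof.
move=> E0; set K := energy_limit V E (u E) (z E); set k := Num.sqrt E.
have [y1 [z1 [y2 [z2 [[s1 s2] [y10 y20] _ [lim1 lim2] lim]]]]] :=
  outgoing_solution V_dec E0 (u_sol E) (u_0 E) (z_0 E).
rewrite -/K -/k in lim1 lim2 lim.
have k0 : 0 < k by rewrite sqrtr_gt0.
have [cy1 cz1 _ _] := s1; have [cy2 cz2 _ _] := s2.
have [M1 Mb1] := solution_norm_bounded V_dec E0 s1.
have [M2 Mb2] := solution_norm_bounded V_dec E0 s2.
pose M := M1 ^+ 2 + M2 ^+ 2.
have sqb (t N : R) : `|t| <= N -> t ^+ 2 <= N ^+ 2.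
  move=> tN; rewrite -real_normK ?num_real// ler_sqr ?nnegrE//.
  exact: le_trans tN.
have y1b x : 0 <= x -> y1 x ^+ 2 <= M1 ^+ 2 by move=> /Mb1[/sqb].
have z1b x : 0 <= x -> z1 x ^+ 2 <= M1 ^+ 2 by move=> /Mb1[_ /sqb].
have y2b x : 0 <= x -> y2 x ^+ 2 <= M2 ^+ 2 by move=> /Mb2[/sqb].
have z2b x : 0 <= x -> z2 x ^+ 2 <= M2 ^+ 2 by move=> /Mb2[_ /sqb].
pose phi x := y1 x ^+ 2 + y2 x ^+ 2.
pose psi x := (z1 x + k * y2 x) ^+ 2 + (z2 x - k * y1 x) ^+ 2.
have phiM x : 0 <= x -> phi x <= M by move=> x0; rewrite lerD ?y1b ?y2b.
have phiMn x : 0 <= x -> `|phi x| <= M.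
  by move=> x0; rewrite ger0_norm ?phiM// addr_ge0 ?sqr_ge0.
have M0 : 0 <= M by rewrite addr_ge0 ?sqr_ge0.
have psiMn x : 0 <= x -> `|psi x| <= (4 + 4 * k ^+ 2) * (2 * M).
  move=> x0; rewrite ger0_norm ?addr_ge0 ?sqr_ge0//.
  have := y1b x x0; have := z1b x x0; have := y2b x x0; have := z2b x x0.
  have := sqr_ge0 M1; have := sqr_ge0 M2 => m2 m1 ? ? ? ?.
  by apply: (outgoing_energy_le (ltW k0) _ _).2; rewrite /M; lra.
have psi0 : psi x @[x --> +oo] --> (0 : R).
  have -> : (0 : R) = 0 ^+ 2 + 0 ^+ 2 by rewrite expr0n addr0.
  by apply: cvgD; apply: cvg_expn.
pose n (m : nat) : R := m.+3%:R; pose c m := cutoff_length k m.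
pose a m := (n m)^-1 * (intR 0 (c m) (fun x => (cutoff k m x * y1 x) ^+ 2) +
      intR 0 (c m) (fun x => (cutoff k m x * y2 x) ^+ 2)).
pose b m := n m * (intR 0 (c m) (fun x => residual1 k m y1 z1 y2 x ^+ 2) +
      intR 0 (c m) (fun x => residual2 k m y1 y2 z2 x ^+ 2)).
have n1 m : (1 : R) <= n m by rewrite ler1n.
have n0 m : (0 : R) < n m by rewrite ltr0n.
have al : a m @[m --> \oo] --> k / K.
  apply: cvg_of_inverse_bound => e e0.
  have [M' [X [M'0 close]]] := limit_exp_bound lim phiMn (divr_gt0 e0 k0).
  exists (M' * expR X + k * `|K^-1|) => m.
  have := profile_energy_close m k0 cy1 cy2 (ltW (divr_gt0 e0 k0)) M'0 close.
  by move=> /le_trans; apply; rewrite mulrC divfK ?gt_eqF// -addrA -mulrDl.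
have b0 : b m @[m --> \oo] --> (0 : R).
  apply: cvg_of_inverse_bound => e e0.
  (* Compensates the factor [6 / k] in front of the outgoing defect. *)
  have e6 : 0 < e * k / 6 by rewrite divr_gt0 ?mulr_gt0.
  have [M' [X [M'0 close]]] := limit_exp_bound psi0 psiMn e6.
  have psile x : 0 <= x -> psi x <= e * k / 6 + M' * expR (X - x).
    by move=> /close; rewrite subr0; exact/le_trans/ler_norm.
  exists (6 / k * (M' * expR X / (2 * k)) + 6 * k * M + 3 * M / (2 * k) / (2 * k) ^+ 2).
  move=> m; have := residual_energy_le m k0 cy1 cz1 cy2 cz2 (ltW e6) M'0 phiM psile.
  rewrite subr0 ger0_norm; last first.
    apply: mulr_ge0; first exact: ltW.
    by apply: addr_ge0; apply: Rintegral_ge0 => x _; exact: sqr_ge0.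
  move=> /le_trans; apply; rewrite -/(n m).
  have kn := lt0r_neq0 k0; have nn := lt0r_neq0 (n0 m).
  move: (n m) (n1 m) (n0 m) nn => N N1 N0 Nn.
  have -> : 6 / k * (e * k / 6 + M' * expR X / (2 * k * N)) =
      e + 6 / k * (M' * expR X / (2 * k)) / N.
    by field; rewrite ?kn ?Nn.
  have h3 : 3 * M / (2 * k) / (2 * k * N) ^+ 2 <= 3 * M / (2 * k) / (2 * k) ^+ 2 / N.
    have -> : 3 * M / (2 * k) / (2 * k * N) ^+ 2 =
        3 * M / (2 * k) / (2 * k) ^+ 2 / N * N^-1 by field; rewrite ?kn ?Nn.
    rewrite ler_piMr ?invf_le1//.
    have M3 : 0 <= 3 * M by rewrite mulr_ge0.
    have k2 : 0 <= 2 * k by rewrite mulr_ge0// ltW.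
    by rewrite !divr_ge0 ?sqr_ge0 ?(ltW N0).
  rewrite !(mulrDl _ _ N^-1).
  by move: h3; set T := _ / (2 * k * N) ^+ 2; set T' := _ / (2 * k) ^+ 2 / N; lra.
have est t m : 0 < t -> _ := fun t0 =>
  poisson_estimate u_sol u_0 z_0 parseval m k0 t0 s1 s2 y10 y20.
have nV m : (0 : R) < (n m)^-1 by rewrite invr_gt0.
(* The upper estimate, at [t = 1], already shows finiteness; the rest can then be done with real
   sequences. *)
have fin m : poisson mu E (n m)^-1 \is a fin_num.
  rewrite ge0_fin_numE ?poisson_ge0//.
  by have [/le_lt_trans + _] := est 1 m ltr01; apply; rewrite ltry.
pose P m := fine (poisson mu E (n m)^-1).
have PE m : poisson mu E (n m)^-1 = (P m)%:E by rewrite /P fineK.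
have Pl : P m @[m --> \oo] --> k / K.
  apply: (weight_limit_squeeze al b0) => t m t0.
  - by have [+ _] := est t m t0; rewrite -/(n m) PE lee_fin.
  - by have [_] := est t m t0; rewrite -/(n m) PE -EFinM -EFinD lee_fin.
have -> : (fun m : nat => poisson mu E m.+3%:R^-1) = EFin \o P.
  by apply/funext => m; rewrite -/(n m) PE.
by apply: cvg_EFin; [exact: nearW|].
Qed.

End poisson_convergence.

(** * Stieltjes inversion *)

(** For [a <= b] and [eps > 0], the angle under which [[a, b]] is seen from [F + i eps], which is
    the integral of the Poisson kernel over [E] in [[a, b]]. *)
Definition poisson_mass (R : realType) (a b eps F : R) : R :=
  atan ((F - a) / eps) - atan ((F - b) / eps).

Section poisson_kernel.
Variable R : realType.
Implicit Types (a b eps E F : R).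

Let kernel E F eps := eps / ((F - E) ^+ 2 + eps ^+ 2).

Let kernel_continuous F eps : 0 < eps -> continuous (fun E => kernel E F eps).
Proof.
move=> e0 x; apply: cvgM; first exact: cvg_cst.
apply: cvgV; first by rewrite gt_eqF// ltr_wpDl ?sqr_ge0 ?exprn_gt0.
by repeat cont_step.
Qed.

Lemma integral_poisson_kernel a b F eps : a <= b -> 0 < eps ->
  (\int[lebesgue_measure]_(E in `[a, b]) (eps / ((F - E) ^+ 2 + eps ^+ 2))%:E =
    (poisson_mass a b eps F)%:E)%E.
Proof.
move=> ab e0; have cK := @kernel_continuous F _ e0.
rewrite -[LHS]fineK; last first.
  by apply: integrable_fin_num => //; exact: integrable_continuous cK.
congr (_%:E).
transitivity (- atan ((F - b) / eps) - - atan ((F - a) / eps)); last first.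
  by rewrite /poisson_mass opprK addrC.
apply: (@integral_derive _ _ (fun E => - atan ((F - E) / eps))) => //.
- move=> x; apply: cvgN; apply: (@continuous_cvg _ _ _ _ _ _ (@atan R)).
    exact: continuous_atan.
  by repeat cont_step.
- move=> x _; have en : eps != 0 by rewrite gt_eqF.
  have d : is_derive x 1 (fun E => (F - E) / eps) (- eps^-1).
    by derive_by; ring.
  have d' := @is_derive1_comp _ _ (fun E => (F - E) / eps) _ _ _
    (is_derive1_atan ((F - x) / eps)) d.
  derive_by.
  have : (F - x) ^+ 2 + eps ^+ 2 != 0.
    by rewrite gt_eqF// ltr_wpDl ?sqr_ge0 ?exprn_gt0.
  rewrite /GRing.scale /= => h2; field.
  by rewrite h2 en.
Qed.

End poisson_kernel.

Section poisson_fubini.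
Variables (R : realType).
Variable mu : {sigma_finite_measure set (measurableTypeR R) -> \bar R}.
Variables (a b eps : R).
Hypotheses (ab : a <= b) (eps0 : 0 < eps).

(** The pair is [(E, F)]; the indicator of [[a, b]] is part of the integrand, so that Tonelli's
    theorem is applied on the whole plane. *)
Let f (w : measurableTypeR R * measurableTypeR R) : \bar R :=
  (eps / ((w.2 - w.1) ^+ 2 + eps ^+ 2) * \1_`[a, b] w.1)%:E.

Let f_ge0 w : (0 <= f w)%E.
Proof. by rewrite lee_fin mulr_ge0// poisson_kernel_ge0. Qed.

Let f_meas : measurable_fun setT f.
Proof.
apply/measurable_EFinP; apply: measurable_funM.
  apply: (@measurableT_comp _ _ _ _ _ _ (fun t : R => eps / (t ^+ 2 + eps ^+ 2))).
    by have := measurable_poisson_kernel 0 eps0; under eq_fun do rewrite subr0.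
  by apply: measurable_funB; [exact: measurable_snd|exact: measurable_fst].
apply: (@measurableT_comp _ _ _ _ _ _ (\1_`[a, b] : R -> R)).
  exact: measurable_indic.
exact: measurable_fst.
Qed.

Let inner1 E : (\int[mu]_F f (E, F) = (poisson mu E eps) * (\1_`[a, b] E)%:E)%E.
Proof.
rewrite /f /=; under eq_integral do rewrite mulrC EFinM.
rewrite ge0_integralZl_EFin//; first by rewrite muleC.
- by move=> F _; rewrite lee_fin poisson_kernel_ge0.
- by apply/measurable_EFinP; exact (measurable_poisson_kernel E eps0).
Qed.

Lemma measurable_poisson : measurable_fun `[a, b] (fun E => poisson mu E eps).
Proof.
have := measurable_fun_fubini_tonelli_F f f_meas f_ge0 (m2 := mu).
rewrite /fubini_F; under eq_fun do rewrite inner1.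
move=> h; apply/(measurable_restrictT _ _).2 => //.
by rewrite epatch_indic.
Qed.

Lemma integral_poisson :
  (\int[lebesgue_measure]_(E in `[a, b]) poisson mu E eps =
   \int[mu]_F (poisson_mass a b eps F)%:E)%E.
Proof.
have := fubini_tonelli f f_meas f_ge0 (m1 := lebesgue_measure) (m2 := mu).
under eq_integral do rewrite inner1.
move=> h; transitivity (\int[lebesgue_measure]_E
  (poisson mu E eps * (\1_`[a, b] E)%R%:E))%E.
  by rewrite integral_mkcond; apply: eq_integral => E _; rewrite epatch_indic.
rewrite {}h; apply: eq_integral => F _; rewrite -integral_poisson_kernel//.
rewrite [RHS]integral_mkcond; apply: eq_integral => E _.
by rewrite epatch_indic /f EFinM.
Qed.

End poisson_fubini.

Section poisson_mass.
Variable R : realType.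
Implicit Types (a b eps t F : R).

Lemma poisson_mass_continuous a b eps : continuous (poisson_mass a b eps).
Proof.
have catan (g : R -> R) : continuous g -> continuous (fun x => atan (g x)).
  by move=> cg x; apply: (@continuous_cvg _ _ _ _ _ g (@atan R));
    [exact: continuous_atan|exact: cg].
move=> x; apply: cvgB.
- by apply: (catan (fun F => (F - a) / eps)); continuous_by.
- by apply: (catan (fun F => (F - b) / eps)); continuous_by.
Qed.

Lemma atan_scaled_cvg t : 0 < t -> atan (t / m.+3%:R^-1) @[m --> \oo] --> pi / 2.
Proof.
move=> t0; apply: (@cvg_comp _ _ _ (fun m : nat => t / m.+3%:R^-1) (@atan R) _ +oo%R);
  last exact: cvgy_atan.
apply/cvgryPge => A; near=> m; rewrite invrK mulrC -ler_pdivrMr//.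
have : A / t <= m%:R by near: m; exact: nbhs_infty_ger.
by move=> /le_trans; apply; rewrite ler_nat !leqW.
Unshelve. all: by end_near. Qed.

(** The angle opens to pi inside the interval and closes to 0 outside. For [a < b] it tends to
    [pi / 2] at the endpoints, which must then be shown to have no mass. *)
Lemma poisson_mass_cvg a b F : a <= b -> F != a -> F != b ->
  poisson_mass a b m.+3%:R^-1 F @[m --> \oo] --> pi * (\1_`]a, b] F : R).
Proof.
move=> ab; rewrite !neq_lt => Fa Fb.
have pos t : 0 < t -> atan (t / m.+3%:R^-1) @[m --> \oo] --> pi / 2.
  exact: atan_scaled_cvg.
have neg t : t < 0 -> atan (t / m.+3%:R^-1) @[m --> \oo] --> - (pi / 2).
  move=> t0; have -> : (fun m : nat => atan (t / m.+3%:R^-1)) =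
      (fun m : nat => - atan (- t / m.+3%:R^-1)).
    by apply/funext => m; rewrite mulNr atanN opprK.
  by apply: cvgN; apply: pos; rewrite oppr_gt0.
rewrite indicE; case/orP: Fa => Fa; [|case/orP: Fb => Fb].
- rewrite memNset/=; last by rewrite in_itv/= ltNge (ltW Fa).
  rewrite mulr0 -(subrr (- (pi / 2))); apply: cvgB; apply: neg; rewrite subr_lt0//.
  exact: lt_le_trans ab.
- rewrite mem_set/=; last by rewrite in_itv/= Fa ltW.
  have -> : pi * 1 = pi / 2 - - (pi / 2) :> R by field.
  by apply: cvgB; [apply: pos; rewrite subr_gt0|apply: neg; rewrite subr_lt0].
- rewrite memNset/=; last by rewrite in_itv/= (leNgt F b) Fb andbF.
  by rewrite mulr0 -(subrr (pi / 2)); apply: cvgB; apply: pos; rewrite subr_gt0.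
Qed.

Lemma poisson_mass_ge0 a b eps F : a <= b -> 0 < eps -> 0 <= poisson_mass a b eps F.
Proof.
move=> ab e0; rewrite subr_ge0 le_atan// ler_pM2r ?invr_gt0//.
by rewrite lerD2l lerN2.
Qed.

(** The dominating function is the kernel at [b] with eps [3^-1], the one of index [m = 0], so that
    its integrability is a known Poisson bound. Near [b] the mass is at most pi; when [|F - b| > M],
    the choice of [M] gives [|F - b| <= 2 * |F - E|] on [[a, b]], so the kernel is at most
    [8 / (s + 1)] there. *)
Lemma poisson_mass_le a b : a <= b -> exists2 D, 0 <= D &
  forall eps F, 0 < eps <= 1 ->
    poisson_mass a b eps F <= D * (3^-1 / ((F - b) ^+ 2 + 3^-1 ^+ 2)).
Proof.
move=> ab; pose M := 2 * (b - a) + 1.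
have M1 : 1 <= M by rewrite lerDr mulr_ge0 ?subr_ge0.
have pi0 : 0 <= pi :> R by exact: pi_ge0.
pose D1 := pi * (3 * (M ^+ 2 + 1)); pose D2 := 24 * (b - a).
have D10 : 0 <= D1 by rewrite !mulr_ge0// addr_ge0 ?sqr_ge0.
have D20 : 0 <= D2 by rewrite mulr_ge0 ?subr_ge0.
exists (D1 + D2); first exact: addr_ge0.
move=> eps F /andP[e0 e1]; set s := (F - b) ^+ 2.
have s0 : 0 <= s by exact: sqr_ge0.
have kap : (3 * (s + 1))^-1 <= 3^-1 / (s + 3^-1 ^+ 2).
  rewrite invfM ler_wpM2l// lef_pV2 ?posrE; [|lra|lra].
  lra.
have kap0 : 0 <= 3^-1 / (s + 3^-1 ^+ 2).
  by apply: le_trans kap; rewrite invr_ge0 mulr_ge0//; lra.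
have s1 : 0 < 3 * (s + 1) by lra.
have [sM|Ms] := leP s (M ^+ 2).
  have h1 : poisson_mass a b eps F <= pi.
    have := atan_ltpi2 ((F - a) / eps); have := atan_gtNpi2 ((F - b) / eps).
    by rewrite /poisson_mass; lra.
  apply: (le_trans h1); apply: (@le_trans _ _ (D1 * (3 * (s + 1))^-1)).
    by rewrite ler_pdivlMr// ler_wpM2l//; lra.
  by apply: ler_pM => //; [rewrite invr_ge0 ltW|rewrite lerDl].
have Ms' : M < `|F - b|.
  rewrite -(@ltr_pXn2r _ 2) ?nnegrE//; last by lra.
  by rewrite real_normK ?num_real.
have kE E : a <= E <= b -> eps / ((F - E) ^+ 2 + eps ^+ 2) <= 8 / (s + 1).
  move=> /andP[aE Eb].
  have d1 : s <= 4 * (F - E) ^+ 2.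
    have : `|F - b| <= 2 * `|F - E|.
      have := ler_normD (F - E) (E - b); rewrite addrA subrK.
      by rewrite (ler0_norm (_ : E - b <= 0)) ?subr_le0// /M in Ms' *; lra.
    move=> h; rewrite /s -(@real_normK _ (F - b)) ?num_real//.
    rewrite -(@real_normK _ (F - E)) ?num_real//.
    rewrite (_ : 4 * _ = (2 * `|F - E|) ^+ 2); last by ring.
    by rewrite ler_sqr ?nnegrE ?mulr_ge0.
  have sgt : 1 < s by apply: le_lt_trans Ms; rewrite exprn_ege1.
  have e2 : 0 <= eps ^+ 2 by exact: sqr_ge0.
  rewrite ler_pdivrMr; last by lra.
  rewrite mulrAC ler_pdivlMr; last by lra.
  have : eps * (s + 1) <= s + 1 by rewrite ler_piMl//; lra.
  lra.
have h2 : poisson_mass a b eps F <= 8 / (s + 1) * (b - a).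
  rewrite -lee_fin -integral_poisson_kernel//.
  apply: (@le_trans _ _ (\int[lebesgue_measure]_(x in `[a, b]) (8 / (s + 1))%:E)%E).
    apply: ge0_le_integral => //.
    - by move=> x _; rewrite lee_fin poisson_kernel_ge0.
    - apply/measurable_EFinP; apply: measurable_funTS.
      have := measurable_poisson_kernel F e0.
      by under eq_fun do rewrite -sqrrN opprB.
  rewrite integral_cst//= lebesgue_measure_itv/= lte_fin.
  case: ltP => // ba; rewrite ?EFinM// mule0 lee_fin mulr_ge0 ?subr_ge0//.
  by rewrite divr_ge0//; lra.
apply: (le_trans h2); apply: (@le_trans _ _ (D2 * (3 * (s + 1))^-1)).
  have sn : s + 1 != 0 by rewrite gt_eqF//; lra.
  by rewrite le_eqVlt; apply/orP; left; apply/eqP; rewrite /D2; field; rewrite sn.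
by apply: ler_pM => //; [rewrite invr_ge0 ltW|rewrite lerDr].
Qed.

End poisson_mass.

Section stieltjes_inversion.
Variables (R : realType) (mu : {sigma_finite_measure set (measurableTypeR R) -> \bar R}).
Variable l : R -> R.
Hypothesis poisson_bnd : forall a b : R, 0 < a -> a <= b -> exists C, forall E m,
  a <= E <= b -> (poisson mu E m.+3%:R^-1 <= C%:E)%E.
Hypothesis poisson_lim : forall E : R, 0 < E ->
  poisson mu E m.+3%:R^-1 @[m --> \oo] --> (l E)%:E.

Let eps_gt0 (m : nat) : 0 < m.+3%:R^-1 :> R. Proof. by rewrite invr_gt0. Qed.

Let eps_le1 (m : nat) : 0 < (m.+3%:R : R)^-1 <= 1.
Proof. by rewrite eps_gt0 invf_le1// ler1n. Qed.

(** At its centre the kernel equals [1 / eps], so [mu [set a] / eps] is at most the Poisson integral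
    at [a], which stays bounded as eps tends to 0. *)
Lemma atom_eq0 (a : R) : 0 < a -> mu [set a] = 0%E.
Proof.
move=> a0; have [C Cb] := poisson_bnd a0 (lexx a).
have aaa : a <= a <= a by rewrite lexx.
have mset : measurable ([set a] : set (measurableTypeR R)).
  exact: measurable_set1.
have atom m : ((m.+3%:R : R)%:E * mu [set a] <= C%:E)%E.
  apply: le_trans (Cb a m aaa).
  rewrite -(integral_cst mu mset).
  have mk := measurable_poisson_kernel a (eps_gt0 m).
  apply: (@le_trans _ _ (\int[mu]_(F in [set a])
      (m.+3%:R^-1 / ((F - a) ^+ 2 + m.+3%:R^-1 ^+ 2))%:E)%E).
    rewrite le_eqVlt; apply/orP; left; apply/eqP; apply: eq_integral => F.
    rewrite inE/= => ->; rewrite subrr; congr (_%:E).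
    have : (m.+3%:R : R)^-1 != 0 by rewrite gt_eqF.
    rewrite -{2}(invrK m.+3%:R); move: (m.+3%:R^-1 : R) => e e0.
    by rewrite /cst expr0n/= add0r; field.
  apply: ge0_subset_integral => //.
    by apply/measurable_EFinP; exact mk.
  by move=> F _; rewrite lee_fin poisson_kernel_ge0.
have C0 : 0 <= C.
  by rewrite -lee_fin; apply: le_trans (atom 0%N); rewrite mule_ge0// lee_fin.
have fin : mu [set a] \is a fin_num.
  rewrite ge0_fin_numE//; have := atom 0%N.
  case: (mu [set a]) => // [r _|]; first by rewrite ltry.
  by rewrite gt0_muley ?lte_fin// leNgt ltry.
have [r rE] : exists r, mu [set a] = r%:E by exists (fine (mu [set a])); rewrite fineK.
have : 0 <= r by rewrite -lee_fin -rE.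
rewrite rE le_eqVlt => /predU1P[<-//|r0]; exfalso.
have := atom (Num.truncn (C / r)); rewrite rE -EFinM lee_fin leNgt => /negP; apply.
rewrite -ltr_pdivrMr//; apply: lt_le_trans (truncnS_gt _) _.
by rewrite ler_nat leqW.
Qed.

(** One double integral has two limits by dominated convergence: in [E], dominated by the constant
    [C], and after Tonelli in [F], dominated by the kernel of [poisson_mass_le]. The pointwise limit
    in [F] fails only at the endpoints, which are null. *)
Lemma stieltjes_inversion (a b : R) : 0 < a -> a < b ->
  (\int[lebesgue_measure]_(E in `[a, b]) (l E)%:E = pi%:E * mu [set` `]a, b]%R])%E.
Proof.
move=> a0 ab; have b0 := lt_trans a0 ab.
have [C Cb] := poisson_bnd a0 (ltW ab).
pose P m E := poisson mu E m.+3%:R^-1.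
have mP m : measurable_fun `[a, b] (P m).
  exact: measurable_poisson.
have Pge0 m E : (0 <= P m E)%E by exact: poisson_ge0.
have Plim E : `[a, b]%classic E -> P m E @[m --> \oo] --> (l E)%:E.
  by rewrite /= in_itv/= => /andP[aE _]; apply: poisson_lim; exact: lt_le_trans aE.
have ml : measurable_fun `[a, b] (EFin \o l).
  exact: (emeasurable_fun_cvg P).
have absP m E : `[a, b]%classic E -> (`|P m E| <= C%:E)%E.
  by rewrite /= in_itv/= gee0_abs//; exact: Cb.
have iC : lebesgue_measure.-integrable `[a, b] (EFin \o (fun=> C : R)).
  by apply: integrable_continuous; continuous_by.
have aePlim : {ae lebesgue_measure, forall E, `[a, b]%classic E ->
    P ^~ E @ \oo --> (EFin \o l) E}.
  by apply: aeW => E; exact: Plim.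
have aeP : {ae lebesgue_measure, forall E m, `[a, b]%classic E ->
    (`|P m E| <= (EFin \o (fun=> C : R)) E)%E}.
  by apply: aeW => E m; exact: absP.
have [_ _ lim1] := @dominated_convergence _ _ _ lebesgue_measure `[a, b]%classic
  (measurable_itv _) P (EFin \o l) (EFin \o (fun=> C : R)) mP ml
  aePlim iC aeP.
have [D D0 Dle] := poisson_mass_le (ltW ab).
pose S m F := (poisson_mass a b m.+3%:R^-1 F)%:E.
pose S' F := (pi * (\1_`]a, b] F : R))%:E.
pose G F := (D * (3^-1 / ((F - b) ^+ 2 + 3^-1 ^+ 2)))%:E.
have mS m : measurable_fun [set: measurableTypeR R] (S m).
  apply/measurable_EFinP; apply: continuous_measurable_fun.
  exact: poisson_mass_continuous.
have mS' : measurable_fun [set: measurableTypeR R] S'.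
  by apply/measurable_EFinP; apply: measurable_funM => //; exact: measurable_indic.
have e3 : (0 : R) < 3^-1 by rewrite invr_gt0.
have mk := measurable_poisson_kernel b e3.
have iG : mu.-integrable [set: measurableTypeR R] G.
  apply/integrableP; split.
    by apply/measurable_EFinP; apply: measurable_funM => //; exact mk.
  have G0 F : (0 <= G F)%E by rewrite lee_fin mulr_ge0// poisson_kernel_ge0.
  under eq_integral do rewrite gee0_abs//.
  rewrite /G; under eq_integral do rewrite EFinM.
  rewrite ge0_integralZl_EFin//.
  - apply: lte_mul_pinfty; rewrite ?lee_fin//.
    have bab : a <= b <= b by rewrite (ltW ab) lexx.
    by apply: le_lt_trans (Cb b 0%N bab) _; rewrite ltry.
  - by move=> F _; rewrite lee_fin poisson_kernel_ge0.
  - by apply/measurable_EFinP; exact mk.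
have Slim : {ae mu, forall F, [set: measurableTypeR R] F -> S ^~ F @ \oo --> S' F}.
  exists ([set a] `|` [set b]); split.
  - by apply: measurableU; exact: measurable_set1.
  - apply: null_set_setU; [exact: measurable_set1|exact: measurable_set1| |];
      exact: atom_eq0.
  - move=> F /=; apply: contra_notP => /not_orP[/eqP Fa /eqP Fb] _.
    apply: cvg_EFin; first exact: nearW.
    exact: poisson_mass_cvg (ltW ab) Fa Fb.
have absS m F : (`|S m F| <= G F)%E.
  by rewrite gee0_abs lee_fin ?poisson_mass_ge0 ?(ltW ab)//; exact: Dle.
have aeS : {ae mu, forall F m, [set: measurableTypeR R] F -> (`|S m F| <= G F)%E}.
  by apply: aeW => F m _; exact: absS.
have [_ _ lim2] := @dominated_convergence _ _ _ mu _
  (@measurableT _ (measurableTypeR R)) S S' G mS mS' Slim iG aeS.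
have eqPS m : (\int[lebesgue_measure]_(E in `[a, b]) P m E = \int[mu]_F S m F)%E.
  exact: integral_poisson (ltW ab) (eps_gt0 m).
have lim1' : (\int[mu]_F S m F)%E @[m --> \oo] -->
    (\int[lebesgue_measure]_(E in `[a, b]) (l E)%:E)%E.
  by under eq_fun do rewrite -eqPS; exact: lim1.
rewrite (cvg_unique _ lim1' lim2)//.
rewrite /S'; under eq_integral do rewrite EFinM.
rewrite ge0_integralZl_EFin ?pi_ge0//.
- by rewrite integral_indic// setIT.
- by apply/measurable_EFinP; exact: measurable_indic.
Qed.

End stieltjes_inversion.

(** * From intervals to measurable sets *)

Section density_measure.
Variables (R : realType) (f : measurableTypeR R -> \bar R).
Hypotheses (f_meas : measurable_fun setT f) (f_ge0 : forall x, (0 <= f x)%E).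

(* The dummy lets make the hypotheses, on which the measure structure depends,
   arguments of the definition. *)
Definition density_measure (A : set (measurableTypeR R)) : \bar R :=
  let _ := f_meas in let _ := f_ge0 in \int[lebesgue_measure]_(x in A) f x.

Let density0 : density_measure set0 = 0%E.
Proof. by rewrite /density_measure integral_set0. Qed.

Let density_ge0 A : (0 <= density_measure A)%E.
Proof. exact: integral_ge0. Qed.

Let density_sigma_additive : semi_sigma_additive density_measure.
Proof.
move=> /= A mA tA mUA; rewrite /density_measure/= ge0_integral_bigcup//=; last first.
  exact: measurable_funTS.
by apply: is_cvg_ereal_nneg_natsum_cond => n _ _; exact: integral_ge0.
Qed.

HB.instance Definition _ := isMeasure.Build _ _ _
  density_measure density0 density_ge0 density_sigma_additive.

End density_measure.

Section half_line_density.
Variables (R : realType) (mu : {measure set (measurableTypeR R) -> \bar R}).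
Variable l : R -> R.
Hypotheses (l_meas : measurable_fun [set: measurableTypeR R] l) (l_ge0 : forall x, 0 <= l x).
Hypothesis mu_fin : forall b : R, (mu [set` `]0%R, b]%R] < +oo)%E.
Hypothesis mu_itv : forall a b : R, 0 < a -> a < b ->
  (mu [set` `]a, b]%R] = \int[lebesgue_measure]_(x in `[a, b]) (l x)%:E)%E.

Let D : set (measurableTypeR R) := [set` `]0%R, +oo[%R].
Let mD : measurable D. Proof. exact: measurable_itv. Qed.

Let f : measurableTypeR R -> \bar R := (EFin \o l) \_ D.
Let f_meas : measurable_fun setT f.
Proof.
by apply/(measurable_restrictT _ _).1 => //; apply: measurable_funTS; exact/measurable_EFinP.
Qed.
Let f_ge0 x : (0 <= f x)%E.
Proof. by rewrite /f patchE; case: ifP => // _; rewrite lee_fin. Qed.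

Let m1 : {measure set (measurableTypeR R) -> \bar R} := mrestr mu mD.
Let m2 : {measure set (measurableTypeR R) -> \bar R} := density_measure f_meas f_ge0.

Let m2E A : m2 A = (\int[lebesgue_measure]_(x in A `&` D) (l x)%:E)%E.
Proof. by rewrite integral_mkcondr. Qed.

Let m12_pos a b : 0 < a -> a < b -> m1 [set` `]a, b]%R] = m2 [set` `]a, b]%R].
Proof.
move=> a0 ab; have abD : [set` `]a, b]%R] `&` D = [set` `]a, b]%R].
  by apply: setIidl => x; rewrite /D /= !in_itv/= andbT => /andP[/(lt_trans a0)].
rewrite m2E abD; transitivity (mu [set` `]a, b]%R]).
  by rewrite -[in RHS]abD.
rewrite mu_itv//; apply/esym/integral_itv_obnd_cbnd.
by apply: measurable_funTS; apply/measurable_EFinP.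
Qed.

Let bigcup_pos (b : R) :
  \bigcup_k [set` `]((k.+1%:R : R)^-1), b]%R] = [set` `]0%R, b]%R] :> set R.
Proof.
apply/seteqP; split => [x [k _]|x] /=; rewrite !in_itv/=.
  by move=> /andP[kx ->]; rewrite andbT (lt_trans _ kx)// invr_gt0.
move=> /andP[x0 xb]; exists (Num.truncn x^-1) => //=.
rewrite in_itv/= xb andbT -[ltRHS]invrK ltf_pV2 ?posrE ?invr_gt0//.
exact: truncnS_gt.
Qed.

(** [mu_itv] is silent on intervals that reach 0; continuity from below along the increasing
    intervals starting at [k.+1%:R^-1] fills the gap. *)
Let m12_zero b : 0 < b -> m1 [set` `]0%R, b]%R] = m2 [set` `]0%R, b]%R].
Proof.
move=> b0; pose F k : set (measurableTypeR R) := [set` `]((k.+1%:R : R)^-1), b]%R].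
have mF k : measurable (F k) by exact: measurable_itv.
have mUF : measurable (\bigcup_k F k) by exact: bigcup_measurable.
have ndF : nondecreasing_seq F.
  move=> i j ij; apply/subsetPset => x; rewrite /F /= !in_itv/= => /andP[ix ->].
  rewrite andbT; apply: le_lt_trans ix.
  by rewrite lef_pV2 ?posrE// ler_nat.
have c1 := @nondecreasing_cvg_mu _ _ _ m1 F mF mUF ndF.
have c2 := @nondecreasing_cvg_mu _ _ _ m2 F mF mUF ndF.
have eF : m1 \o F = m2 \o F.
  apply/funext => k /=; have [kb|bk] := ltP (k.+1%:R^-1) b.
    by apply: m12_pos => //; rewrite invr_gt0.
  have -> : F k = set0 by rewrite /F set_itv_ge// -leNgt bnd_simp.
  by rewrite !measure0.
rewrite eF in c1; have e := cvg_unique (@ereal_hausdorff R) c1 c2.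
have UE : \bigcup_k F k = [set` `]0%R, b]%R] by exact: bigcup_pos.
by rewrite UE in e; apply: e.
Qed.

(** The two measures agree on half-open intervals, which are stable under intersection and generate
    the Borel sets; an interval that starts at or below 0 is first cut to []0, b]]. [mu_fin] makes
    the exhausting intervals [g k] of finite mass. *)
Lemma half_line_densityP (A : set (measurableTypeR R)) : measurable A -> A `<=` D ->
  mu A = (\int[lebesgue_measure]_(x in A) (l x)%:E)%E.
Proof.
move=> mA AD.
have -> : mu A = m1 A by rewrite /m1 /= /mrestr setIidl.
have -> : (\int[lebesgue_measure]_(x in A) (l x)%:E)%E = m2 A by rewrite m2E setIidl.
pose g (k : nat) : set (measurableTypeR R) := [set` `](- (k%:R : R)), k%:R]%R].
have ocitv_gen : @measurable _ (measurableTypeR R) = <<s (@ocitv R) >> by [].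
apply: (@measure_unique _ R (measurableTypeR R) (@ocitv R) g ocitv_gen (@ocitvI R)
  _ _ m1 m2 _ _ A mA).
- by move=> k; exact: is_ocitv.
- exact: bigcup_itvT.
- move=> X /ocitvP[->|[[a b] /= ab ->]]; first by rewrite !measure0.
  have [a0|a0] := ltP 0 a; first exact: m12_pos.
  have cut : [set` `]a, b]%R] `&` D = [set` `]0%R, b]%R] `&` D.
    apply/seteqP; split => x; rewrite /D /= !in_itv/= !andbT => -[/andP[ax xb] x0].
      by rewrite x0 xb.
    by rewrite (le_lt_trans a0 ax) xb.
  have -> : m1 [set` `]a, b]%R] = m1 [set` `]0%R, b]%R] by rewrite /m1 /= /mrestr cut.
  have -> : m2 [set` `]a, b]%R] = m2 [set` `]0%R, b]%R] by rewrite !m2E cut.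
  have [b0|b0] := ltP 0 b; first exact: m12_zero.
  by rewrite set_itv_ge ?measure0// -leNgt bnd_simp.
- move=> k; apply: le_lt_trans (mu_fin k%:R).
  apply: le_measure; rewrite ?inE.
  + by apply: measurableI => //; exact: measurable_itv.
  + exact: measurable_itv.
  + move=> x; rewrite /g /D /= !in_itv/= !andbT => -[/andP[_ xk] x0].
    by rewrite x0 xk.
Qed.

End half_line_density.

(** * The classically forbidden region *)

Section tunnelling.
Variables (R : realType) (V dV u z : R -> R) (E N : R).
Implicit Types (x t : R).
Hypothesis V_dec : decaying_potential V dV.
Hypothesis V_strict : forall x y : R, 0 <= x -> x < y -> V y < V x.
Hypothesis sol : solution V E u z.
Hypotheses (u_0 : u 0 = 0) (z_0 : z 0 = 1).
Hypotheses (N_ge0 : 0 <= N) (V_N : V N = E).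

Let V_cont : continuous V. Proof. by case: V_dec. Qed.
Let V_mono x1 x2 : x1 <= x2 -> V x2 <= V x1.
Proof. by case: V_dec => _ _ Vm _ _; exact: Vm. Qed.
Let u_cont : continuous u. Proof. by case: sol. Qed.
Let z_cont : continuous z. Proof. by case: sol. Qed.
Let u_der x : 0 < x -> is_derive x 1 u (z x).
Proof. by case: sol => _ _ + _; exact. Qed.
Let z_der x : 0 < x -> is_derive x 1 z ((V x - E) * u x).
Proof. by case: sol => _ _ _; exact. Qed.
Let V_ge x : x <= N -> 0 <= V x - E.
Proof. by move=> xN; rewrite subr_ge0 -V_N; exact: V_mono. Qed.

(** The derivative of [u * z] is [z ^+ 2 + (V - E) * u ^+ 2], nonnegative whatever the signs of [u]
    and [z]. Starting with products avoids a circular argument between the positivity of [u] and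
    that of [z]. *)
Let uz_ge0 x : 0 <= x <= N -> 0 <= u x * z x.
Proof.
move=> /andP[x0 xN]; have -> : 0 = u 0 * z 0 by rewrite u_0 mul0r.
apply: (@ge0_derive_le _ (fun x => u x * z x)
  (fun x => z x ^+ 2 + (V x - E) * u x ^+ 2)) => //.
- by continuous_by.
- move=> t /andP[t0 _]; have := u_der t0; have := z_der t0 => ? ?.
  by derive_by; ring.
- move=> t /andP[t0 tx]; rewrite addr_ge0 ?sqr_ge0// mulr_ge0 ?sqr_ge0//.
  by apply: V_ge; rewrite (le_trans (ltW tx)).
Qed.

Let z2_ge1 x : 0 <= x <= N -> 1 <= z x ^+ 2.
Proof.
move=> /andP[x0 xN]; have -> : 1 = z 0 ^+ 2 :> R by rewrite z_0 expr1n.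
apply: (@ge0_derive_le _ (fun x => z x ^+ 2)
  (fun x => 2 * (V x - E) * (u x * z x))) => //.
- by continuous_by.
- by move=> t /andP[t0 _]; have := z_der t0 => ?; derive_by; ring.
- move=> t /andP[t0 tx]; have tN : t <= N by rewrite (le_trans (ltW tx)).
  by rewrite mulr_ge0 ?uz_ge0 ?(ltW t0)// mulr_ge0// V_ge.
Qed.

(** Since [z ^+ 2 >= 1], the function [z] has no zero on the interval and keeps the sign of
    [z 0 = 1]. *)
Lemma tunnel_velocity_ge1 x : 0 <= x <= N -> 1 <= z x.
Proof.
move=> xN; have /andP[x0 _] := xN; have z2 := z2_ge1 xN.
have [zx|zx] := leP (z x) 0; last first.
  by rewrite -(@ler_sqr _ 1) ?expr1n ?nnegrE// ltW.
have [||c cx zc] := @IVT R z 0 x 0 x0.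
- exact: continuous_subspaceT.
- by rewrite z_0 min_r ?max_l ?zx ?ler01// (le_trans zx).
have cN : 0 <= c <= N.
  move: cx; rewrite in_itv/= => /andP[-> cx].
  by rewrite (le_trans cx)//; case/andP: xN.
by have := z2_ge1 cN; rewrite zc expr0n ler10.
Qed.

Lemma tunnel_position_ge x : 0 <= x <= N -> x <= u x.
Proof.
move=> /andP[x0 xN]; rewrite -subr_ge0.
have -> : 0 = u 0 - 0 by rewrite u_0 subr0.
apply: (@ge0_derive_le _ (fun x => u x - x) (fun x => z x - 1)) => //.
- by continuous_by.
- by move=> t /andP[t0 _]; have := u_der t0 => ?; derive_by.
- move=> t /andP[t0 tx]; rewrite subr_ge0 tunnel_velocity_ge1// ltW//=.
  by rewrite (le_trans (ltW tx)).
Qed.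

Let rate x := Num.sqrt (V x - E).
Let action := intR 0 N rate.

Let rate_cont : continuous rate. Proof. by rewrite /rate; continuous_by. Qed.

Let rate_sqr x : x <= N -> rate x * rate x = V x - E.
Proof. by move=> xN; rewrite -expr2 sqr_sqrtr// V_ge. Qed.

(** Strict monotonicity gives [V x - E > 0] to the left of [N], where the square root is smooth. At
    [N] its argument vanishes, hence the open interval. *)
Let rate_der x : 0 < x < N -> exists2 dr, is_derive x 1 rate dr & dr <= 0.
Proof.
move=> /andP[x0 xN]; have VE : 0 < V x - E by rewrite subr_gt0 -V_N V_strict// ltW.
have [_ _ _ + _] := V_dec => /(_ x x0)[dVx dV0].
exists ((2 * Num.sqrt (V x - E))^-1 * dV x); last first.
  by rewrite mulr_ge0_le0// invr_ge0 mulr_ge0// sqrtr_ge0.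
have d : is_derive x 1 (fun t => V t - E) (dV x) by derive_by; ring.
exact: (@is_derive1_comp _ Num.sqrt (fun t => V t - E) x _ _ (is_derive1_sqrt VE) d).
Qed.

(** With [G] the primitive of [rate], [(z + rate * u) * expR (- G)] decreases and
    [(z - rate * u) * expR G] increases: their derivatives are the derivative of [rate], which is
    nonpositive, times [u * expR (- G)] and [- u * expR G]. The first bounds [z N], because
    [rate N = 0], and then [u N], because [z] increases. The second gives [z >= rate * u], so
    [u * expR (- G)] increases; as [u 0 = 0], the comparison starts at some [x], where [u x >= x]
    and [G x <= x * Num.sqrt (V 0)]. *)
Lemma tunnelling_bounds :
  [/\ z N <= expR action, u N <= N * expR action &
    forall x, 0 <= x <= N -> x * expR (action - x * Num.sqrt (V 0)) <= u N].
Proof.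
have [G [cG G0 dG]] := continuous_primitive rate_cont.
have aE : action = G N.
  rewrite -[RHS]subr0 -G0; apply: integral_derive => // x /andP[x0 _].
  exact: dG.
have r0 x : 0 <= rate x by exact: sqrtr_ge0.
have rN : rate N = 0 by rewrite /rate V_N subrr sqrtr0.
have in_tunnel t b : 0 < t < b -> b <= N -> [/\ 0 < t, t <= N & 0 <= t <= N].
  move=> /andP[t0 tb] bN; have tN : t <= N by rewrite (le_trans (ltW tb)).
  by split=> //; rewrite (ltW t0).
have u_ge0 t : 0 <= t <= N -> 0 <= u t.
  by move=> tN; apply: le_trans (tunnel_position_ge tN); case/andP: tN.
have zN : z N <= expR action.
  have : (z N + rate N * u N) * expR (- G N) <= (z 0 + rate 0 * u 0) * expR (- G 0).
    have h t : 0 < t < N -> exists2 dr,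
        is_derive t 1 (fun x => (z x + rate x * u x) * expR (- G x)) dr & dr <= 0.
      move=> tN; have [t0 tN' tN''] := in_tunnel t N tN (lexx N).
      have [dr d dr0] := rate_der tN.
      exists (dr * u t * expR (- G t)).
        have := u_der t0; have := z_der t0; have := dG t t0; rewrite -rate_sqr// => ? ? ?.
        by derive_by; ring.
      by rewrite mulr_le0_ge0 ?expR_ge0// mulr_le0_ge0// u_ge0.
    (* The derivative of [rate] is only known to exist, point by point; ['D_1] names the derivative
       of the product as a function. *)
    apply: (@le0_derive_ge _ (fun x => (z x + rate x * u x) * expR (- G x))
      (fun x => 'D_1 (fun x => (z x + rate x * u x) * expR (- G x)) x)) => //.
    - by continuous_by.
    - by move=> t /h[dr [d _] _]; exact: DeriveDef.
    - by move=> t /h[dr [_ ->]].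
  rewrite rN mul0r addr0 z_0 u_0 mulr0 addr0 G0 oppr0 expR0 mulr1.
  by rewrite expRN ler_pdivrMr ?expR_gt0// mul1r aE.
have z_le x : 0 <= x <= N -> z x <= z N.
  move=> /andP[x0 xN]; apply: (@ge0_derive_le _ z (fun x => (V x - E) * u x)) => //.
  - by move=> t _; exact: z_cont.
  - by move=> t /andP[xt _]; apply: z_der; exact: le_lt_trans xt.
  - move=> t /andP[xt tN]; rewrite mulr_ge0 ?V_ge ?u_ge0 ?(ltW tN)//.
    by rewrite (le_trans x0 (ltW xt)).
split => //.
- have : u N - expR action * N <= u 0 - expR action * 0.
    apply: (@le0_derive_ge _ (fun x => u x - expR action * x)
      (fun x => z x - expR action)) => //.
    + move=> t _; apply: cvgB; first exact: u_cont.
      by apply: cvgM; [exact: cvg_cst|exact: cvg_id].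
    + by move=> t /andP[t0 _]; have := u_der t0 => ?; derive_by; ring.
    + move=> t /andP[t0 tN]; rewrite subr_le0; apply: le_trans zN.
      by rewrite z_le// !ltW.
  by rewrite u_0 mulr0 subr0 subr_le0 mulrC.
- have growth t : 0 <= t <= N -> rate t * u t <= z t.
    move=> /andP[t0 tN].
    have : (z 0 - rate 0 * u 0) * expR (G 0) <= (z t - rate t * u t) * expR (G t).
      have h s : 0 < s < t -> exists2 dr,
          is_derive s 1 (fun x => (z x - rate x * u x) * expR (G x)) dr & 0 <= dr.
        move=> st; have [s0 sN' sN''] := in_tunnel s t st tN.
        have sN : 0 < s < N by rewrite s0; case/andP: st => _ /lt_le_trans; apply.
        have [dr d dr0] := rate_der sN.
        exists (- dr * u s * expR (G s)).
          have := u_der s0; have := z_der s0; have := dG s s0; rewrite -rate_sqr// => ? ? ?.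
          by derive_by; ring.
        by rewrite mulr_ge0 ?expR_ge0// mulr_ge0 ?oppr_ge0// u_ge0.
      apply: (@ge0_derive_le _ (fun x => (z x - rate x * u x) * expR (G x))
        (fun x => 'D_1 (fun x => (z x - rate x * u x) * expR (G x)) x)) => //.
      - by continuous_by.
      - by move=> s /h[dr [d _] _]; exact: DeriveDef.
      - by move=> s /h[dr [_ ->]].
    rewrite z_0 u_0 mulr0 subr0 G0 expR0 mulr1 => h.
    by rewrite -subr_ge0 -(pmulr_lge0 _ (expR_gt0 (G t))); apply: le_trans h.
  move=> x xN; have /andP[x0 xN'] := xN.
  have h1 : u x * expR (- G x) <= u N * expR (- G N).
    apply: (@ge0_derive_le _ (fun x => u x * expR (- G x))
      (fun x => (z x - rate x * u x) * expR (- G x))) => //.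
    + by continuous_by.
    + move=> t /andP[xt _]; have t0 := le_lt_trans x0 xt.
      by have := u_der t0; have := dG t t0 => ? ?; derive_by; ring.
    + move=> t /andP[xt tN]; rewrite mulr_ge0 ?expR_ge0// subr_ge0 growth//.
      by rewrite (le_trans x0 (ltW xt)) ltW.
  have Gx : G x <= x * Num.sqrt (V 0).
    have : G x - x * Num.sqrt (V 0) <= G 0 - 0 * Num.sqrt (V 0); last first.
      by rewrite G0 mul0r subr0 subr_le0.
    apply: (@le0_derive_ge _ (fun x => G x - x * Num.sqrt (V 0))
      (fun x => rate x - Num.sqrt (V 0))) => //.
    + by continuous_by.
    + by move=> t /andP[t0 _]; have := dG t t0 => ?; derive_by; ring.
    + move=> t /andP[t0 _]; rewrite subr_le0; apply: ler_wsqrtr.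
      have V0t := V_mono (ltW t0); have [_ V0 _ _ _] := V_dec.
      by have := V0 N; rewrite V_N; lra.
  have h2 : x * expR (- (x * Num.sqrt (V 0))) <= u N * expR (- G N).
    apply: le_trans h1; apply: ler_pM => //; rewrite ?expR_ge0//.
      exact: tunnel_position_ge.
    by rewrite ler_expR lerN2.
  rewrite expRD aE mulrCA mulrC -ler_pdivlMr ?expR_gt0//.
  by rewrite -expRN.
Qed.

End tunnelling.

(** At [N] itself [E - V] vanishes and the energy no longer controls [u], so both bounds are taken
    at [N + 1], where [E - V] is [d]; crossing the unit interval costs at most [expR c], as
    [E <= V 0]. The number [m] dominates 1 and [d], which compares [z1 ^+ 2 + d * u1 ^+ 2] and
    [u1 ^+ 2 + z1 ^+ 2 / d] with [u1 ^+ 2 + z1 ^+ 2]. The lower bound [x0] of [N] lets [N ^+ 2]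
    absorb the contribution of [z N]. *)
Lemma energy_limit_tunnelling (R : realType) (V dV u z : R -> R) (E N x0 : R) :
  decaying_potential V dV -> (forall x y : R, 0 <= x -> x < y -> V y < V x) ->
  solution V E u z -> u 0 = 0 -> z 0 = 1 -> 0 < x0 -> x0 <= N -> V N = E ->
  let K := energy_limit V E u z in
  let g := intR 0 N (fun x => Num.sqrt (V x - E)) in
  let d := E - V (N + 1) in
  let m := 1 + V 0 in let c := 1 + 2 * V 0 in
  expR (- c) * x0 ^+ 2 * expR (- (x0 * Num.sqrt (V 0))) ^+ 2 / m * d * expR g ^+ 2 <= K /\
  K <= expR c * m * (1 + x0 ^- 2) * (E * N ^+ 2 / d) * expR g ^+ 2.
Proof.
move=> V_dec V_strict sol u0 z0 x00 x0N VN K g d m c.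
have [_ V_gt0 V_mono _ _] := V_dec.
have N0 : 0 < N by exact: lt_le_trans x0N.
have E0 : 0 < E by rewrite -VN.
have EV0 : E <= V 0 by rewrite -VN V_mono// ltW.
have N1 : N < N + 1 by rewrite ltrDl.
have d0 : 0 < d by rewrite subr_gt0 -VN V_strict// ltW.
have dE : d <= E by rewrite lerBlDr lerDl ltW.
have m1 : 1 <= m by rewrite lerDl ltW.
have m0 : 0 < m by exact: lt_le_trans m1.
have dm : d <= m by rewrite (le_trans dE)// (le_trans EV0)// lerDr.
have [zle ule uge] := tunnelling_bounds V_dec V_strict sol u0 z0 (ltW N0) VN.
rewrite -/g in zle ule uge.
have cE : 1 + V 0 + `|E| <= c by rewrite gtr0_norm// /c; lra.
have NN1 : 0 <= N <= N + 1 by rewrite !ltW.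
have [S1 S2] := solution_growth V_dec sol cE NN1.
rewrite addrAC subrr add0r mulr1 in S1 S2.
set SN := u N ^+ 2 + z N ^+ 2 in S1 S2.
set u1 := u (N + 1) in S1 S2; set z1 := z (N + 1) in S1 S2.
have NN0 : 0 <= N + 1 by rewrite addr_ge0// ltW.
have lo := le_energy_limit V_dec E0 sol NN0.
have VE1 : V (N + 1) < E by rewrite -subr_gt0.
have hi := energy_limit_le V_dec sol NN0 VE1.
rewrite /energy -/d -/u1 -/z1 -/K in lo hi.
have u1s := sqr_ge0 u1; have z1s := sqr_ge0 z1.
have z1N : 1 <= z N.
  by apply: (tunnel_velocity_ge1 V_dec sol u0 z0 VN); rewrite ltW//=.
have NN : 0 <= N <= N by rewrite ltW/=.
have x0NN : 0 <= x0 <= N by rewrite ltW.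
have uN := tunnel_position_ge V_dec sol u0 z0 VN NN.
split.
- have h1 : expR (- c) * SN <= u1 ^+ 2 + z1 ^+ 2.
    by rewrite expRN ler_pdivrMl ?expR_gt0.
  have h2 : x0 ^+ 2 * expR (- (x0 * Num.sqrt (V 0))) ^+ 2 * expR g ^+ 2 <= SN.
    have := uge x0 x0NN; rewrite expRD => h.
    have -> : x0 ^+ 2 * expR (- (x0 * Num.sqrt (V 0))) ^+ 2 * expR g ^+ 2 =
      (x0 * (expR g * expR (- (x0 * Num.sqrt (V 0))))) ^+ 2 by ring.
    have : (x0 * (expR g * expR (- (x0 * Num.sqrt (V 0))))) ^+ 2 <= u N ^+ 2.
      rewrite ler_sqr ?nnegrE ?mulr_ge0 ?expR_ge0 ?(ltW x00)//.
      exact: le_trans (ltW N0) uN.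
    by rewrite /SN; have := sqr_ge0 (z N); lra.
  have h3 : d / m * (u1 ^+ 2 + z1 ^+ 2) <= z1 ^+ 2 + d * u1 ^+ 2.
    have dm1 : d / m <= 1 by rewrite ler_pdivrMr// mul1r.
    have dmd : d / m <= d by rewrite ler_pdivrMr// ler_peMr// ltW.
    by have := ler_wpM2r z1s dm1; have := ler_wpM2r u1s dmd; lra.
  apply: le_trans lo; apply: le_trans h3.
  have -> : expR (- c) * x0 ^+ 2 * expR (- (x0 * Num.sqrt (V 0))) ^+ 2 / m * d * expR g ^+ 2 =
    d / m * (expR (- c) * (x0 ^+ 2 * expR (- (x0 * Num.sqrt (V 0))) ^+ 2 * expR g ^+ 2)).
    by ring.
  apply: ler_wpM2l; first by rewrite divr_ge0// ltW.
  by apply: le_trans h1; rewrite ler_wpM2l ?expR_ge0.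
- apply: (le_trans hi).
  have h1 : u1 ^+ 2 + z1 ^+ 2 / d <= m / d * (u1 ^+ 2 + z1 ^+ 2).
    rewrite mulrDr; apply: lerD.
      by rewrite ler_peMl// ler_pdivlMr// mul1r.
    have -> : m / d * z1 ^+ 2 = m * (z1 ^+ 2 / d) by ring.
    by rewrite ler_peMl// divr_ge0// ltW.
  have uN0 : 0 <= u N by exact: le_trans (ltW N0) uN.
  have g0 := expR_ge0 g.
  have h2 : u N ^+ 2 <= N ^+ 2 * expR g ^+ 2.
    by rewrite -exprMn ler_sqr ?nnegrE// mulr_ge0// ltW.
  have h3 : z N ^+ 2 <= expR g ^+ 2 by rewrite ler_sqr ?nnegrE// (le_trans ler01).
  have h4 : 1 <= x0 ^- 2 * N ^+ 2.
    by rewrite mulrC ler_pdivlMr ?exprn_gt0// mul1r ler_sqr ?nnegrE// ltW.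
  have h5 : SN <= (1 + x0 ^- 2) * N ^+ 2 * expR g ^+ 2.
    have := ler_wpM2r (sqr_ge0 (expR g)) h4.
    by rewrite /SN; lra.
  have -> : expR c * m * (1 + x0 ^- 2) * (E * N ^+ 2 / d) * expR g ^+ 2 =
      E * (m / d * (expR c * ((1 + x0 ^- 2) * N ^+ 2 * expR g ^+ 2))) by ring.
  apply: ler_wpM2l; first exact: ltW.
  apply: (le_trans h1); apply: ler_wpM2l; first by rewrite divr_ge0// ltW.
  by apply: (le_trans S1); rewrite ler_wpM2l ?expR_ge0.
Qed.

(** Here [s] is the square root of [E]. The claim is that [pi * K / s] lies within a factor [T ^+ 2]
    of [expR g ^+ 2], where [T] is the prescribed value of [expR (h E)]. The powers of [d] match up
    to one spare factor, absorbed by [d <= s ^+ 2 <= s0 * s]. *)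
Lemma wkb_logarithm (R : realType) (K N d s s0 x0 c1 c2 g : R) :
  0 < K -> 0 < x0 -> x0 <= N -> 0 < d -> d <= s ^+ 2 -> 0 < s -> s <= s0 ->
  0 < c1 -> 0 < c2 ->
  c1 * d * expR g ^+ 2 <= K -> K <= c2 * (s ^+ 2 * N ^+ 2 / d) * expR g ^+ 2 ->
  let C := 1 + pi * c2 * s0 + s0 / (pi * c1 * x0 ^+ 2) in
  0 < C * N * d^-1 * s /\
  `|ln (pi * K / s) / 2 - g| <= ln (C * N * d^-1 * s).
Proof.
move=> K0 x00 x0N d0 ds s_gt0 ss0 c10 c20 lo hi C.
have pi0 : 0 < pi :> R by exact: pi_gt0.
have N0 : 0 < N by exact: lt_le_trans x0N.
have s00 : 0 < s0 by exact: lt_le_trans ss0.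
have t1 : 0 < pi * c2 * s0 by rewrite !mulr_gt0.
have t2 : 0 < s0 / (pi * c1 * x0 ^+ 2) by rewrite divr_gt0// !mulr_gt0// exprn_gt0.
have C1 : 1 <= C by rewrite /C; lra.
have C0 : 0 < C by exact: lt_le_trans C1.
(* The constant enters through [T ^+ 2], so the summand 1 in [C] makes it possible to bound by [C]
   alone; the other two summands serve the upper and the lower estimate. *)
have CC : C <= C ^+ 2 by rewrite expr2 ler_peMl// ltW.
have T0 : 0 < C * N * d^-1 * s by rewrite !mulr_gt0// invr_gt0.
split=> //; set T := C * N * d^-1 * s.
have G0 := expR_gt0 g; have G2 : 0 < expR g ^+ 2 by rewrite exprn_gt0.
have A0 : 0 < pi * K / s by rewrite divr_gt0// mulr_gt0.
have dn : d != 0 by rewrite gt_eqF.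
have sn : s != 0 by rewrite gt_eqF.
have up : pi * K / s <= expR g ^+ 2 * T ^+ 2.
  apply: (@le_trans _ _ (pi * (c2 * (s ^+ 2 * N ^+ 2 / d) * expR g ^+ 2) / s)).
    by rewrite ler_wpM2r ?invr_ge0 ?(ltW s_gt0)// ler_wpM2l ?(ltW pi0).
  have -> : pi * (c2 * (s ^+ 2 * N ^+ 2 / d) * expR g ^+ 2) / s =
      (expR g ^+ 2 * N ^+ 2 * s / d ^+ 2) * (pi * c2 * d) by field; rewrite dn sn.
  have -> : expR g ^+ 2 * T ^+ 2 =
      (expR g ^+ 2 * N ^+ 2 * s / d ^+ 2) * (C ^+ 2 * s) by rewrite /T; field.
  apply: ler_wpM2l.
    by rewrite divr_ge0 ?sqr_ge0// !mulr_ge0 ?sqr_ge0// ltW.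
  apply: (@le_trans _ _ (pi * c2 * s0 * s)).
    have : d <= s0 * s by rewrite (le_trans ds)// expr2 ler_wpM2r// ltW.
    by rewrite -!mulrA => h; rewrite !ler_wpM2l// ltW.
  by rewrite ler_wpM2r ?(ltW s_gt0)// (le_trans _ CC)// /C; lra.
have lo' : expR g ^+ 2 <= T ^+ 2 * (pi * K / s).
  apply: (@le_trans _ _ (T ^+ 2 * (pi * (c1 * d * expR g ^+ 2) / s))); last first.
    rewrite ler_wpM2l ?sqr_ge0// ler_wpM2r ?invr_ge0 ?(ltW s_gt0)//.
    by rewrite ler_wpM2l ?(ltW pi0).
  have -> : T ^+ 2 * (pi * (c1 * d * expR g ^+ 2) / s) =
      (C ^+ 2 * (pi * c1 * N ^+ 2) * s) / d * expR g ^+ 2.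
    by rewrite /T; field; rewrite dn sn.
  rewrite ler_peMl ?(ltW G2)// ler_pdivlMr// mul1r.
  apply: (@le_trans _ _ (s0 * s)); first by rewrite (le_trans ds)// expr2 ler_wpM2r// ltW.
  rewrite ler_wpM2r ?(ltW s_gt0)//.
  have px : 0 < pi * c1 * x0 ^+ 2 by rewrite !mulr_gt0// exprn_gt0.
  apply: (@le_trans _ _ (C ^+ 2 * (pi * c1 * x0 ^+ 2))).
    rewrite -ler_pdivrMr// (le_trans _ CC)// /C; lra.
  rewrite ler_wpM2l ?sqr_ge0// ler_wpM2l ?mulr_ge0 ?(ltW pi0) ?(ltW c10)//.
  by rewrite ler_sqr ?nnegrE ?(ltW x00) ?(ltW N0).
have lnG : ln (expR g ^+ 2) = 2 * g.
  by rewrite lnXn ?posrE// expRK mulr2n; ring.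
have lnT : ln (T ^+ 2) = 2 * ln T by rewrite lnXn// mulr2n; ring.
have T2 : 0 < T ^+ 2 by rewrite exprn_gt0.
have up' : ln (pi * K / s) <= 2 * g + 2 * ln T.
  by rewrite -lnG -lnT -lnM ?posrE// ler_ln ?posrE// mulr_gt0.
have lo'' : 2 * g <= 2 * ln T + ln (pi * K / s).
  by rewrite -lnG -lnT -lnM ?posrE// ler_ln ?posrE// mulr_gt0.
by rewrite ler_norml; apply/andP; split; lra.
Qed.

(** * The density of the spectral measure on the positive axis *)

Section spectral_density.
Variables (R : realType) (mu : {measure set (measurableTypeR R) -> \bar R}).
Variable l : R -> R.
Hypothesis poisson_bnd : forall a b : R, 0 < a -> a <= b -> exists C, forall E m,
  a <= E <= b -> (poisson mu E m.+3%:R^-1 <= C%:E)%E.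
Hypothesis poisson_lim : forall E : R, 0 < E ->
  poisson mu E m.+3%:R^-1 @[m --> \oo] --> (pi * l E)%:E.
Hypothesis l_cont : {in `]0, +oo[, continuous l}.
Hypothesis l_ge0 : forall E, 0 < E -> 0 <= l E.

(** The kernel centred at 1 with eps [3^-1] has the positive lower bound [k] on the interval and a
    finite integral. This provides the sigma-finiteness on which Tonelli's theorem rests. *)
Lemma bounded_interval_fin (b : R) : (mu [set` `](- b)%R, b]%R] < +oo)%E.
Proof.
have [C Cb] := poisson_bnd ltr01 (lexx 1).
have one : ((1 : R) <= 1) && ((1 : R) <= 1) by rewrite lexx.
have {one} := Cb 1 0%N one; set B := [set` _].
have e3 : (0 : R) < 3%:R^-1 by rewrite invr_gt0.
pose k : R := 3%:R^-1 / ((`|b| + 1) ^+ 2 + 3%:R^-1 ^+ 2).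
have k0 : 0 < k by rewrite divr_gt0// ltr_wpDl ?sqr_ge0// exprn_gt0.
have mB : measurable (B : set (measurableTypeR R)) by exact: measurable_itv.
have mk := measurable_poisson_kernel 1 e3.
move=> PC; have : (k%:E * mu B <= C%:E)%E.
  apply: le_trans PC; rewrite -(integral_cst mu mB).
  apply: (@le_trans _ _ (\int[mu]_(F in B)
      (3%:R^-1 / ((F - 1) ^+ 2 + 3%:R^-1 ^+ 2))%:E)%E).
    apply: ge0_le_integral => //.
    - by move=> F _; rewrite lee_fin ltW.
    - by apply/measurable_EFinP; apply: measurable_funTS; exact mk.
    - move=> F; rewrite /B /= in_itv/= => /andP[bF Fb]; rewrite lee_fin.
      rewrite ler_wpM2l ?(ltW e3)// lef_pV2 ?posrE.
      + rewrite lerD2r -(@real_normK _ (F - 1)) ?num_real// ler_sqr ?nnegrE//.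
        rewrite (le_trans (ler_normB _ _))// normr1 lerD2r ler_norml.
        by have := ler_norm b; lra.
      + by rewrite ltr_wpDl ?sqr_ge0// exprn_gt0.
      + by rewrite ltr_wpDl ?sqr_ge0// exprn_gt0.
  apply: ge0_subset_integral => //.
    by apply/measurable_EFinP; exact mk.
  by move=> F _; rewrite lee_fin poisson_kernel_ge0.
by case: (mu B) => [r _||]; rewrite ?ltry// gt0_muley ?lte_fin// leNgt ltry.
Qed.

Lemma spectral_densityP (A : set (measurableTypeR R)) :
  measurable A -> A `<=` `]0, +oo[ ->
  mu A = (\int[lebesgue_measure]_(E in A) (l E)%:E)%E.
Proof.
have sf : sigma_finite setT mu.
  exists (fun k : nat => [set` `](- (k%:R : R)), k%:R]%R]).
    by rewrite bigcup_itvT.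
  by move=> k; split; [exact: measurable_itv|exact: bounded_interval_fin].
(* [nu] is [mu] equipped with the sigma-finite structure just established. *)
pose nu_sf := isSFinite.Build _ _ _ mu (sfinite_measure_sigma_finite sf).
pose nu_sigma := isSigmaFinite.Build _ _ _ mu sf.
pose nu := HB.pack_for (SigmaFiniteMeasure.type (measurableTypeR R) R)
  (Measure.sort mu) nu_sf nu_sigma.
have muE : mu = nu by exact: eq_measure.
(* The density is controlled only on the positive axis; extension by 0 makes it measurable and
   nonnegative on the whole line. *)
pose l0 : R -> R := l \_ `]0, +oo[.
have l0_meas : measurable_fun [set: measurableTypeR R] l0.
  apply/(measurable_restrictT _ _).1 => //.
  apply: open_continuous_measurable_fun; first exact: interval_open.
  by move=> x; rewrite inE; exact: l_cont.
have l0_ge0 x : 0 <= l0 x.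
  by rewrite /l0 patchE; case: ifPn => //; rewrite inE/= in_itv/= andbT; exact: l_ge0.
have l0E x : 0 < x -> l0 x = l x.
  by move=> x0; rewrite /l0 patchE mem_set//= in_itv/= x0.
move=> mA A0; rewrite (@half_line_densityP _ mu l0)//.
- apply: eq_integral => x /set_mem /A0; rewrite /= in_itv/= andbT => x0.
  by rewrite l0E.
- move=> b; apply: le_lt_trans (bounded_interval_fin `|b|).
  apply: le_measure; rewrite ?inE; [exact: measurable_itv|exact: measurable_itv|].
  move=> x; rewrite /= !in_itv/= => /andP[x0 xb].
  have := ler_norm b; have := normr_ge0 b => b0 bb.
  by apply/andP; split; lra.
- move=> a b a0 ab.
  have := @stieltjes_inversion _ nu (fun E => pi * l E); rewrite -muE => inv.
  have pin : pi != 0 :> R by rewrite gt_eqF// pi_gt0.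
  have -> : mu [set` `]a, b]%R] = (pi^-1%:E * (pi%:E * mu [set` `]a, b]%R]))%E.
    by rewrite muleA -EFinM mulVf// mul1e.
  rewrite -inv//.
  rewrite -ge0_integralZl_EFin//.
  + apply: eq_integral => x /set_mem; rewrite /= in_itv/= => /andP[ax _].
    by rewrite -EFinM mulrA mulVf// mul1r l0E// (lt_le_trans a0).
  + move=> x; rewrite /= in_itv/= => /andP[ax _].
    by rewrite lee_fin mulr_ge0 ?pi_ge0// l_ge0// (lt_le_trans a0).
  + apply/measurable_EFinP; apply: measurable_funM => //.
    apply: subspace_continuous_measurable_fun; first exact: measurable_itv.
    apply: continuous_in_subspaceT => x; rewrite inE/= in_itv/= => /andP[ax _].
    by apply: l_cont; rewrite in_itv/= andbT (lt_le_trans a0).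
  + by rewrite invr_ge0 pi_ge0.
Qed.

End spectral_density.

(** * Extension from the half line and conclusion *)

Lemma continuous_halfline (R : realType) (f df : R -> R) :
  has_derivative_halfline f df -> continuous (fun x : R => f (Num.max x 0)).
Proof.
move=> [fd fd0] x; have [x0|x0|->] := ltgtP x 0.
- have : (fun=> f 0) t @[t --> x] --> f (Num.max x 0).
    by rewrite max_r ?(ltW x0)//; exact: cvg_cst.
  apply: cvg_trans; apply: near_eq_cvg; near=> t.
  rewrite max_r// ltW//; near: t; exact: (cvgr_lt x (@cvg_id _ (nbhs x)) _ x0).
- have [d _] := derive_max0 x0 (fd x x0).
  by apply: differentiable_continuous; apply/derivable1_diffP.
- apply/left_right_continuousP; rewrite maxxx; split.
    have : (fun=> f 0) t @[t --> (0 : R)^'-] --> f 0 by exact: cvg_cst.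
    apply: cvg_trans; apply: near_eq_cvg; near=> t.
    by rewrite max_r// ltW//; near: t; exact: nbhs_left_lt.
  have h0 : t @[t --> (0 : R)^'+] --> (0 : R) by exact: cvg_within.
  (* At 0 only the one-sided difference quotient is available; [f] is recovered from it, and its
     convergence forces continuity from the right. *)
  have : t * (t^-1 * (f t - f 0)) + f 0 @[t --> (0 : R)^'+] --> 0 * df 0 + f 0.
    by apply: cvgD; [exact: cvgM|exact: cvg_cst].
  rewrite mul0r add0r; apply: cvg_trans; apply: near_eq_cvg; near=> t.
  have t0 : 0 < t by near: t; exact: nbhs_right_gt.
  by rewrite mulVKf ?gt_eqF// subrK max_l// ltW.
Unshelve. all: by end_near. Qed.

Lemma dirichlet_solution_extend (R : realType) (V : R -> R) (E : R) (u : R -> R) :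
  dirichlet_solution V E u ->
  exists z : R -> R, [/\ solution (fun x : R => V (Num.max x 0)) E (fun x : R => u (Num.max x 0)) z,
    u (Num.max (0 : R) 0) = 0 & z 0 = 1].
Proof.
move=> [du [ddu [u1 u2 eq u0 du0]]]; exists (fun x : R => du (Num.max x 0)).
rewrite !maxxx; split => //; split.
- exact: continuous_halfline u1.
- exact: continuous_halfline u2.
- move=> x x0; have := derive_max0 x0 (u1.1 x x0); rewrite [in du (Num.max x 0)]max_l//.
  exact: ltW.
- move=> x x0; have := derive_max0 x0 (u2.1 x x0); rewrite !max_l ?(ltW x0)//.
  by have := eq x (ltW x0) => e; have -> : ddu x = (V x - E) * u x by lra.
Qed.

Lemma decaying_potential_extend (R : realType) (V dV : R -> R) :
  C1_halfline V dV -> (forall x : R, 0 <= x -> 0 < V x) ->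
  (forall x y : R, 0 <= x -> x < y -> V y < V x) ->
  (forall x : R, 0 <= x -> dV x < 0) -> V x @[x --> +oo] --> (0 : R) ->
  decaying_potential (fun x : R => V (Num.max x 0)) dV.
Proof.
move=> [V1 _] V0 Vd dV0 Vl; have m0 (x : R) : 0 <= Num.max x 0 by rewrite le_max lexx orbT.
split.
- exact: continuous_halfline V1.
- by move=> x; exact: V0.
- move=> x y xy; have : Num.max y 0 <= Num.max x 0.
    by rewrite ge_max !le_max xy lexx orbT.
  by rewrite le_eqVlt => /predU1P[->//|/(Vd _ _ (m0 y))/ltW].
- by move=> x x0; split; [exact: derive_max0 (V1.1 x x0)|rewrite ltW// dV0// ltW].
- move: Vl; apply: cvg_trans; apply: near_eq_cvg; near=> x.
  by rewrite max_l//; near: x; exact: nbhs_pinfty_ge.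
Unshelve. all: by end_near. Qed.

Theorem theorem4p1 (R : realType) (V dV : R -> R)
  (V_C1 : C1_halfline V dV)
  (V_gt0 : forall x : R, 0 <= x -> 0 < V x)
  (V_decr : forall x y : R, 0 <= x -> x < y -> V y < V x)
  (dV_lt0 : forall x : R, 0 <= x -> dV x < 0)
  (V_cvg0 : V x @[x --> +oo] --> (0 : R))
  (mu : {measure set (measurableTypeR R) -> \bar R})
  (mu_spectral : spectral_measure V mu)
  (N : R -> R)
  (N_inv : forall E : R, 0 < E < V 0 -> 0 <= N E /\ V (N E) = E) :
  exists Q : R -> R,
    [/\ {in `]0, +oo[, continuous Q},
        forall A : set (measurableTypeR R), measurable A -> A `<=` `]0, +oo[ ->
          mu A = (\int[lebesgue_measure]_(E in A) (expR (- (2 * Q E)))%:E)%E &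
        forall E0 : R, 0 < E0 < V 0 ->
          exists (C : R) (h : R -> R), forall E : R, 0 < E <= E0 ->
            expR (h E) =
              C * N E * (V (N E) - V (N E + 1))^-1 * Num.sqrt E /\
            `|Q E - \int[lebesgue_measure]_(x in `[0, N E])
                      Num.sqrt (V x - E)| <= h E].
Proof.
pose V' (x : R) := V (Num.max x 0).
have V'E x : 0 <= x -> V' x = V x by move=> x0; rewrite /V' max_l.
have V_dec : decaying_potential V' dV by exact: decaying_potential_extend.
have V_strict x y : 0 <= x -> x < y -> V' y < V' x.
  by move=> x0 xy; rewrite !V'E ?V_decr// (le_trans x0)// ltW.
have [u u_sol par] := spectral_parseval mu_spectral.
have [z zP] := choice (fun E => dirichlet_solution_extend (u_sol E)).
pose w E (x : R) := u E (Num.max x 0).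
have sol E : solution V' E (w E) (z E) by have [] := zP E.
have w0 E : w E 0 = 0 by have [] := zP E.
have z0 E : z E 0 = 1 by have [] := zP E.
have parseval (f : R -> R) (b : R) : continuous f ->
  exists phi : R -> R, [/\ measurable_fun setT phi,
    {ae mu, forall E, phi E = intR 0 b (fun x => f x * w E x)} &
    (\int[mu]_E (phi E ^+ 2)%:E = (intR 0 b (fun x => f x ^+ 2))%:E)%E].
  move=> /(par _ b)[phi [mphi aephi iphi]]; exists phi; split => //.
  apply: filterS aephi => [|E ->]; first exact: (ae_filter_ringOfSetsType mu).
  apply: eq_Rintegral => x /set_mem; rewrite /= in_itv/= => /andP[x0 _].
  by rewrite /w max_l.
pose K E := energy_limit V' E (w E) (z E).
have K_gt0 E : 0 < E -> 0 < K E.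
  by move=> E0; exact (energy_limit_gt0 V_dec E0 (sol E) (w0 E) (z0 E)).
(* The solution of [expR (- (2 * Q E)) = Num.sqrt E / (pi * K E)]. *)
pose Q E := ln (pi * K E / Num.sqrt E) / 2.
have A_gt0 E : 0 < E -> 0 < pi * K E / Num.sqrt E.
  by move=> E0; rewrite divr_gt0 ?sqrtr_gt0// mulr_gt0 ?pi_gt0 ?K_gt0.
have Q_cont : {in `]0, +oo[, continuous Q}.
  move=> E EI; have := EI; rewrite in_itv/= andbT => E0.
  apply: cvgM; last exact: cvg_cst.
  apply: (@continuous_cvg _ _ _ _ _ (fun E => pi * K E / Num.sqrt E) (@ln R)).
    exact: continuous_ln (A_gt0 E E0).
  apply: cvgM; last first.
    by apply: cvgV; [rewrite gt_eqF// sqrtr_gt0|exact: sqrt_continuous].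
  apply: cvgM; first exact: cvg_cst.
  exact (energy_limit_continuous V_dec sol w0 z0 EI).
pose l E := expR (- (2 * Q E)).
have lE E : 0 < E -> pi * l E = Num.sqrt E / K E.
  move=> E0; have kn : Num.sqrt E != 0 by rewrite gt_eqF// sqrtr_gt0.
  have Kn : K E != 0 by rewrite gt_eqF// K_gt0.
  rewrite /l /Q expRN [2 * _]mulrC divfK ?pnatr_eq0// lnK ?posrE ?A_gt0//.
  have aux (p q r : R) : p != 0 -> q != 0 -> r != 0 -> p * (p * q / r)^-1 = r / q.
    by move=> p0 q0 r0; field; rewrite q0 r0.
  by apply: aux => //; rewrite gt_eqF// pi_gt0.
exists Q; split => //.
- move=> A mA A0; apply: (@spectral_densityP _ mu l) => //.
  + exact: (poisson_bounded V_dec sol w0 z0 parseval).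
  + move=> E E0; rewrite lE//.
    exact (poisson_cvg V_dec sol w0 z0 parseval E0).
  + move=> E EI; rewrite /l; apply: cvg_expR; apply: cvgN; apply: cvgM; first exact: cvg_cst.
    exact: Q_cont.
  + by move=> E _; exact: expR_ge0.
- move=> E0 /andP[E00 E0V].
  have E0I : 0 < E0 < V 0 by rewrite E00.
  (* Since [V] decreases, [x0] bounds [N E] from below for all [E <= E0], and [E0 < V 0] makes it
     positive. All constants below depend only on [x0], [E0] and [V 0]. *)
  have [x00 Vx0] := N_inv E0 E0I; pose x0 := N E0.
  have x0_gt0 : 0 < x0.
    rewrite lt_neqAle x00 andbT; apply/eqP => e.
    by move: E0V; rewrite -[ltLHS]Vx0 -/x0 -e ltxx.
  pose m := 1 + V' 0; pose c := 1 + 2 * V' 0.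
  pose c1 := expR (- c) * x0 ^+ 2 * expR (- (x0 * Num.sqrt (V' 0))) ^+ 2 / m.
  pose c2 := expR c * m * (1 + x0 ^- 2).
  pose C := 1 + pi * c2 * Num.sqrt E0 + Num.sqrt E0 / (pi * c1 * x0 ^+ 2).
  exists C, (fun E => ln (C * N E * (V (N E) - V (N E + 1))^-1 * Num.sqrt E)).
  move=> E /andP[E_gt0 EE0].
  have EI : 0 < E < V 0 by rewrite E_gt0 (le_lt_trans EE0).
  have [NE0 VN] := N_inv E EI.
  have x0N : x0 <= N E.
    rewrite leNgt; apply/negP => /(V_decr _ _ NE0).
    by rewrite VN Vx0 ltNge EE0.
  have N_gt0 : 0 < N E by exact: lt_le_trans x0N.
  have V'N : V' (N E) = E by rewrite V'E.
  have [lo hi] := energy_limit_tunnelling V_dec V_strict (sol E) (w0 E) (z0 E)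
    x0_gt0 x0N V'N.
  have V'N1 : V' (N E + 1) = V (N E + 1) by rewrite V'E// addr_ge0.
  have actionE : intR 0 (N E) (fun x => Num.sqrt (V' x - E)) =
      intR 0 (N E) (fun x => Num.sqrt (V x - E)).
    apply: eq_Rintegral => x /set_mem; rewrite /= in_itv/= => /andP[xge0 _].
    by rewrite V'E.
  rewrite V'N1 actionE in lo hi.
  have d_gt0 : 0 < E - V (N E + 1) by rewrite subr_gt0 -[ltRHS]VN V_decr// ltrDl.
  have V'0 : 0 < V' 0 by rewrite V'E// V_gt0.
  have m_gt0 : 0 < m by rewrite addr_gt0.
  have s_gt0 : 0 < Num.sqrt E by rewrite sqrtr_gt0.
  have sE : Num.sqrt E ^+ 2 = E by rewrite sqr_sqrtr// ltW.
  have d_le : E - V (N E + 1) <= Num.sqrt E ^+ 2.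
    by rewrite sE lerBlDr lerDl ltW// V_gt0// addr_ge0.
  have s_le : Num.sqrt E <= Num.sqrt E0 by exact: ler_wsqrtr.
  have c1_gt0 : 0 < c1 by rewrite divr_gt0// !mulr_gt0 ?exprn_gt0 ?expR_gt0.
  have c2_gt0 : 0 < c2.
    by rewrite !mulr_gt0 ?expR_gt0// addr_gt0// invr_gt0 exprn_gt0.
  have hi' : K E <= c2 * (Num.sqrt E ^+ 2 * N E ^+ 2 / (E - V (N E + 1))) *
      expR (intR 0 (N E) (fun x => Num.sqrt (V x - E))) ^+ 2.
    by rewrite sE; exact: hi.
  have [T0 final] := wkb_logarithm (K_gt0 E E_gt0) x0_gt0 x0N d_gt0 d_le s_gt0 s_le
    c1_gt0 c2_gt0 lo hi'.
  rewrite VN; split; last exact: final.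
  by rewrite lnK.
Qed.
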